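(* There is a deterministic fully dynamic algorithm that, on a graph whose maximum degree is at most $\Delta$ at all times, maintains a proper vertex coloring using $(1+o(1))\Delta$ colors with amortized update time $O\!\left(\log^{4+o(1)}\Delta/(\log\log\Delta)^2\right)$.
   Context: Dynamic setting: fixed vertex set, the graph starts with no edges and undergoes a sequence of edge insertions and deletions; the bound $\Delta$ on the maximum degree is known to the algorithm. After each update the coloring must be proper (adjacent vertices receive different colors). The $o(1)$ is with respect to $\Delta\to\infty$. Amortized update time $\alpha$ means the total time for the first $t$ updates is at most $\alpha t$ for every $t$. *)

(* Defs.v *)
From Stdlib Require Import Reals Lia List Arith.
Import ListNotations.
Open Scope R_scope.

(* Memory: cells indexed by nat holding w-bit words (values < 2^w).
   Operands of instructions are (constant) cell addresses; indirect
   addressing is provided by ILoad / IStore. *)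
Inductive instr : Type :=
| IConst (d k : nat)
| IAdd (d a b : nat)
| ISub (d a b : nat)
| IMul (d a b : nat)
| IDiv (d a b : nat)            (* M[d] := M[a] / M[b]  (0 if M[b]=0) *)
| IAnd (d a b : nat) | IOr (d a b : nat) | IXor (d a b : nat)
| IShl (d a b : nat)
| IShr (d a b : nat)
| ILoad (d a : nat)
| IStore (a b : nat)
| IJlt (a b l : nat)
| IJmp (l : nat)
| IHalt.

Definition program := list instr.
Definition memory := nat -> nat.

Definition upd (m : memory) (a v : nat) : memory :=
  fun x => if Nat.eqb x a then v else m x.

Definition step (P : program) (w : nat) (pc : nat) (m : memory)
  : option (nat * memory) :=
  let W := (2 ^ w)%nat in
  match nth pc P IHalt with
  | IConst d k => Some (S pc, upd m d (k mod W))
  | IAdd d a b => Some (S pc, upd m d ((m a + m b) mod W))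
  | ISub d a b => Some (S pc, upd m d ((m a + W - m b mod W) mod W))
  | IMul d a b => Some (S pc, upd m d ((m a * m b) mod W))
  | IDiv d a b => Some (S pc, upd m d (m a / m b))
  | IAnd d a b => Some (S pc, upd m d (Nat.land (m a) (m b)))
  | IOr d a b => Some (S pc, upd m d (Nat.lor (m a) (m b)))
  | IXor d a b => Some (S pc, upd m d (Nat.lxor (m a) (m b)))
  | IShl d a b => Some (S pc, upd m d ((Nat.shiftl (m a) (m b)) mod W))
  | IShr d a b => Some (S pc, upd m d (Nat.shiftr (m a) (m b)))
  | ILoad d a => Some (S pc, upd m d (m (m a)))
  | IStore a b => Some (S pc, upd m (m a) (m b))
  | IJlt a b l => Some (if Nat.ltb (m a) (m b) then l else S pc, m)
  | IJmp l => Some (l, m)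
  | IHalt => None
  end.

Inductive Exec (P : program) (w : nat) : nat -> memory -> nat -> memory -> Prop :=
| Exec_halt pc m : step P w pc m = None -> Exec P w pc m 0 m
| Exec_step pc m pc' m' k m'' :
    step P w pc m = Some (pc', m') -> Exec P w pc' m' k m'' ->
    Exec P w pc m (S k) m''.

Record update := mkUpdate { ins : bool; eu : nat; ev : nat }.

Definition same_pair (x y : nat) (e : update) : bool :=
  (Nat.eqb (eu e) x && Nat.eqb (ev e) y) || (Nat.eqb (eu e) y && Nat.eqb (ev e) x).

Definition edge (s : list update) (x y : nat) : bool :=
  fold_left (fun b e => if same_pair x y e then ins e else b) s false.

Definition degree (n : nat) (s : list update) (x : nat) : nat :=
  length (filter (fun y => edge s x y) (seq 0 n)).

Definition valid_seq (n Delta : nat) (s : list update) : Prop :=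
  forall t, (t < length s)%nat ->
    let pre := firstn t s in
    let e := nth t s (mkUpdate false 0 0) in
    (eu e < n)%nat /\ (ev e < n)%nat /\ eu e <> ev e /\
    edge pre (eu e) (ev e) = negb (ins e) /\
    (forall x, (x < n)%nat -> (degree n (firstn (S t) s) x <= Delta)%nat).

(* Before each update, cells 0..4 receive n, Δ, the update kind (1 = insert,
   0 = delete) and the two endpoints; the program is then run from pc 0
   until it halts.  The color of vertex x is (by convention) cell color_cell x. *)
Definition color_cell (x : nat) : nat := (8 + x)%nat.

Definition load_input (m : memory) (n Delta : nat) (e : update) : memory :=
  upd (upd (upd (upd (upd m 0 n) 1 Delta) 2 (if ins e then 1 else 0)) 3 (eu e)) 4 (ev e).

Definition init_mem : memory := fun _ => 0%nat.

Definition word_size (c n Delta : nat) : nat :=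
  ((c + 1) * (Nat.log2 (n + Delta + 2) + 1))%nat.

Inductive Session (P : program) (w n Delta : nat) : list update -> memory -> nat -> Prop :=
| Session_nil : Session P w n Delta [] init_mem 0
| Session_snoc s m c e k m' :
    Session P w n Delta s m c ->
    Exec P w 0 (load_input m n Delta e) k m' ->
    Session P w n Delta (s ++ [e]) m' (c + k).

Definition proper_coloring (n : nat) (s : list update) (col : nat -> nat) : Prop :=
  forall x y, (x < n)%nat -> (y < n)%nat -> edge s x y = true -> col x <> col y.

Definition time_bound (delta : nat -> R) (Delta : nat) : R :=
  Rpower (ln (INR Delta)) (4 + delta Delta) / (ln (ln (INR Delta))) ^ 2.

(* Main.v *)
(* A colour is a number written in mixed radix: digits 1..L in base lam (polylogarithmic in
   Delta) and a last digit with base slightly larger than the final threshold.  The level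
   graph G_j consists of the edges whose endpoints share the first j digits, and every vertex v
   is required to have degree at most D_j in G_j, where D_0 = Delta, D_j is a factor lam
   smaller than D_(j-1) up to a small relative slack, and D_(L+1) = 0.  So G_(L+1) has no edge,
   which is properness, and the product of the bases is (1 + o(1)) Delta.

   When v exceeds D_i, for the least such i, its digits i, i+1, .. are rechosen one after the
   other, each time taking the least frequent digit among the neighbours sharing the prefix.
   By averaging v then stays below D_j by the slack at every level j >= i.  Hence the number of
   edges in G_i drops by more than the slack of level i, and since thresholds decrease
   geometrically with a large ratio the edges created at deeper levels number at most half of
   that.  The total number of edges over all level graphs is therefore a potential which an
   update increases by O(L) and which pays for all recolourings. *)

Require Import Defs.
From Stdlib Require Import Reals Lra Lia List Arith.
Import ListNotations.
Open Scope nat_scope.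

(** * A while language and its compiler *)

(** The slack of level i is about a [TT]-th part of D_(i-1), whereas rechoosing digit i scans up to
    D_(i-1) neighbours. So every removed edge must carry time of order [TT], that is (log Delta
    loglog Delta)^2. An update adds at most one edge to each of the O(log Delta) level graphs, which
    gives amortised time O(log^3 Delta (loglog Delta)^2). For large Delta this lies below log^4
    Delta / (loglog Delta)^2, so the correction of the exponent is taken to be 0.

    Averaging from level i on needs v to be within D_(i-1), which is why the least exceeded level is
    treated; for i = 1 this is the promise on the degrees. Only a vertex that gains an edge can
    newly exceed a threshold, so a stack of such vertices spares any search.

    The claim is about a machine with bounded words. The procedure is written in a structured
    language whose executions exist only when nothing overflows, so correctness and time are argued
    over the naturals; compilation costs a constant factor. *)

Inductive bop := OAdd | OSub | OMul | ODiv | OXor.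

Inductive expr :=
| EC (k : nat)
| EV (x : nat)
| EOp (o : bop) (a b : expr)
| EL (t : nat) (i j k : expr).

Inductive com :=
| Skip
| Asg (x : nat) (e : expr)
| Sto (t : nat) (i j k e : expr)
| Seq (c1 c2 : com)
| If (a b : expr) (c1 c2 : com)
| While (a b : expr) (c : com).

Record st := mkSt { vr : nat -> nat; ar : nat -> nat -> nat -> nat -> nat }.

Definition setv (s : st) (x v : nat) : st :=
  mkSt (fun y => if y =? x then v else vr s y) (ar s).

Definition seta (s : st) (t i j k v : nat) : st :=
  mkSt (vr s) (fun t' i' j' k' =>
    if t' =? t then if i' =? i then if j' =? j then if k' =? k then v
    else ar s t' i' j' k' else ar s t' i' j' k' else ar s t' i' j' k'
    else ar s t' i' j' k').

Definition bev (o : bop) (a b : nat) : nat :=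
  match o with
  | OAdd => a + b | OSub => a - b | OMul => a * b | ODiv => a / b
  | OXor => Nat.lxor a b
  end.

Fixpoint eval (e : expr) (s : st) : nat :=
  match e with
  | EC k => k
  | EV x => vr s x
  | EOp o a b => bev o (eval a s) (eval b s)
  | EL t i j k => ar s t (eval i s) (eval j s) (eval k s)
  end.

(* Cells below [TMP] are the variables, those from [TMP] to [RR] hold temporaries.
   For 8 <= x < RR a cell x is thus a register although it is also a colour cell:
   the true colours live in an array, and the epilogue copies them back.  Variable 5
   permanently holds [N = n + Delta + 2], the radix of array addresses. *)
Definition TMP := 40.
Definition RR := 64.

Definition addr (N t i j k : nat) : nat := ((t * N + i) * N + j) * N + k.

(** Under these conditions the machine result modulo [W] is the result over the naturals. Quotients
    and xors are not reduced by the machine, so they carry no condition. *)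
Definition bok (W : nat) (o : bop) (a b : nat) : Prop :=
  match o with
  | OAdd => a + b < W
  | OSub => b <= a /\ a < W
  | OMul => a * b < W
  | ODiv | OXor => True
  end.

Definition idxok (N W t i j k : nat) : Prop :=
  i < N /\ j < N /\ k < N /\ RR <= addr N t i j k /\ addr N t i j k < W.

Fixpoint okx (N W : nat) (e : expr) (s : st) : Prop :=
  match e with
  | EC k => k < W
  | EV x => True
  | EOp o a b => okx N W a s /\ okx N W b s /\ bok W o (eval a s) (eval b s)
  | EL t i j k => okx N W i s /\ okx N W j s /\ okx N W k s
      /\ idxok N W t (eval i s) (eval j s) (eval k s)
  end.

(* The natural number is the number of atomic commands and tests executed. *)
Inductive exec (N W : nat) : com -> st -> nat -> st -> Prop :=
| X_skip s : exec N W Skip s 0 s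
| X_asg x e s : okx N W e s -> exec N W (Asg x e) s 1 (setv s x (eval e s))
| X_sto t i j k e s :
    okx N W (EL t i j k) s -> okx N W e s ->
    exec N W (Sto t i j k e) s 1
      (seta s t (eval i s) (eval j s) (eval k s) (eval e s))
| X_seq c1 c2 s t1 s1 t2 s2 :
    exec N W c1 s t1 s1 -> exec N W c2 s1 t2 s2 ->
    exec N W (Seq c1 c2) s (t1 + t2) s2
| X_ift a b c1 c2 s t s' :
    okx N W a s -> okx N W b s -> eval a s < eval b s ->
    exec N W c1 s t s' -> exec N W (If a b c1 c2) s (S t) s'
| X_iff a b c1 c2 s t s' :
    okx N W a s -> okx N W b s -> eval b s <= eval a s ->
    exec N W c2 s t s' -> exec N W (If a b c1 c2) s (S t) s'
| X_while0 a b c s :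
    okx N W a s -> okx N W b s -> eval b s <= eval a s ->
    exec N W (While a b c) s 1 s
| X_while1 a b c s t1 s1 t2 s2 :
    okx N W a s -> okx N W b s -> eval a s < eval b s ->
    exec N W c s t1 s1 -> exec N W (While a b c) s1 t2 s2 ->
    exec N W (While a b c) s (S (t1 + t2)) s2.

Definition opi (o : bop) (d a b : nat) : instr :=
  match o with
  | OAdd => IAdd d a b | OSub => ISub d a b | OMul => IMul d a b
  | ODiv => IDiv d a b | OXor => IXor d a b
  end.

Definition cop (o : bop) (ca cb : list instr) (d : nat) : list instr :=
  ca ++ cb ++ [opi o d d (S d)].

Definition caddr (t : nat) (ci cj ck : list instr) (d : nat) : list instr :=
  let cN := [IOr (S d) 5 5] in
  cop OAdd (cop OMul (cop OAdd (cop OMul (cop OAdd (cop OMul [IConst d t] cN d)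
    ci d) cN d) cj d) cN d) ck d.

Fixpoint ce (e : expr) (d : nat) : list instr :=
  match e with
  | EC k => [IConst d k]
  | EV x => [IOr d x x]
  | EOp o a b => cop o (ce a d) (ce b (S d)) d
  | EL t i j k => caddr t (ce i (S d)) (ce j (S d)) (ce k (S d)) d ++ [ILoad d d]
  end.

Fixpoint cc (c : com) (base : nat) : list instr :=
  match c with
  | Skip => []
  | Asg x e => ce e TMP ++ [IOr x TMP TMP]
  | Sto t i j k e =>
      caddr t (ce i (S TMP)) (ce j (S TMP)) (ce k (S TMP)) TMP
      ++ ce e (S TMP) ++ [IStore TMP (S TMP)]
  | Seq c1 c2 => let l1 := cc c1 base in l1 ++ cc c2 (base + length l1)
  | If a b c1 c2 =>
      let t := ce a TMP ++ ce b (S TMP) in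
      let b2 := base + length t + 1 in
      let l2 := cc c2 b2 in
      let b1 := b2 + length l2 + 1 in
      let l1 := cc c1 b1 in
      t ++ IJlt TMP (S TMP) b1 :: l2 ++ IJmp (b1 + length l1) :: l1
  | While a b c =>
      let t := ce a TMP ++ ce b (S TMP) in
      let b1 := base + length t + 2 in
      let l1 := cc c b1 in
      t ++ IJlt TMP (S TMP) b1 :: IJmp (b1 + length l1 + 1) :: l1 ++ [IJmp base]
  end.

(** Bounds the number of temporaries used by [ce], counted from its target cell. *)
Fixpoint edepth (e : expr) : nat :=
  match e with
  | EC _ | EV _ => 1
  | EOp _ a b => Nat.max (edepth a) (S (edepth b))
  | EL _ i j k => S (S (Nat.max (edepth i) (Nat.max (edepth j) (edepth k))))
  end.

Fixpoint ewf (e : expr) : bool :=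
  match e with
  | EC _ => true
  | EV x => x <? TMP
  | EOp _ a b => ewf a && ewf b
  | EL _ i j k => ewf i && ewf j && ewf k
  end.

(** There are [RR - TMP = 24] temporaries, so 20 leaves room for a start at [TMP] or [S TMP]. *)
Definition ewfd (e : expr) : bool := ewf e && (edepth e <? 20).

Fixpoint cwf (c : com) : bool :=
  match c with
  | Skip => true
  | Asg x e => (x <? TMP) && negb (x =? 5) && ewfd e
  | Sto t i j k e => ewfd (EL t i j k) && ewfd e
  | Seq c1 c2 => cwf c1 && cwf c2
  | If a b c1 c2 => ewfd a && ewfd b && cwf c1 && cwf c2
  | While a b c => ewfd a && ewfd b && cwf c
  end.

(** Machine instructions per unit of [exec] time. It depends on the program alone, which is why
    compilation costs a constant factor. *)
Fixpoint kmax (c : com) : nat :=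
  match c with
  | Skip => 0
  | Asg x e => length (ce e TMP) + 1
  | Sto t i j k e => length (cc c 0)
  | Seq c1 c2 => Nat.max (kmax c1) (kmax c2)
  | If a b c1 c2 => (length (ce a TMP) + length (ce b (S TMP)) + 2) + (kmax c1 + kmax c2)
  | While a b c => (length (ce a TMP) + length (ce b (S TMP)) + 2) + kmax c
  end.

(** Unlike [Exec], which must end in a halt, this relation may stop at any program counter and
    therefore composes. *)
Inductive run (P : program) (w : nat) : nat -> memory -> nat -> nat -> memory -> Prop :=
| run_0 pc m : run P w pc m 0 pc m
| run_S pc m pc1 m1 k pc2 m2 :
    step P w pc m = Some (pc1, m1) -> run P w pc1 m1 k pc2 m2 ->
    run P w pc m (S k) pc2 m2.

Lemma run_trans P w pc m k1 pc1 m1 k2 pc2 m2 :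
  run P w pc m k1 pc1 m1 -> run P w pc1 m1 k2 pc2 m2 ->
  run P w pc m (k1 + k2) pc2 m2.
Proof.
  intros H1 H2. induction H1; simpl; auto. econstructor; eauto.
Qed.

Lemma run_1 P w pc m pc1 m1 :
  step P w pc m = Some (pc1, m1) -> run P w pc m 1 pc1 m1.
Proof. intros H. econstructor; [eassumption | constructor]. Qed.

Lemma run_Exec P w pc m k1 pc1 m1 k2 m2 :
  run P w pc m k1 pc1 m1 -> Exec P w pc1 m1 k2 m2 ->
  Exec P w pc m (k1 + k2) m2.
Proof.
  intros H1 H2. induction H1; simpl; auto. econstructor; eauto.
Qed.

Definition code_at (P : program) (base : nat) (l : list instr) : Prop :=
  forall i, i < length l -> nth (base + i) P IHalt = nth i l IHalt.

Lemma code_at_app P base l1 l2 :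
  code_at P base (l1 ++ l2) -> code_at P base l1 /\ code_at P (base + length l1) l2.
Proof.
  intros H. split; intros i Hi.
  - rewrite H by (rewrite length_app; lia). now rewrite app_nth1.
  - rewrite <- Nat.add_assoc, H by (rewrite length_app; lia).
    rewrite app_nth2 by lia. f_equal. lia.
Qed.

Lemma code_at_cons P base a l :
  code_at P base (a :: l) -> nth base P IHalt = a /\ code_at P (S base) l.
Proof.
  intros H. split.
  - specialize (H 0). simpl in H. rewrite Nat.add_0_r in H. apply H. lia.
  - intros i Hi. specialize (H (S i)). simpl in H.
    rewrite Nat.add_succ_r in H. apply H. lia.
Qed.

(** Uniqueness of digits in base [N], peeled off from the last; this keeps different array entries
    in different cells. *)
Lemma addr_inj N t i j k t' i' j' k' :
  i < N -> j < N -> k < N -> i' < N -> j' < N -> k' < N ->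
  addr N t i j k = addr N t' i' j' k' -> t = t' /\ i = i' /\ j = j' /\ k = k'.
Proof.
  unfold addr. intros ? ? ? ? ? ? E.
  assert (Hd : forall a b a' b', b < N -> b' < N -> a * N + b = a' * N + b' -> a = a' /\ b = b').
  { intros a b a' b' Hb Hb' E'. apply (Nat.div_mod_unique N); try lia. }
  apply Hd in E as [E ->]; auto. apply Hd in E as [E ->]; auto.
  apply Hd in E as [E ->]; auto.
Qed.

(** Arrays are tied to memory only from [RR] on: below that, tag 0 would alias the registers. *)
Definition Rel (N : nat) (s : st) (m : memory) : Prop :=
  (forall x, x < TMP -> m x = vr s x) /\ vr s 5 = N /\
  (forall t i j k, i < N -> j < N -> k < N -> RR <= addr N t i j k ->
     m (addr N t i j k) = ar s t i j k).

(** Only the temporaries from [d] up to [RR] may change, so that evaluation into [d] behaves like a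
    stack. *)
Definition same_but (d : nat) (m m' : memory) : Prop :=
  (forall x, x < d -> m' x = m x) /\ (forall x, RR <= x -> m' x = m x).

Lemma same_but_Rel N s d m m' :
  TMP <= d -> same_but d m m' -> Rel N s m -> Rel N s m'.
Proof.
  intros Hd [H1 H2] (R1 & R2 & R3). split; [|split]; auto.
  - intros x Hx. rewrite H1 by lia. auto.
  - intros. rewrite H2 by lia. auto.
Qed.

Lemma same_but_trans d d' m m1 m2 :
  d <= d' -> same_but d m m1 -> same_but d' m1 m2 -> same_but d m m2.
Proof.
  intros Hd [H1 H2] [H3 H4]. split; intros x Hx.
  - rewrite H3 by lia. auto.
  - rewrite H4 by lia. auto.
Qed.

Lemma same_but_upd d m v : TMP <= d < RR -> same_but d m (upd m d v).
Proof.
  intros Hd. split; intros x Hx; unfold upd; destruct (Nat.eqb_spec x d); auto; lia.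
Qed.

Section Compiler.
Variables (P : program) (w N : nat).
Let W := 2 ^ w.

Definition Comp (s : st) (code : list instr) (d v : nat) : Prop :=
  forall base m, code_at P base code -> Rel N s m ->
  exists m', run P w base m (length code) (base + length code) m'
    /\ m' d = v /\ same_but d m m'.

Lemma upd_same m a v : upd m a v a = v.
Proof. unfold upd. now rewrite Nat.eqb_refl. Qed.

Lemma Comp_const s d k : TMP <= d < RR -> k < W -> Comp s [IConst d k] d k.
Proof.
  intros Hd Hk base m HP HR. apply code_at_cons in HP as [HP _].
  exists (upd m d k). simpl. rewrite Nat.add_1_r. split; [|split].
  - apply run_1. unfold step. rewrite HP. now rewrite Nat.mod_small.
  - apply upd_same.
  - now apply same_but_upd.
Qed.

Lemma Comp_var s d x : TMP <= d < RR -> x < TMP -> Comp s [IOr d x x] d (vr s x).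
Proof.
  intros Hd Hx base m HP HR. apply code_at_cons in HP as [HP _].
  exists (upd m d (vr s x)). simpl. rewrite Nat.add_1_r. split; [|split].
  - apply run_1. unfold step. rewrite HP, Nat.lor_diag.
    destruct HR as [HR _]. now rewrite HR.
  - apply upd_same.
  - now apply same_but_upd.
Qed.

(** The second operand is computed from [S d] on, hence the first one survives in [d]. *)
Lemma Comp_op s o ca cb d va vb :
  TMP <= d < RR -> Comp s ca d va -> Comp s cb (S d) vb -> bok W o va vb ->
  Comp s (cop o ca cb d) d (bev o va vb).
Proof.
  intros Hd Ha Hb Hok base m HP HR. unfold cop in *.
  apply code_at_app in HP as [HPa HP]. apply code_at_app in HP as [HPb HP].
  apply code_at_cons in HP as [HP _].
  destruct (Ha _ _ HPa HR) as (m1 & r1 & v1 & s1).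
  assert (HR1 : Rel N s m1) by (refine (same_but_Rel _ _ _ _ _ _ s1 HR); lia).
  destruct (Hb _ _ HPb HR1) as (m2 & r2 & v2 & s2).
  exists (upd m2 d (bev o va vb)). split; [|split].
  - rewrite !length_app. cbn [length].
    replace (base + (length ca + (length cb + 1)))
      with (S (base + length ca + length cb)) by lia.
    eapply run_trans; [eassumption|]. eapply run_trans; [eassumption|].
    apply run_1. unfold step. rewrite HP.
    assert (E : m2 d = va) by (destruct s2 as [s2 _]; rewrite s2; auto).
    destruct o; simpl in Hok |- *; rewrite E, v2; fold W; auto;
      try (rewrite Nat.mod_small by lia; auto).
    (* Only subtraction is left: the machine adds [W] before subtracting, and since [vb <= va] this
       [W] disappears modulo [W]. *)
    rewrite (Nat.mod_small vb) by lia.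
    replace (va + W - vb) with (va - vb + 1 * W) by lia.
    rewrite Nat.Div0.mod_add, Nat.mod_small by lia. auto.
  - apply upd_same.
  - eapply same_but_trans; [|eassumption|]; [reflexivity|].
    eapply (same_but_trans d d); [lia| |apply same_but_upd; auto].
    destruct s2 as [sa sb]. split; auto.
Qed.

(** Horner's scheme: each intermediate value is at most the final address, so bounding the latter
    excludes every overflow on the way. *)
Lemma Comp_addr s t ci cj ck d vi vj vk :
  TMP <= d -> S d < RR -> vr s 5 = N -> t < W ->
  Comp s ci (S d) vi -> Comp s cj (S d) vj -> Comp s ck (S d) vk ->
  0 < N -> addr N t vi vj vk < W ->
  Comp s (caddr t ci cj ck d) d (addr N t vi vj vk).
Proof.
  intros Hd Hd' HN Ht Hi Hj Hk Np HA. unfold caddr, addr in *.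
  assert (HcN : Comp s [IOr (S d) 5 5] (S d) N).
  { rewrite <- HN. apply Comp_var; unfold TMP in *; lia. }
  assert (Hm : forall x, x <= x * N) by (intros; nia).
  assert (H1 := Hm t). assert (H2 := Hm (t * N + vi)).
  assert (H3 := Hm ((t * N + vi) * N + vj)).
  refine (Comp_op _ OAdd _ _ _ _ _ _ _ Hk _); try lia; [|simpl; lia].
  refine (Comp_op _ OMul _ _ _ _ _ _ _ HcN _); try lia; [|simpl; lia].
  refine (Comp_op _ OAdd _ _ _ _ _ _ _ Hj _); try lia; [|simpl; lia].
  refine (Comp_op _ OMul _ _ _ _ _ _ _ HcN _); try lia; [|simpl; lia].
  refine (Comp_op _ OAdd _ _ _ _ _ _ _ Hi _); try lia; [|simpl; lia].
  refine (Comp_op _ OMul _ _ _ _ _ _ _ HcN _); try lia; [|simpl; lia].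
  apply Comp_const; lia.
Qed.

Lemma idxok_lt t i j k : idxok N W t i j k -> t < W.
Proof.
  unfold idxok, addr. intros (? & ? & ? & ? & ?).
  assert (Hm : forall x, x <= x * N) by (intros; nia).
  assert (A1 := Hm t). assert (A2 := Hm (t * N + i)).
  assert (A3 := Hm ((t * N + i) * N + j)). lia.
Qed.

Lemma ce_correct s e : forall d, TMP <= d -> d + edepth e < RR -> vr s 5 = N ->
  ewf e = true -> okx N W e s -> Comp s (ce e d) d (eval e s).
Proof.
  induction e as [k | x | o a IHa b IHb | t i IHi j IHj k IHk]; cbn [ce eval okx ewf edepth];
    intros d Hd Hdep H5 Hwf Hok.
  - apply Comp_const; auto; lia.
  - apply Comp_var; [lia|]. now apply Nat.ltb_lt.
  - apply andb_prop in Hwf as [? ?]. destruct Hok as (? & ? & ?).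
    apply Comp_op; auto; [lia | apply IHa; auto; lia | apply IHb; auto; lia].
  - apply andb_prop in Hwf as [Hwf ?]. apply andb_prop in Hwf as [? ?].
    destruct Hok as (? & ? & ? & Hidx).
    assert (Ht := idxok_lt _ _ _ _ Hidx).
    destruct Hidx as (? & ? & ? & ? & ?).
    assert (HC : Comp s (caddr t (ce i (S d)) (ce j (S d)) (ce k (S d)) d) d
      (addr N t (eval i s) (eval j s) (eval k s))).
    { apply Comp_addr; auto; try lia; [apply IHi | apply IHj | apply IHk]; auto; lia. }
    intros base m HP HR. apply code_at_app in HP as [HPa HP].
    apply code_at_cons in HP as [HP _].
    destruct (HC _ _ HPa HR) as (m1 & r1 & v1 & s1).
    assert (HR1 : Rel N s m1) by (refine (same_but_Rel _ _ _ _ _ _ s1 HR); auto).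
    exists (upd m1 d (ar s t (eval i s) (eval j s) (eval k s))). split; [|split].
    + rewrite length_app. cbn [length]. rewrite Nat.add_assoc.
      eapply run_trans; [eassumption|]. rewrite Nat.add_1_r.
      apply run_1. unfold step. rewrite HP, v1.
      destruct HR1 as (_ & _ & HR1). now rewrite HR1.
    + apply upd_same.
    + eapply same_but_trans; [|eassumption|]; [reflexivity|].
      apply same_but_upd; lia.
Qed.

Lemma ce_correct0 s e d : TMP <= d <= S TMP -> vr s 5 = N ->
  ewfd e = true -> okx N W e s -> Comp s (ce e d) d (eval e s).
Proof.
  intros Hd H5 Hwf. apply andb_prop in Hwf as [Hwf Hd']. apply Nat.ltb_lt in Hd'.
  intros. apply ce_correct; auto; unfold TMP, RR in *; lia.
Qed.

Lemma tests_correct s a b base m :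
  code_at P base (ce a TMP ++ ce b (S TMP)) -> Rel N s m ->
  ewfd a = true -> ewfd b = true -> okx N W a s -> okx N W b s ->
  exists m', run P w base m (length (ce a TMP) + length (ce b (S TMP)))
    (base + length (ce a TMP) + length (ce b (S TMP))) m'
    /\ m' TMP = eval a s /\ m' (S TMP) = eval b s /\ Rel N s m'.
Proof.
  intros HP HR Ha Hb Oa Ob. apply code_at_app in HP as [HPa HPb].
  assert (H5 : vr s 5 = N) by apply HR.
  destruct (ce_correct0 s a TMP (conj (le_n _) (le_S _ _ (le_n _))) H5 Ha Oa _ _ HPa HR)
    as (m1 & r1 & v1 & s1).
  assert (HR1 : Rel N s m1) by (refine (same_but_Rel _ _ _ _ _ _ s1 HR); auto).
  destruct (ce_correct0 s b (S TMP) (conj (le_S _ _ (le_n _)) (le_n _)) H5 Hb Ob _ _ HPb HR1)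
    as (m2 & r2 & v2 & s2).
  exists m2. split; [|split; [|split]]; auto.
  - eapply run_trans; eassumption.
  - destruct s2 as [s2 _]. rewrite s2; auto.
  - refine (same_but_Rel _ _ _ _ _ _ s2 HR1); auto.
Qed.

Lemma Rel_setv s m x v : x < TMP -> x <> 5 -> Rel N s m -> Rel N (setv s x v) (upd m x v).
Proof.
  intros Hx H5 (R1 & R2 & R3). split; [|split].
  - intros y Hy. unfold upd. simpl. destruct (y =? x); auto.
  - cbn -[Nat.eqb]. destruct (Nat.eqb_spec 5 x); congruence.
  - intros t i j k Hi Hj Hk Ha. unfold upd.
    destruct (Nat.eqb_spec (addr N t i j k) x); [unfold TMP, RR in *; lia|].
    simpl. auto.
Qed.

Lemma Rel_seta s m t i j k v : idxok N W t i j k -> Rel N s m ->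
  Rel N (seta s t i j k v) (upd m (addr N t i j k) v).
Proof.
  intros (Hi & Hj & Hk & Ha & Hw) (R1 & R2 & R3). split; [|split]; auto.
  - intros y Hy. unfold upd. simpl.
    destruct (Nat.eqb_spec y (addr N t i j k)); auto. unfold TMP, RR in *; lia.
  - intros t' i' j' k' Hi' Hj' Hk' Ha'. unfold upd.
    destruct (Nat.eqb_spec (addr N t' i' j' k') (addr N t i j k)) as [E|E].
    + apply addr_inj in E as (-> & -> & -> & ->); auto. simpl.
      now rewrite !Nat.eqb_refl.
    + simpl. rewrite R3 by auto.
      destruct (Nat.eqb_spec t' t); auto. destruct (Nat.eqb_spec i' i); auto.
      destruct (Nat.eqb_spec j' j); auto. destruct (Nat.eqb_spec k' k); auto.
      subst. tauto.
Qed.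

(** Induction on the execution rather than on the command, because the tail of a loop is again an
    execution of the same loop. *)
Lemma cc_correct c s t s' : exec N W c s t s' ->
  forall base m, code_at P base (cc c base) -> cwf c = true -> Rel N s m ->
  exists m' k, k <= kmax c * t /\ run P w base m k (base + length (cc c base)) m'
    /\ Rel N s' m'.
Proof.
  induction 1 as [s | x e s Ok | tg i j k e s Ok1 Ok2 | c1 c2 s t1 s1 t2 s2 _ IH1 _ IH2
    | a b c1 c2 s t s' Oa Ob Hlt _ IH | a b c1 c2 s t s' Oa Ob Hge _ IH
    | a b c s Oa Ob Hge | a b c s t1 s1 t2 s2 Oa Ob Hlt _ IH1 _ IH2];
    intros base m HP Hwf HR.
  - exists m, 0. simpl. rewrite Nat.add_0_r. repeat split; auto; try constructor; apply HR.
  - simpl in *. apply andb_prop in Hwf as [Hwf He]. apply andb_prop in Hwf as [Hx H5].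
    apply Nat.ltb_lt in Hx. apply Bool.negb_true_iff, Nat.eqb_neq in H5.
    apply code_at_app in HP as [HPa HP]. apply code_at_cons in HP as [HP _].
    destruct (ce_correct0 s e TMP (conj (le_n _) (le_S _ _ (le_n _))) (proj1 (proj2 HR)) He Ok _ _ HPa HR)
      as (m1 & r1 & v1 & s1).
    exists (upd m1 x (eval e s)), (length (ce e TMP) + 1). split; [|split].
    + lia.
    + rewrite length_app. cbn [length]. rewrite Nat.add_assoc.
      eapply run_trans; [eassumption|]. rewrite Nat.add_1_r. apply run_1.
      unfold step. now rewrite HP, v1, Nat.lor_diag.
    + apply Rel_setv; auto. refine (same_but_Rel _ _ _ _ _ _ s1 HR); auto.
  - cbn [cc cwf kmax] in *. apply andb_prop in Hwf as [Hwf1 Hwf2].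
    apply andb_prop in Hwf1 as [Hw Hd]. apply Nat.ltb_lt in Hd. simpl in Hd, Hw.
    apply andb_prop in Hw as [Hw ?]. apply andb_prop in Hw as [? ?].
    apply code_at_app in HP as [HPa HP]. apply code_at_app in HP as [HPe HP].
    apply code_at_cons in HP as [HP _].
    destruct Ok1 as (Oi & Oj & Okk & Hidx).
    assert (Ht := idxok_lt _ _ _ _ Hidx).
    assert (H5 : vr s 5 = N) by apply HR.
    assert (HC : Comp s (caddr tg (ce i (S TMP)) (ce j (S TMP)) (ce k (S TMP)) TMP) TMP
      (addr N tg (eval i s) (eval j s) (eval k s))).
    { destruct Hidx as (? & ? & ? & ? & ?). unfold TMP, RR in *.
      apply Comp_addr; auto; try lia; unfold TMP, RR; try lia; apply ce_correct; auto; unfold TMP, RR; try lia. }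
    destruct (HC _ _ HPa HR) as (m1 & r1 & v1 & s1).
    assert (HR1 : Rel N s m1) by (refine (same_but_Rel _ _ _ _ _ _ s1 HR); auto).
    destruct (ce_correct0 s e (S TMP) (conj (le_S _ _ (le_n _)) (le_n _)) H5 Hwf2 Ok2 _ _ HPe HR1)
      as (m2 & r2 & v2 & s2).
    exists (upd m2 (addr N tg (eval i s) (eval j s) (eval k s)) (eval e s)).
    eexists. split; [|split].
    2:{ rewrite !length_app. cbn [length].
      eapply run_trans; [eassumption|]. eapply run_trans; [eassumption|].
      rewrite !Nat.add_assoc, Nat.add_1_r. apply run_1. unfold step. rewrite HP, v2.
      destruct s2 as [s2 _]. rewrite s2, v1 by auto. reflexivity. }
    + rewrite !length_app. cbn [length]. lia.
    + apply Rel_seta; auto. refine (same_but_Rel _ _ _ _ _ _ s2 HR1); auto.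
  - simpl in *. apply andb_prop in Hwf as [Hw1 Hw2]. apply code_at_app in HP as [HP1 HP2].
    destruct (IH1 _ _ HP1 Hw1 HR) as (m1 & k1 & L1 & r1 & R1).
    destruct (IH2 _ _ HP2 Hw2 R1) as (m2 & k2 & L2 & r2 & R2).
    exists m2, (k1 + k2). split; [|split]; auto.
    + nia.
    + rewrite length_app, Nat.add_assoc. eapply run_trans; eassumption.
  - cbn [cc cwf kmax] in *. cbv zeta in *.
    apply andb_prop in Hwf as [Hwf W2]. apply andb_prop in Hwf as [Hwf W1].
    apply andb_prop in Hwf as [Wa Wb].
    remember (ce a TMP ++ ce b (S TMP)) as tt eqn:Ett.
    set (b2 := base + length tt + 1) in *. set (l2 := cc c2 b2) in *.
    set (b1 := b2 + length l2 + 1) in *. set (l1 := cc c1 b1) in *.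
    apply code_at_app in HP as [HPt HP]. apply code_at_cons in HP as [HPj HP].
    apply code_at_app in HP as [HP2 HP]. apply code_at_cons in HP as [HPk HP1].
    subst tt. destruct (tests_correct _ _ _ _ _ HPt HR Wa Wb Oa Ob) as (m1 & r1 & v1 & v1' & R1).
    replace (S (S (base + length (ce a TMP ++ ce b (S TMP))) + length l2)) with b1 in HP1
      by (unfold b1, b2; lia).
    destruct (IH _ _ HP1 W1 R1) as (m2 & k2 & L2 & r2 & R2). fold l1 in r2.
    exists m2, (length (ce a TMP) + length (ce b (S TMP)) + (1 + k2)). split; [|split]; auto.
    + nia.
    + eapply run_trans; [eassumption|]. eapply run_trans.
      * apply run_1. unfold step. rewrite <- Nat.add_assoc, <- length_app, HPj, v1, v1'.
        rewrite (proj2 (Nat.ltb_lt _ _) Hlt). reflexivity.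
      * replace (base + length ((ce a TMP ++ ce b (S TMP)) ++
          IJlt TMP (S TMP) b1 :: l2 ++ IJmp (b1 + length l1) :: l1)) with (b1 + length l1); auto.
        repeat (rewrite length_app; cbn [length]). unfold b1, b2. rewrite ?length_app. lia.
  - cbn [cc cwf kmax] in *. cbv zeta in *.
    apply andb_prop in Hwf as [Hwf W2]. apply andb_prop in Hwf as [Hwf W1].
    apply andb_prop in Hwf as [Wa Wb].
    remember (ce a TMP ++ ce b (S TMP)) as tt eqn:Ett.
    set (b2 := base + length tt + 1) in *. set (l2 := cc c2 b2) in *.
    set (b1 := b2 + length l2 + 1) in *. set (l1 := cc c1 b1) in *.
    apply code_at_app in HP as [HPt HP]. apply code_at_cons in HP as [HPj HP].
    apply code_at_app in HP as [HP2 HP]. apply code_at_cons in HP as [HPk HP1].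
    subst tt. destruct (tests_correct _ _ _ _ _ HPt HR Wa Wb Oa Ob) as (m1 & r1 & v1 & v1' & R1).
    replace (S (base + length (ce a TMP ++ ce b (S TMP)))) with b2 in HP2, HPk
      by (unfold b2; lia).
    destruct (IH _ _ HP2 W2 R1) as (m2 & k2 & L2 & r2 & R2). fold l2 in r2.
    exists m2, (length (ce a TMP) + length (ce b (S TMP)) + (1 + (k2 + 1))). split; [|split]; auto.
    + nia.
    + eapply run_trans; [eassumption|]. eapply run_trans.
      * apply run_1. unfold step. rewrite <- Nat.add_assoc, <- length_app, HPj, v1, v1'.
        rewrite (proj2 (Nat.ltb_ge _ _) Hge). reflexivity.
      * eapply run_trans; [replace (S (base + length (ce a TMP ++ ce b (S TMP)))) with b2
            by (unfold b2; lia); eassumption|].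
        apply run_1. unfold step. rewrite HPk.
        replace (base + length ((ce a TMP ++ ce b (S TMP)) ++
          IJlt TMP (S TMP) b1 :: l2 ++ IJmp (b1 + length l1) :: l1)) with (b1 + length l1); auto.
        repeat (rewrite length_app; cbn [length]). unfold b1, b2. rewrite ?length_app. lia.
  - cbn [cc cwf kmax] in *. cbv zeta in *.
    apply andb_prop in Hwf as [Hwf W1]. apply andb_prop in Hwf as [Wa Wb].
    remember (ce a TMP ++ ce b (S TMP)) as tt eqn:Ett.
    set (b1 := base + length tt + 2) in *. set (l1 := cc c b1) in *.
    apply code_at_app in HP as [HPt HP]. apply code_at_cons in HP as [HPj HP].
    apply code_at_cons in HP as [HPk HP].
    subst tt. destruct (tests_correct _ _ _ _ _ HPt HR Wa Wb Oa Ob) as (m1 & r1 & v1 & v1' & R1).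
    exists m1, (length (ce a TMP) + length (ce b (S TMP)) + (1 + 1)). split; [|split]; auto.
    + nia.
    + eapply run_trans; [eassumption|]. eapply run_trans.
      * apply run_1. unfold step. rewrite <- Nat.add_assoc, <- length_app, HPj, v1, v1'.
        rewrite (proj2 (Nat.ltb_ge _ _) Hge). reflexivity.
      * apply run_1. unfold step. rewrite HPk. f_equal. f_equal.
        repeat (rewrite length_app; cbn [length]). unfold b1. rewrite ?length_app. lia.
  (* Kept unsplit: after the jump back to [base] the remaining iterations run the whole loop code
     again. *)
  - assert (HP0 := HP). assert (Hwf0 := Hwf).
    cbn [cc cwf kmax] in HP, Hwf, IH1 |- *. cbv zeta in HP.
    apply andb_prop in Hwf as [Hwf W1]. apply andb_prop in Hwf as [Wa Wb].
    remember (ce a TMP ++ ce b (S TMP)) as tt eqn:Ett.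
    set (b1 := base + length tt + 2) in *. set (l1 := cc c b1) in *.
    apply code_at_app in HP as [HPt HP]. apply code_at_cons in HP as [HPj HP].
    apply code_at_cons in HP as [HPk HP]. apply code_at_app in HP as [HPc HP].
    apply code_at_cons in HP as [HPb _].
    subst tt. destruct (tests_correct _ _ _ _ _ HPt HR Wa Wb Oa Ob) as (m1 & r1 & v1 & v1' & R1).
    replace (S (S (base + length (ce a TMP ++ ce b (S TMP))))) with b1 in HPc, HPb
      by (unfold b1; lia).
    destruct (IH1 _ _ HPc W1 R1) as (m2 & k2 & L2 & r2 & R2). fold l1 in r2.
    destruct (IH2 _ _ HP0 Hwf0 R2) as (m3 & k3 & L3 & r3 & R3).
    exists m3, (length (ce a TMP) + length (ce b (S TMP)) + (1 + (k2 + (1 + k3)))).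
    split; [|split]; auto.
    + cbn [kmax] in L3. nia.
    + eapply run_trans; [eassumption|]. eapply run_trans.
      * apply run_1. unfold step. rewrite <- Nat.add_assoc, <- length_app, HPj, v1, v1'.
        rewrite (proj2 (Nat.ltb_lt _ _) Hlt). reflexivity.
      * eapply run_trans; [eassumption|]. eapply run_trans; [|eassumption].
        apply run_1. unfold step. rewrite HPb. reflexivity.
Qed.

End Compiler.

(** * Program logic and level graphs *)

(** Total correctness with time. One terminating execution is asked for, which the compiler turns
    into a machine run. *)
Definition wp (N W : nat) (c : com) (s : st) (Q : nat -> st -> Prop) : Prop :=
  exists t s', exec N W c s t s' /\ Q t s'.

Lemma wp_skip N W s (Q : nat -> st -> Prop) : Q 0 s -> wp N W Skip s Q.
Proof. intros H. exists 0, s. split; [constructor | exact H]. Qed.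

Lemma wp_asg N W x e s (Q : nat -> st -> Prop) :
  okx N W e s -> Q 1 (setv s x (eval e s)) -> wp N W (Asg x e) s Q.
Proof. intros H1 H2. eexists _, _. split; [constructor; exact H1 | exact H2]. Qed.

Lemma wp_sto N W t i j k e s (Q : nat -> st -> Prop) :
  okx N W (EL t i j k) s -> okx N W e s ->
  Q 1 (seta s t (eval i s) (eval j s) (eval k s) (eval e s)) ->
  wp N W (Sto t i j k e) s Q.
Proof. intros H1 H2 H3. eexists _, _. split; [constructor; eassumption | exact H3]. Qed.

Lemma wp_seq N W c1 c2 s (Q : nat -> st -> Prop) :
  wp N W c1 s (fun t1 s1 => wp N W c2 s1 (fun t2 s2 => Q (t1 + t2) s2)) ->
  wp N W (Seq c1 c2) s Q.
Proof.
  intros (t1 & s1 & H1 & t2 & s2 & H2 & H3).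
  exists (t1 + t2), s2. split; [econstructor; eassumption | exact H3].
Qed.

Lemma wp_if N W a b c1 c2 s (Q : nat -> st -> Prop) :
  okx N W a s -> okx N W b s ->
  (eval a s < eval b s -> wp N W c1 s (fun t s' => Q (S t) s')) ->
  (eval b s <= eval a s -> wp N W c2 s (fun t s' => Q (S t) s')) ->
  wp N W (If a b c1 c2) s Q.
Proof.
  intros Ha Hb H1 H2. destruct (le_lt_dec (eval b s) (eval a s)) as [H | H].
  - destruct (H2 H) as (t & s' & Hx & HQ). eexists _, _.
    split; [eapply X_iff; eassumption | exact HQ].
  - destruct (H1 H) as (t & s' & Hx & HQ). eexists _, _.
    split; [eapply X_ift; eassumption | exact HQ].
Qed.

Lemma wp_conseq N W c s (Q Q' : nat -> st -> Prop) :
  wp N W c s Q -> (forall t s', Q t s' -> Q' t s') -> wp N W c s Q'.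
Proof. intros (t & s' & H1 & H2) H. exists t, s'. auto. Qed.

(* [Inv s t]: invariant of state [s] after [t] ticks; [mu] decreases. *)
Lemma wp_while N W a b c (Inv : st -> nat -> Prop) (mu : st -> nat)
    (Q : nat -> st -> Prop) s0 :
  Inv s0 0 ->
  (forall s t, Inv s t -> okx N W a s /\ okx N W b s) ->
  (forall s t, Inv s t -> eval a s < eval b s ->
     wp N W c s (fun t' s' => Inv s' (S (t + t')) /\ mu s' < mu s)) ->
  (forall s t, Inv s t -> eval b s <= eval a s -> Q (S t) s) ->
  wp N W (While a b c) s0 Q.
Proof.
  intros H0 Hok Hstep Hend.
  enough (G : forall m s t, mu s < m -> Inv s t ->
    exists t' s', exec N W (While a b c) s t' s' /\ Q (t + t') s').
  { destruct (G (S (mu s0)) s0 0) as (t' & s' & H1 & H2); auto.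
    exists t', s'. auto. }
  induction m as [|m IH]; intros s t Hm HI; [lia|].
  destruct (Hok _ _ HI) as [Ha Hb].
  destruct (le_lt_dec (eval b s) (eval a s)) as [H | H].
  - exists 1, s. split; [constructor; auto|]. rewrite Nat.add_1_r. eauto.
  - destruct (Hstep _ _ HI H) as (t1 & s1 & X1 & HI1 & Hmu).
    destruct (IH s1 (S (t + t1))) as (t2 & s2 & X2 & HQ); auto; [lia|].
    exists (S (t1 + t2)), s2. split; [econstructor; eassumption|].
    replace (t + S (t1 + t2)) with (S (t + t1) + t2) by lia. exact HQ.
Qed.

(** * Finite sums *)

Fixpoint sumn (f : nat -> nat) (m : nat) : nat :=
  match m with 0 => 0 | S m => sumn f m + f m end.

Lemma div_le_self a b : a / b <= a.
Proof. destruct b; [simpl; lia|]. apply Nat.Div0.div_le_upper_bound. nia. Qed.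

Lemma sumn_ext f g m : (forall k, k < m -> f k = g k) -> sumn f m = sumn g m.
Proof. induction m; simpl; intros H; auto. rewrite IHm, H; auto. Qed.

Lemma sumn_mono f g m : (forall k, k < m -> f k <= g k) -> sumn f m <= sumn g m.
Proof.
  induction m; simpl; intros H; auto.
  assert (f m <= g m) by auto. assert (sumn f m <= sumn g m) by auto. lia.
Qed.

Lemma sumn_const c m : sumn (fun _ => c) m = m * c.
Proof. induction m; simpl; lia. Qed.

Lemma sumn_incr f g m a d : a < m -> g a = f a + d ->
  (forall k, k < m -> k <> a -> g k = f k) -> sumn g m = sumn f m + d.
Proof.
  induction m; intros Ha E H; [lia|]. simpl.
  destruct (Nat.eq_dec a m) as [-> | Hn].
  - rewrite (sumn_ext g f) by (intros; apply H; lia). lia.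
  - rewrite IHm by (auto; lia). rewrite (H m) by lia. lia.
Qed.

Lemma sumn_swap (f : nat -> nat -> nat) a b :
  sumn (fun x => sumn (fun y => f x y) b) a = sumn (fun y => sumn (fun x => f x y) a) b.
Proof.
  induction a; simpl.
  - rewrite sumn_const. lia.
  - rewrite IHa. clear IHa. induction b; simpl; auto. lia.
Qed.

Lemma sumn_indicator x b : x < b -> sumn (fun d => if x =? d then 1 else 0) b = 1.
Proof.
  intros H. replace 1 with (0 + 1) at 2 by auto.
  rewrite (sumn_incr (fun _ => 0) _ b x 1); auto.
  - now rewrite sumn_const, Nat.mul_0_r.
  - now rewrite Nat.eqb_refl.
  - intros k _ Hk. destruct (Nat.eqb_spec x k); congruence.
Qed.

(* [adj s j v k] for [k < cnt s j v] lists the neighbours of [v] in the level graph [j];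
   [pos s j v u] is the index of [u] in that list.  [flg]/[stk]: dirty vertices;
   [dcc]: digit counters; [Dd]: thresholds; [Qq]: radix products. *)
Notation adj s j v k := (ar s 1 j v k).
Notation pos s j v u := (ar s 2 j v u).
Notation cnt s j v := (ar s 3 0 j v).
Notation col s v := (ar s 4 0 0 v).
Notation flg s v := (ar s 5 0 0 v).
Notation stk s k := (ar s 6 0 0 k).
Notation dcc s k := (ar s 7 0 0 k).
Notation Dd s j := (ar s 8 0 0 j).
Notation Qq s j := (ar s 9 0 0 j).
(** Tag 0 with two zero indices addresses cell [x] itself, so a colour is output by an ordinary
    array store. *)
Notation outc s x := (ar s 0 0 0 x).

Notation "c1 ;; c2" := (Seq c1 c2) (at level 60, right associativity).

Definition eO := EC 0.
Definition eJ := EV 10. Definition eU := EV 11. Definition eV := EV 12.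
Definition eI := EV 13. Definition eNL := EV 6. Definition eST := EV 7.
Definition eK := EV 19. Definition eB := EV 20. Definition eM := EV 21.
Definition eX := EV 17. Definition eF := EV 14.
Definition aA := EV 30. Definition aB := EV 31. Definition aC := EV 32.
Definition aP := EV 33. Definition aX := EV 34.
Definition plus1 e := EOp OAdd e (EC 1).
Definition minus1 e := EOp OSub e (EC 1).

Definition halfadd : com :=
  Asg 32 (EL 3 eO eJ aA);;
  Sto 1 eJ aA aC aB;;
  Sto 2 eJ aA aB aC;;
  Sto 3 eO eJ aA (plus1 aC).

(** Constant-time deletion: the last neighbour is moved into the place of the removed one. *)
Definition halfrem : com :=
  Asg 32 (minus1 (EL 3 eO eJ aA));;
  Asg 33 (EL 2 eJ aA aB);;
  Asg 34 (EL 1 eJ aA aC);;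
  Sto 1 eJ aA aP aX;;
  Sto 2 eJ aA aX aP;;
  Sto 3 eO eJ aA aC.

Definition both (c : com) : com :=
  Asg 30 eV;; Asg 31 eU;; c;; Asg 30 eU;; Asg 31 eV;; c.

Definition push : com :=
  If (EL 5 eO eO eU) (EC 1)
    (Sto 5 eO eO eU (EC 1);; Sto 6 eO eO eST eU;; Asg 7 (plus1 eST))
    Skip.

Definition clear_level : com :=
  While eO (EL 3 eO eJ eV)
    (Asg 11 (EL 1 eJ eV (minus1 (EL 3 eO eJ eV)));; both halfrem).

Definition clear : com :=
  Asg 10 eI;; While eJ (plus1 eNL) (clear_level;; Asg 10 (plus1 eJ)).

Definition for_K (bound : expr) (body : com) : com :=
  Asg 19 eO;; While eK bound (body;; Asg 19 (plus1 eK)).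

(** Counts the digits [j] of the neighbours at level [j - 1], then takes the least frequent one. The
    machine has no remainder, whence [x - x / B * B]. *)
Definition pick : com :=
  for_K eB (Sto 7 eO eO eK eO);;
  for_K eM (Asg 11 (EL 1 (minus1 eJ) eV eK);;
    Asg 17 (EOp ODiv (EL 4 eO eO eU) (EL 9 eO eO eJ));;
    Asg 17 (EOp OSub eX (EOp OMul (EOp ODiv eX eB) eB));;
    Sto 7 eO eO eX (plus1 (EL 7 eO eO eX)));;
  Asg 17 eO;;
  for_K eB (If (EL 7 eO eO eK) (EL 7 eO eO eX) (Asg 17 eK) Skip).

Definition prefix e := EOp ODiv (EL 4 eO eO e) (EL 9 eO eO eJ).

(** Tests are only of the form [<], and subtraction must not go below zero; so equality of prefixes
    is tested by their xor being below 1. *)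
Definition add_loop : com :=
  for_K eM (Asg 11 (EL 1 (minus1 eJ) eV eK);;
    If (EOp OXor (prefix eU) (prefix eV)) (EC 1) (both halfadd;; push) Skip).

Ltac ev := cbn [eval bev vr ar setv seta Nat.eqb eO eJ eU eV eI eNL eST eK eB eM eX eF
  aA aB aC aP aX plus1 minus1 prefix] in *.
Ltac evg := cbn [eval bev vr ar setv seta Nat.eqb eO eJ eU eV eI eNL eST eK eB eM eX eF
  aA aB aC aP aX plus1 minus1 prefix].

(** * Adjacency lists of the level graphs and the operations on them *)

Section Graphs.
Variables (n NL : nat).

(** That [pos] inverts [adj] on each list also says that no neighbour is listed twice. *)
Definition WF (s : st) : Prop := forall j v k, j <= NL -> v < n -> k < cnt s j v ->
  adj s j v k < n /\ pos s j v (adj s j v k) = k.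

Definition mem (s : st) (j v u : nat) : Prop := exists k, k < cnt s j v /\ adj s j v k = u.

(** Once the lists are symmetric, each edge of a level graph counts twice, once per endpoint. *)
Definition Phi (s : st) : nat := sumn (fun j => sumn (fun v => cnt s j v) n) (S NL).

Lemma Phi_incr s s' j a d : j <= NL -> a < n -> cnt s' j a = cnt s j a + d ->
  (forall j' a', j' <= NL -> a' < n -> j' <> j \/ a' <> a -> cnt s' j' a' = cnt s j' a') ->
  Phi s' = Phi s + d.
Proof.
  intros Hj Ha E H. apply sumn_incr with (a := j); [lia| |].
  - apply sumn_incr with (a := a); auto.
  - intros. apply sumn_ext. intros. apply H; auto; lia.
Qed.

Lemma mem_pos s j v u : WF s -> j <= NL -> v < n -> mem s j v u ->
  u < n /\ pos s j v u < cnt s j v /\ adj s j v (pos s j v u) = u.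
Proof.
  intros Hw Hj Hv (k & Hk & <-). destruct (Hw j v k Hj Hv Hk) as [H1 H2].
  rewrite H2. auto.
Qed.

(** Pigeonhole: the listed neighbours, distinct by [WF], and the non-neighbours [l] all lie below
    [m]. *)
Lemma cnt_lt s j v (l : list nat) m : WF s -> j <= NL -> v < n -> NoDup l ->
  (forall u, In u l -> u < m /\ ~ mem s j v u) ->
  (forall u, mem s j v u -> u < m) -> cnt s j v + length l <= m.
Proof.
  intros Hw Hj Hv Hl Hl2 Hm.
  set (f := fun k => adj s j v k).
  assert (Hnd : NoDup (l ++ map f (seq 0 (cnt s j v)))).
  { apply NoDup_app; auto.
    - apply NoDup_map_NoDup_ForallPairs; [|apply seq_NoDup].
      intros a b Ha Hb E. apply in_seq in Ha, Hb.
      destruct (Hw j v a) as [_ E1]; auto; [lia|].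
      destruct (Hw j v b) as [_ E2]; auto; [lia|].
      unfold f in E. rewrite <- E1, E, E2. reflexivity.
    - intros u Hu Hin. apply in_map_iff in Hin as (k & E & Hk). apply in_seq in Hk.
      apply (Hl2 u Hu). exists k. split; auto. lia. }
  assert (Hinc : incl (l ++ map f (seq 0 (cnt s j v))) (seq 0 m)).
  { intros u Hu. apply in_seq. split; [lia|]. simpl. apply in_app_iff in Hu as [Hu | Hu].
    - now apply Hl2.
    - apply in_map_iff in Hu as (k & E & Hk). apply in_seq in Hk.
      apply Hm. exists k. split; auto. lia. }
  apply NoDup_incl_length in Hinc; auto.
  rewrite length_app, length_map, !length_seq in Hinc. lia.
Qed.

Lemma cnt_le s j v : WF s -> j <= NL -> v < n -> cnt s j v <= n.
Proof.
  intros Hw Hj Hv. assert (H := cnt_lt s j v [] n Hw Hj Hv). simpl in H.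
  rewrite <- plus_n_O in H. apply H; [constructor | tauto |].
  intros u Hu. now apply (mem_pos s j v).
Qed.

(** A missing neighbour leaves a free index, so appending it stays within the array. *)
Lemma cnt_ltn s j v u : WF s -> j <= NL -> v < n -> u < n -> ~ mem s j v u -> cnt s j v < n.
Proof.
  intros Hw Hj Hv Hu Hm. assert (H := cnt_lt s j v [u] n Hw Hj Hv). simpl in H.
  rewrite Nat.add_1_r in H. apply H.
  - constructor; [auto | constructor].
  - intros u' [<- | []]. auto.
  - intros u' Hu'. now apply (mem_pos s j v).
Qed.

(** The flags are the characteristic function of the stack, which makes membership a constant-time
    test. *)
Definition StkOK (s : st) : Prop :=
  (forall k, k < vr s 7 -> stk s k < n /\ flg s (stk s k) <> 0) /\
  (forall k k', k < vr s 7 -> k' < vr s 7 -> stk s k = stk s k' -> k = k') /\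
  (forall x, x < n -> flg s x <> 0 -> exists k, k < vr s 7 /\ stk s k = x).

(** Ensures that there is room to push an unflagged vertex. *)
Lemma StkOK_le s x : StkOK s -> x < n -> flg s x = 0 -> vr s 7 < n.
Proof.
  intros (H1 & H2 & _) Hx Hf.
  assert (Hnd : NoDup (x :: map (fun k => stk s k) (seq 0 (vr s 7)))).
  { constructor.
    - intros Hin. apply in_map_iff in Hin as (k & E & Hk). apply in_seq in Hk.
      destruct (H1 k) as [_ H]; [lia|]. congruence.
    - apply NoDup_map_NoDup_ForallPairs; [|apply seq_NoDup].
      intros a b Ha Hb E. apply in_seq in Ha, Hb. apply H2; auto; lia. }
  apply NoDup_incl_length with (l' := seq 0 n) in Hnd.
  - simpl in Hnd. rewrite length_map, !length_seq in Hnd. lia.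
  - intros y [<- | Hin]; apply in_seq; [lia|].
    apply in_map_iff in Hin as (k & <- & Hk). apply in_seq in Hk.
    destruct (H1 k); lia.
Qed.

Lemma StkOK_ext s s' : vr s' 7 = vr s 7 ->
  (forall t i j k, t = 5 \/ t = 6 -> ar s' t i j k = ar s t i j k) ->
  StkOK s -> StkOK s'.
Proof.
  intros E F (H1 & H2 & H3). unfold StkOK. rewrite E. split; [|split].
  - intros k. rewrite !F by auto. auto.
  - intros k k'. rewrite !F by auto. auto.
  - intros x Hx. rewrite F by auto. intros Hf. destruct (H3 x Hx Hf) as (k & Hk & Ek).
    exists k. rewrite F by auto. auto.
Qed.

Variables (N W : nat).
Hypothesis HRN : RR + 8 < N.
Hypothesis HnN : n < N.
Hypothesis HLN : NL < N.
Hypothesis HNW : N * N * N * N * N * N <= W.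

(** Since [N] exceeds 72, one more factor [N] absorbs any of the numerical constants. *)
Lemma pow_facts : N < W /\ N * N < W /\ N * N * N < W /\ N * N * N * N < W
  /\ 16 * (N * N * N) < W /\ 100 < W.
Proof.
  unfold RR in *.
  assert (A0 : forall x, 1 <= x -> 72 * x < x * N) by (intros; nia).
  assert (A1 := A0 1). assert (A2 := A0 N). assert (A3 := A0 (N * N)).
  assert (A4 := A0 (N * N * N)). assert (A5 := A0 (N * N * N * N)).
  assert (A6 := A0 (N * N * N * N * N)). lia.
Qed.

(** A positive tag puts the address at [N] or above, beyond the registers; a tag of at most 12 keeps
    it below [16 * N^3]. *)
Lemma idxok_tag t i j k : 1 <= t <= 12 -> i < N -> j < N -> k < N -> idxok N W t i j k.
Proof.
  intros. destruct pow_facts as (_ & _ & _ & _ & HP & _).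
  unfold idxok, addr. repeat split; auto.
  - assert (B1 : t <= t * N) by nia.
    assert (B2 : t * N <= (t * N + i) * N) by nia.
    assert (B3 : N <= t * N) by nia.
    assert (B4 : (t * N + i) * N <= ((t * N + i) * N + j) * N) by nia. lia.
  - assert (B1 : t * N + i <= 13 * N) by nia.
    assert (B2 : (t * N + i) * N + j <= 13 * N * N + N) by nia.
    assert (B3 : ((t * N + i) * N + j) * N <= (13 * N * N + N) * N) by nia.
    nia.
Qed.

Ltac ok1 := repeat match goal with
  | |- _ /\ _ => split
  | |- True => exact I
  | |- idxok _ _ _ _ _ _ => apply idxok_tag
  end.
Ltac ok := unfold prefix, eO, eJ, eU, eV, eI, eNL, eST, eK, eB, eM, eX, eF, aA, aB, aC, aP, aX, plus1, minus1;
  cbn [okx bok]; evg; ok1; try lia.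

(** The edge operations use the variables from 30 on as scratch and touch only the adjacency arrays,
    tags 1 to 3. *)
Definition frame (s s' : st) : Prop :=
  (forall x, x < 30 -> vr s' x = vr s x) /\
  (forall t i j k, t = 0 \/ 4 <= t -> ar s' t i j k = ar s t i j k).

Ltac eqb := repeat match goal with
  | |- context [?a =? ?b] => destruct (Nat.eqb_spec a b); subst
  | H : context [?a =? ?b] |- _ => destruct (Nat.eqb_spec a b); subst
  end.

Lemma wp_halfadd s j a b : vr s 10 = j -> vr s 30 = a -> vr s 31 = b ->
  j <= NL -> a < n -> b < n -> WF s -> ~ mem s j a b ->
  wp N W halfadd s (fun t s' => t = 4 /\ (forall x, x < 32 -> vr s' x = vr s x) /\
    (forall t i j k, t = 0 \/ 4 <= t -> ar s' t i j k = ar s t i j k) /\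
    WF s' /\
    (forall j' a' b', mem s' j' a' b' <-> mem s j' a' b' \/ (j' = j /\ a' = a /\ b' = b)) /\
    cnt s' j a = S (cnt s j a) /\
    (forall j' a', j' <> j \/ a' <> a -> cnt s' j' a' = cnt s j' a') /\
    Phi s' = Phi s + 1 /\
    (forall j' a' k, j' <> j \/ a' <> a -> adj s' j' a' k = adj s j' a' k)).
Proof.
  intros Ej Ea Eb Hj Ha Hb Hw Hm. pose proof pow_facts as HP.
  assert (Hc := cnt_ltn s j a b Hw Hj Ha Hb Hm).
  unfold halfadd.
  apply wp_seq, wp_asg; [ok|]. ev. rewrite ?Ej, ?Ea, ?Eb.
  apply wp_seq, wp_sto; [ok|ok|]. ev. rewrite ?Ej, ?Ea, ?Eb.
  apply wp_seq, wp_sto; [ok|ok|]. ev. rewrite ?Ej, ?Ea, ?Eb.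
  apply wp_sto; [ok|ok|]. ev. rewrite ?Ej, ?Ea, ?Eb.
  clear Ej Ea Eb.
  split; [reflexivity|].
  split. { intros x Hx. evg. eqb; auto; lia. }
  split. { intros t i j' k Ht. evg. eqb; auto; lia. }
  split.
  { intros j' v k Hj' Hv Hk. ev.
    destruct (Nat.eqb_spec j' j) as [-> | Dj]; [|apply Hw; auto].
    destruct (Nat.eqb_spec v a) as [-> | Dv]; [|apply Hw; auto].
    destruct (Nat.eqb_spec k (cnt s j a)) as [-> | Dk].
    - rewrite Nat.eqb_refl. auto.
    - assert (Hk' : k < cnt s j a) by lia.
      destruct (Hw _ _ _ Hj' Hv Hk') as [H1 H2].
      (* Writing [pos] at [b] harms no other entry, because [b] was not listed before. *)
      destruct (Nat.eqb_spec (adj s j a k) b) as [Du | Du]; auto.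
      exfalso. apply Hm. exists k. auto. }
  assert (Hcn : forall j' a', j' <> j \/ a' <> a ->
    (if j' =? j then if a' =? a then cnt s j a + 1 else cnt s j' a' else cnt s j' a') = cnt s j' a').
  { intros. eqb; auto. lia. }
  split.
  { intros j' a' b'. unfold mem. evg.
    destruct (Nat.eqb_spec j' j) as [-> | Dj].
    2:{ split; [auto|]. intros [? | [? _]]; auto. lia. }
    destruct (Nat.eqb_spec a' a) as [-> | Da].
    2:{ split; [auto|]. intros [? | (_ & ? & _)]; auto. lia. }
    split.
    - intros (k & Hk & E). destruct (Nat.eqb_spec k (cnt s j a)).
      + right. auto.
      + left. exists k. split; auto. lia.
    - intros [(k & Hk & E) | (_ & _ & E)].
      + exists k. split; [lia|]. eqb; auto; lia.
      + exists (cnt s j a). rewrite Nat.eqb_refl. split; [lia | auto]. }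
  split. { evg. rewrite !Nat.eqb_refl. lia. }
  split; [exact Hcn|]. split.
  - apply Phi_incr with (j := j) (a := a); auto. evg. rewrite !Nat.eqb_refl. lia.
    intros. evg. auto.
  - intros. evg. eqb; auto. lia.
Qed.

Lemma wp_halfrem s j a b : vr s 10 = j -> vr s 30 = a -> vr s 31 = b ->
  j <= NL -> a < n -> b < n -> WF s -> mem s j a b ->
  wp N W halfrem s (fun t s' => t = 6 /\ (forall x, x < 32 -> vr s' x = vr s x) /\
    (forall t i j k, t = 0 \/ 4 <= t -> ar s' t i j k = ar s t i j k) /\
    WF s' /\
    (forall j' a' b', mem s' j' a' b' <-> mem s j' a' b' /\ ~ (j' = j /\ a' = a /\ b' = b)) /\
    S (cnt s' j a) = cnt s j a /\
    (forall j' a', j' <> j \/ a' <> a -> cnt s' j' a' = cnt s j' a') /\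
    Phi s' + 1 = Phi s).
Proof.
  intros Ej Ea Eb Hj Ha Hb Hw Hm. pose proof pow_facts as HP.
  assert (Hc := cnt_le s j a Hw Hj Ha).
  destruct Hm as (p & Hp & Epb). destruct (Hw j a p Hj Ha Hp) as [_ Ep]. rewrite Epb in Ep.
  remember (adj s j a (cnt s j a - 1)) as X eqn:EX.
  assert (HX : X < n /\ pos s j a X = cnt s j a - 1).
  { rewrite EX. apply Hw; auto; lia. }
  unfold halfrem.
  apply wp_seq, wp_asg; [ok; rewrite ?Ej, ?Ea; lia|]. ev. rewrite ?Ej, ?Ea, ?Eb.
  apply wp_seq, wp_asg; [ok|]. ev. rewrite ?Ej, ?Ea, ?Eb, ?Ep.
  apply wp_seq, wp_asg; [ok|]. ev. rewrite ?Ej, ?Ea, ?Eb, <- ?EX.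
  apply wp_seq, wp_sto; [ok|ok|]. ev. rewrite ?Ej, ?Ea, ?Eb.
  apply wp_seq, wp_sto; [ok|ok|]. ev. rewrite ?Ej, ?Ea, ?Eb.
  apply wp_sto; [ok|ok|]. ev. rewrite ?Ej, ?Ea, ?Eb.
  clear Ej Ea Eb.
  split; [reflexivity|].
  split. { intros x Hx. evg. eqb; auto; lia. }
  split. { intros t i j' k Ht. evg. eqb; auto; lia. }
  split.
  { intros j' v k Hj' Hv Hk. ev.
    destruct (Nat.eqb_spec j' j) as [-> | Dj]; [|apply Hw; auto].
    destruct (Nat.eqb_spec v a) as [-> | Dv]; [|apply Hw; auto].
    destruct (Nat.eqb_spec k p) as [-> | Dk].
    - rewrite Nat.eqb_refl. split; [apply HX | auto].
    - assert (Hk' : k < cnt s j a) by lia.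
      destruct (Hw _ _ _ Hj' Hv Hk') as [H1 H2].
      destruct (Nat.eqb_spec (adj s j a k) X) as [Du | Du]; auto.
      exfalso. rewrite Du in H2. lia. }
  assert (Hcn : forall j' a', j' <> j \/ a' <> a ->
    (if j' =? j then if a' =? a then cnt s j a - 1 else cnt s j' a' else cnt s j' a') = cnt s j' a').
  { intros. eqb; auto. lia. }
  split.
  { intros j' a' b'. unfold mem. evg.
    destruct (Nat.eqb_spec j' j) as [-> | Dj].
    2:{ split; [|tauto]. intros; split; auto. lia. }
    destruct (Nat.eqb_spec a' a) as [-> | Da].
    2:{ split; [|tauto]. intros; split; auto. lia. }
    split.
    - intros (k & Hk & E). destruct (Nat.eqb_spec k p) as [Dk | Dk].
      + split; [exists (cnt s j a - 1); split; [lia | congruence]|].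
        intros (_ & _ & Eb'). destruct HX as [_ HX]. subst b' X. rewrite Eb' in HX. lia.
      + split; [exists k; split; [lia | auto]|].
        intros (_ & _ & Eb'). destruct (Hw j a k) as [_ H]; auto; [lia|].
        rewrite E, Eb', Ep in H. lia.
    - intros [(k & Hk & E) Hn].
      assert (Dkp : k <> p) by (intros ->; apply Hn; repeat split; congruence).
      destruct (Nat.eq_dec k (cnt s j a - 1)) as [Dk | Dk].
      + exists p. rewrite Nat.eqb_refl. split; [lia | congruence].
      + exists k. split; [lia|]. eqb; auto; lia. }
  split. { evg. rewrite !Nat.eqb_refl. lia. }
  split; [exact Hcn|].
  symmetry. apply Phi_incr with (j := j) (a := a); auto. evg. rewrite !Nat.eqb_refl. lia.
  intros. evg. symmetry. auto.
Qed.

Lemma wp_addboth s j u v : vr s 10 = j -> vr s 11 = u -> vr s 12 = v ->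
  j <= NL -> u < n -> v < n -> u <> v -> WF s -> ~ mem s j v u -> ~ mem s j u v ->
  wp N W (both halfadd) s (fun t s' => t = 12 /\ frame s s' /\ WF s' /\
    (forall x a b, mem s' x a b <->
       mem s x a b \/ (x = j /\ (a = v /\ b = u \/ a = u /\ b = v))) /\
    cnt s' j v = S (cnt s j v) /\ cnt s' j u = S (cnt s j u) /\
    (forall x a, x <> j \/ (a <> v /\ a <> u) -> cnt s' x a = cnt s x a) /\
    Phi s' = Phi s + 2 /\
    (forall x a k, x <> j -> adj s' x a k = adj s x a k)).
Proof.
  intros Ej Eu Ev Hj Hu Hv Huv Hw Hm1 Hm2.
  unfold both.
  apply wp_seq, wp_asg; [exact I|]. apply wp_seq, wp_asg; [exact I|]. apply wp_seq.
  evg.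
  match goal with |- wp _ _ _ ?s1 _ => pose proof (wp_halfadd s1 j v u) as H1 end.
  eapply wp_conseq; [apply H1; auto|]. clear H1.
  intros t1 s1 (-> & Fv1 & Fa1 & Hw1 & M1 & C1 & C1' & P1 & A1). ev.
  apply wp_seq, wp_asg; [exact I|]. apply wp_seq, wp_asg; [exact I|].
  evg.
  match goal with |- wp _ _ _ ?s1 _ => pose proof (wp_halfadd s1 j u v) as H1 end.
  eapply wp_conseq; [apply H1; auto|]; clear H1; ev.
  - rewrite Fv1 by lia. auto.
  - rewrite Fv1 by lia. auto.
  - rewrite Fv1 by lia. auto.
  - intros Hm. apply M1 in Hm as [Hm | (_ & E & _)]; auto.
  - intros t2 s2 (-> & Fv2 & Fa2 & Hw2 & M2 & C2 & C2' & P2 & A2). ev.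
    change (WF s2) in Hw2.
    assert (M12 : forall x a b, mem s2 x a b <-> mem s x a b
      \/ (x = j /\ a = v /\ b = u) \/ (x = j /\ a = u /\ b = v)).
    { intros x a b. rewrite M2. unfold mem at 1. ev. change (mem s1 x a b \/ x = j /\ a = u /\ b = v
        <-> mem s x a b \/ x = j /\ a = v /\ b = u \/ x = j /\ a = u /\ b = v).
      rewrite M1. unfold mem at 1. ev. fold (mem s x a b). tauto. }
    split; [reflexivity|]. split; [split|].
    + intros x Hx. rewrite Fv2 by lia.
      destruct (Nat.eqb_spec x 31); [lia|]. destruct (Nat.eqb_spec x 30); [lia|].
      rewrite Fv1 by lia.
      destruct (Nat.eqb_spec x 31); [lia|]. destruct (Nat.eqb_spec x 30); [lia|]. auto.
    + intros. rewrite Fa2, Fa1 by auto. auto.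
    + split; [exact Hw2|]. split; [intros; rewrite M12; tauto|].
      split; [rewrite C2' by lia; lia|].
      split; [rewrite C2, C1' by lia; lia|].
      split; [intros x a Hx; rewrite C2', C1' by lia; auto|].
      split; [|intros; rewrite A2, A1 by lia; auto].
      unfold Phi in *. ev. lia.
Qed.

Lemma wp_remboth s j u v : vr s 10 = j -> vr s 11 = u -> vr s 12 = v ->
  j <= NL -> u < n -> v < n -> u <> v -> WF s -> mem s j v u -> mem s j u v ->
  wp N W (both halfrem) s (fun t s' => t = 16 /\ frame s s' /\ WF s' /\
    (forall x a b, mem s' x a b <->
       mem s x a b /\ ~ (x = j /\ (a = v /\ b = u \/ a = u /\ b = v))) /\
    S (cnt s' j v) = cnt s j v /\
    (forall x a, cnt s' x a <= cnt s x a) /\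
    (forall x a, x <> j -> cnt s' x a = cnt s x a) /\
    Phi s' + 2 = Phi s).
Proof.
  intros Ej Eu Ev Hj Hu Hv Huv Hw Hm1 Hm2.
  unfold both.
  apply wp_seq, wp_asg; [exact I|]. apply wp_seq, wp_asg; [exact I|]. apply wp_seq.
  evg.
  match goal with |- wp _ _ _ ?s1 _ => pose proof (wp_halfrem s1 j v u) as H1 end.
  eapply wp_conseq; [apply H1; auto|]. clear H1.
  intros t1 s1 (-> & Fv1 & Fa1 & Hw1 & M1 & C1 & C1' & P1). ev.
  apply wp_seq, wp_asg; [exact I|]. apply wp_seq, wp_asg; [exact I|].
  evg.
  match goal with |- wp _ _ _ ?s1 _ => pose proof (wp_halfrem s1 j u v) as H1 end.
  eapply wp_conseq; [apply H1; auto|]; clear H1; ev.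
  - rewrite Fv1 by lia. auto.
  - rewrite Fv1 by lia. auto.
  - rewrite Fv1 by lia. auto.
  - apply M1. split; auto. intros (_ & E & _); auto.
  - intros t2 s2 (-> & Fv2 & Fa2 & Hw2 & M2 & C2 & C2' & P2). ev.
    change (WF s2) in Hw2.
    assert (M12 : forall x a b, mem s2 x a b <-> mem s x a b
      /\ ~ (x = j /\ a = v /\ b = u) /\ ~ (x = j /\ a = u /\ b = v)).
    { intros x a b. rewrite M2. unfold mem at 1. ev. change (mem s1 x a b /\ ~ (x = j /\ a = u /\ b = v)
        <-> mem s x a b /\ ~ (x = j /\ a = v /\ b = u) /\ ~ (x = j /\ a = u /\ b = v)).
      rewrite M1. unfold mem at 1. ev. fold (mem s x a b). tauto. }
    split; [reflexivity|]. split; [split|].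
    + intros x Hx. rewrite Fv2 by lia.
      destruct (Nat.eqb_spec x 31); [lia|]. destruct (Nat.eqb_spec x 30); [lia|].
      rewrite Fv1 by lia.
      destruct (Nat.eqb_spec x 31); [lia|]. destruct (Nat.eqb_spec x 30); [lia|]. auto.
    + intros. rewrite Fa2, Fa1 by auto. auto.
    + split; [exact Hw2|]. split; [intros; rewrite M12; tauto|].
      assert (D1 : forall x a, cnt s1 x a <= cnt s x a).
      { intros x a. destruct (Nat.eq_dec x j) as [-> |]; [|rewrite C1'; lia].
        destruct (Nat.eq_dec a v) as [-> |]; [|rewrite C1'; lia]. lia. }
      split; [rewrite C2' by lia; lia|].
      split.
      { intros x a. specialize (D1 x a).
        destruct (Nat.eq_dec x j) as [-> |]; [|rewrite C2'; lia].
        destruct (Nat.eq_dec a u) as [-> |]; [|rewrite C2'; lia]. lia. }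
      split; [intros x a Hx; rewrite C2', C1' by lia; auto|].
      unfold Phi in *. ev. lia.
Qed.

Lemma wp_push s u : vr s 11 = u -> u < n -> StkOK s ->
  wp N W push s (fun t s' => t <= 4 /\ (forall x, x <> 7 -> vr s' x = vr s x) /\
    (forall t i j k, t <> 5 -> t <> 6 -> ar s' t i j k = ar s t i j k) /\
    StkOK s' /\ vr s' 7 <= vr s 7 + 1 /\
    flg s' u <> 0 /\ (forall x, x <> u -> flg s' x = flg s x)).
Proof.
  intros Eu Hu HS. pose proof pow_facts as HP.
  unfold push. apply wp_if; [ok|ok| |]; ev; rewrite ?Eu; intros Hf.
  - assert (Hst : vr s 7 < n) by (apply (StkOK_le s u); auto; lia).
    apply wp_seq, wp_sto; [ok|ok|]. ev. rewrite ?Eu.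
    apply wp_seq, wp_sto; [ok|ok|]. ev. rewrite ?Eu.
    apply wp_asg; [ok|]. ev. clear Eu.
    split; [lia|]. split. { intros x Hx. evg. eqb; auto; lia. }
    split. { intros t i j k H1 H2. evg. eqb; auto; lia. }
    split; [|split; [lia|split]].
    + destruct HS as (H1 & H2 & H3). unfold StkOK. evg. split; [|split].
      * intros k Hk. destruct (Nat.eqb_spec k (vr s 7)).
        { rewrite Nat.eqb_refl. lia. }
        destruct (H1 k) as [H4 H5]; [lia|]. split; auto.
        destruct (stk s k =? u); auto.
      * intros k k' Hk Hk'.
        assert (G : forall x, x < vr s 7 -> stk s x <> u).
        { intros x Hx E. destruct (H1 x Hx) as [_ H]. rewrite E in H. lia. }
        destruct (Nat.eqb_spec k (vr s 7)); destruct (Nat.eqb_spec k' (vr s 7)); intros E; subst; auto.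
        { exfalso. apply (G k'); auto; lia. }
        { exfalso. apply (G k); auto; lia. }
        { apply H2; auto; lia. }
      * intros x Hx Hfx. destruct (Nat.eqb_spec x u) as [-> | Hn].
        { exists (vr s 7). rewrite Nat.eqb_refl. split; auto. lia. }
        destruct (H3 x Hx Hfx) as (k & Hk & E). exists k.
        destruct (Nat.eqb_spec k (vr s 7)); [lia|]. split; auto. lia.
    + evg. rewrite Nat.eqb_refl. lia.
    + intros x Hx. evg. eqb; auto; lia.
  - apply wp_skip. split; [lia|]. split; [auto|]. split; [auto|]. split; [auto|].
    split; [lia|]. split; [lia | auto].
Qed.

Lemma wp_clear_level s0 j v : vr s0 10 = j -> vr s0 12 = v -> j <= NL -> v < n -> WF s0 ->
  (forall a b, a < n -> mem s0 j a b -> mem s0 j b a /\ a <> b) ->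
  wp N W clear_level s0 (fun t s' => t <= 18 * cnt s0 j v + 1 /\
    (forall x, x < 30 -> x <> 11 -> vr s' x = vr s0 x) /\
    (forall t i j k, t = 0 \/ 4 <= t -> ar s' t i j k = ar s0 t i j k) /\
    WF s' /\
    (forall x a b, a < n -> (mem s' x a b <-> mem s0 x a b /\ ~ (x = j /\ (a = v \/ b = v)))) /\
    (forall x a, cnt s' x a <= cnt s0 x a) /\
    (forall x a, x <> j -> cnt s' x a = cnt s0 x a) /\
    cnt s' j v = 0 /\ Phi s' + 2 * cnt s0 j v = Phi s0).
Proof.
  intros Ej Ev Hj Hv Hw Hsym. pose proof pow_facts as HP.
  (* An edge costs 18: 16 for the two half removals, one assignment and one test. Symmetry is kept
     in the invariant because both halves must be present to be removed. *)
  apply wp_while with (mu := fun s => cnt s j v) (Inv := fun s t =>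
    t + 18 * cnt s j v <= 18 * cnt s0 j v /\
    (forall x, x < 30 -> x <> 11 -> vr s x = vr s0 x) /\
    (forall t i j k, t = 0 \/ 4 <= t -> ar s t i j k = ar s0 t i j k) /\
    WF s /\
    (forall a b, a < n -> mem s j a b -> mem s j b a /\ a <> b) /\
    (forall x a b, mem s x a b -> mem s0 x a b) /\
    (forall x a b, mem s0 x a b -> ~ (x = j /\ (a = v \/ b = v)) -> mem s x a b) /\
    (forall x a, cnt s x a <= cnt s0 x a) /\
    (forall x a, x <> j -> cnt s x a = cnt s0 x a) /\
    Phi s + 2 * cnt s0 j v = Phi s0 + 2 * cnt s j v).
  - repeat (split; [auto; lia|]). auto.
  - intros s t (_ & Fv & _ & Hw1 & _). assert (Hc := cnt_le s j v Hw1 Hj Hv).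
    split; ok; rewrite ?Fv, ?Ej, ?Ev by lia; lia.
  - intros s t (Ht & Fv & Fa & Hw1 & Hs1 & M1 & M2 & C1 & C2 & P1) Hlt. ev.
    rewrite (Fv 10), (Fv 12), Ej, Ev in Hlt by lia.
    assert (Hc := cnt_le s j v Hw1 Hj Hv).
    destruct (Hw1 j v (cnt s j v - 1) Hj Hv) as [Hu _]; [lia|].
    remember (adj s j v (cnt s j v - 1)) as u eqn:Equ.
    assert (Hm : mem s j v u) by (exists (cnt s j v - 1); split; [lia | auto]).
    destruct (Hs1 _ _ Hv Hm) as [Hm' Hne].
    apply wp_seq, wp_asg.
    { ok; rewrite ?(Fv 10), ?(Fv 12), ?Ej, ?Ev by lia; lia. }
    ev. rewrite (Fv 10), (Fv 12), Ej, Ev, <- Equ by lia.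
    match goal with |- wp _ _ _ ?s1 _ => pose proof (wp_remboth s1 j u v) as H1 end.
    eapply wp_conseq; [apply H1; ev; auto; rewrite ?Fv by lia; auto|]; clear H1; ev.
    intros t2 s2 (-> & [Fv2 Fa2] & Hw2 & M & C3 & C4 & C5 & P2). ev.
    assert (M' : forall x a b, mem s2 x a b <-> mem s x a b /\
      ~ (x = j /\ (a = v /\ b = u \/ a = u /\ b = v))) by (intros; apply M).
    clear M. split; [|lia].
    split; [lia|].
    split. { intros x Hx Hx'. rewrite Fv2 by auto. destruct (Nat.eqb_spec x 11); [lia|]. auto. }
    split. { intros. rewrite Fa2 by auto. apply Fa; auto. }
    split; [auto|].
    split. { intros a b Ha Hab. apply M' in Hab as [Hab Hn].
      destruct (Hs1 _ _ Ha Hab) as [Hba Hne']. split; auto. apply M'. split; auto.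
      intros [_ H]. apply Hn. split; auto. tauto. }
    split. { intros x a b H. apply M1. now apply M' in H. }
    split. { intros x a b H Hn. apply M'. split; [now apply M2|].
      intros [E H']. apply Hn. split; auto. tauto. }
    split. { intros x a. specialize (C1 x a). specialize (C4 x a). lia. }
    split. { intros x a Hx. rewrite C5 by auto. apply C2; auto. }
    unfold Phi in *. ev. lia.
  - intros s t (Ht & Fv & Fa & Hw1 & Hs1 & M1 & M2 & C1 & C2 & P1) Hge. ev.
    rewrite (Fv 10), (Fv 12), Ej, Ev in Hge by lia.
    split; [lia|]. split; [auto|]. split; [auto|]. split; [auto|].
    assert (Hno : forall b, ~ mem s j v b) by (intros b (k & Hk & _); lia).
    split.
    { intros x a b Ha. split; [|intros [H1 H2]; auto].
      intros Hab. split; auto. intros [-> [-> | ->]]; [exact (Hno _ Hab)|].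
      apply Hs1 in Hab; auto. exact (Hno _ (proj1 Hab)). }
    split; [auto|]. split; [auto|]. split; lia.
Qed.

(** [O] is the number of removed edges. It pays for the time, and only the share of level [i] is
    needed as a lower bound for it. *)
Lemma wp_clear s0 i v : vr s0 13 = i -> vr s0 12 = v -> vr s0 6 = NL ->
  i <= NL -> v < n -> WF s0 ->
  (forall j a b, j <= NL -> a < n -> mem s0 j a b -> mem s0 j b a /\ a <> b) ->
  wp N W clear s0 (fun t s' => exists O, t <= 18 * O + 5 * (NL + 1) /\
    (forall x, x < 30 -> x <> 10 -> x <> 11 -> vr s' x = vr s0 x) /\
    (forall t i j k, t = 0 \/ 4 <= t -> ar s' t i j k = ar s0 t i j k) /\
    WF s' /\
    (forall j a b, j <= NL -> a < n ->
      (mem s' j a b <-> mem s0 j a b /\ (j < i \/ (a <> v /\ b <> v)))) /\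
    (forall j a, cnt s' j a <= cnt s0 j a) /\
    (forall j a, j < i -> cnt s' j a = cnt s0 j a) /\
    (forall j, i <= j <= NL -> cnt s' j v = 0) /\
    cnt s0 i v <= O /\ Phi s' + 2 * O = Phi s0).
Proof.
  intros Ei Ev ENL Hi Hv Hw Hsym. pose proof pow_facts as HP.
  apply wp_seq, wp_asg; [ok|]. ev. rewrite Ei.
  match goal with |- wp _ _ _ ?s _ => set (s1 := s) end.
  apply wp_while with (mu := fun s => S NL - vr s 10) (Inv := fun s t => exists O j,
    vr s 10 = j /\ i <= j <= S NL /\
    t + 3 * i <= 18 * O + 3 * j /\
    (forall x, x < 30 -> x <> 10 -> x <> 11 -> vr s x = vr s0 x) /\
    (forall t i j k, t = 0 \/ 4 <= t -> ar s t i j k = ar s0 t i j k) /\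
    WF s /\
    (forall x a b, a < n ->
      (mem s x a b <-> mem s0 x a b /\ ~ (i <= x < j /\ (a = v \/ b = v)))) /\
    (forall x a, cnt s x a <= cnt s0 x a) /\
    (forall x a, x < i \/ j <= x -> cnt s x a = cnt s0 x a) /\
    (forall x, i <= x < j -> cnt s x v = 0) /\
    (i < j -> cnt s0 i v <= O) /\ Phi s + 2 * O = Phi s0).
  - exists 0, i. subst s1. ev. split; [auto|]. split; [lia|]. split; [lia|].
    split. { intros x H1 H2 H3. destruct (Nat.eqb_spec x 10); [lia | auto]. }
    split; [auto|]. split; [auto|].
    split. { intros. unfold mem. ev. fold (mem s0 x a b). split; [|tauto].
      intros; split; auto. lia. }
    split; [auto|]. split; [auto|]. split; [lia|]. split; [lia|]. unfold Phi. ev. lia.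
  - intros s t (O & j & Ej & Hj & _ & Fv & _). split; ok. rewrite Fv by lia. lia.
  - intros s t (O & j & Ej & Hj & Ht & Fv & Fa & Hw1 & M1 & C1 & C2 & C3 & HO & P1) Hlt.
    ev. rewrite Ej, Fv, ENL in Hlt by lia.
    apply wp_seq. eapply wp_conseq; [apply (wp_clear_level s j v); auto; try lia|].
    { rewrite Fv by lia. auto. }
    { intros a b Ha Hab. apply M1 in Hab as [Hab Hn]; auto.
      assert (Hb : b < n) by (eapply (mem_pos s0 j a b); eauto; lia).
      apply Hsym in Hab; auto; [|lia]. split; [|tauto].
      apply M1; auto. split; [tauto|]. intros [H _]; lia. }
    intros t2 s2 (Ht2 & Fv2 & Fa2 & Hw2 & M2 & C4 & C5 & C6 & P2).
    apply wp_asg; [ok; rewrite Fv2, Ej by lia; lia|]. ev.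
    rewrite Fv2, Ej by lia. split; [|lia].
    exists (O + cnt s j v), (S j). split; [lia|]. split; [lia|].
    split; [rewrite ?C2 in Ht2 by lia; rewrite C2 by lia; lia|].
    split. { intros x H1 H2 H3. destruct (Nat.eqb_spec x 10); [lia|].
      rewrite Fv2 by lia. auto. }
    split. { intros. rewrite Fa2 by auto. auto. }
    split; [auto|].
    split. { intros x a b Ha. change (mem s2 x a b <-> mem s0 x a b /\ ~ (i <= x < S j /\ (a = v \/ b = v))).
      rewrite M2, M1 by auto. split.
      - intros [[H1 H2] H3]. split; auto. intros [H4 H5].
        destruct (Nat.eq_dec x j); [apply H3; auto|]. apply H2. split; auto. lia.
      - intros [H1 H2]. split; [split; auto; intros [H3 H4]; apply H2; split; auto; lia|].
        intros [-> H3]. apply H2. split; auto. lia. }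
    split. { intros x a. specialize (C4 x a). specialize (C1 x a). lia. }
    split. { intros x a Hx. rewrite C5 by lia. apply C2. lia. }
    split. { intros x Hx. destruct (Nat.eq_dec x j) as [-> | Hn]; auto.
      rewrite C5 by auto. apply C3. lia. }
    split. { intros _. destruct (Nat.eq_dec i j) as [-> | Hn]; [rewrite C2; lia|].
      assert (i < j) by lia. specialize (HO ltac:(auto)). lia. }
    unfold Phi in *. ev. lia.
  - intros s t (O & j & Ej & Hj & Ht & Fv & Fa & Hw1 & M1 & C1 & C2 & C3 & HO & P1) Hge.
    ev. rewrite Ej, Fv, ENL in Hge by lia. assert (j = S NL) as -> by lia.
    exists O. split; [lia|]. split; [auto|]. split; [auto|]. split; [auto|].
    split. { intros j a b Hj' Ha. rewrite M1 by auto. split; intros [H1 H2]; split; auto.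
      - destruct (le_lt_dec i j); [right | auto].
        split; intros E; apply H2; split; auto; lia.
      - intros [H3 H4]. lia. }
    split; [auto|]. split; [intros; apply C2; lia|]. split; [intros; apply C3; lia|].
    split; [apply HO; lia | auto].
Qed.

Lemma wp_for_K bound body (I : nat -> st -> Prop) (c : nat) (m : nat) s0 (Q : nat -> st -> Prop) :
  (forall k s, I k s -> k <= m -> vr s 19 = k -> okx N W bound s /\ eval bound s = m) ->
  m < N ->
  I 0 (setv s0 19 0) ->
  (forall k s, I k s -> k < m -> vr s 19 = k ->
    wp N W body s (fun t s' => t < c /\ vr s' 19 = k /\ I (S k) (setv s' 19 (S k)))) ->
  (forall t s, t <= (c + 1) * m + 2 -> I m s -> Q t s) ->
  wp N W (for_K bound body) s0 Q.
Proof.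
  intros Hb Hm H0 Hs HQ. pose proof pow_facts as HP.
  apply wp_seq, wp_asg; [ok|]. evg.
  apply wp_while with (mu := fun s => m - vr s 19) (Inv := fun s t => exists k,
    vr s 19 = k /\ k <= m /\ I k s /\ t <= (c + 1) * k).
  - exists 0. repeat split; auto; lia.
  - intros s t (k & E & Hk & HI & Ht). split; [ok|]. now apply (Hb k).
  - intros s t (k & E & Hk & HI & Ht) Hlt. ev. rewrite (proj2 (Hb _ _ HI Hk E)), E in Hlt.
    apply wp_seq. eapply wp_conseq; [apply (Hs k); auto|].
    intros t1 s1 (Ht1 & E1 & HI1). apply wp_asg; [ok|]. evg.
    rewrite E1. split; [|lia]. exists (S k). rewrite Nat.add_1_r.
    split; [auto|]. split; [lia|]. split; [auto|]. nia.
  - intros s t (k & E & Hk & HI & Ht) Hge. ev. rewrite (proj2 (Hb _ _ HI Hk E)), E in Hge.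
    assert (k = m) as -> by lia. apply HQ; auto. lia.
Qed.

(** The minimum of [B] counters is at most their average, and the counters add up to [M] because
    each neighbour has exactly one digit. *)
Lemma wp_pick s0 j v B M : vr s0 10 = j -> vr s0 12 = v -> vr s0 20 = B -> vr s0 21 = M ->
  1 <= j <= NL -> v < n -> 1 <= B < N -> M = cnt s0 (j - 1) v -> WF s0 ->
  (forall a, a < n -> col s0 a < N * N) ->
  wp N W pick s0 (fun t s' => t <= 20 * (B + M + 1) /\
    (forall x, x <> 11 -> x <> 17 -> x <> 19 -> vr s' x = vr s0 x) /\
    (forall t i j k, t <> 7 -> ar s' t i j k = ar s0 t i j k) /\
    vr s' 17 < B /\
    B * sumn (fun k => if (col s0 (adj s0 (j - 1) v k) / Qq s0 j) mod B =? vr s' 17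
                       then 1 else 0) M <= M).
Proof.
  intros Ej Ev EB EM Hj Hv HB HM Hw Hcol. pose proof pow_facts as HP.
  assert (HMn : M <= n) by (rewrite HM; apply cnt_le; auto; lia).
  set (dig := fun k => (col s0 (adj s0 (j - 1) v k) / Qq s0 j) mod B).
  set (FV := fun s => forall x, x <> 11 -> x <> 17 -> x <> 19 -> vr s x = vr s0 x).
  set (FA := fun s => forall t i j k, t <> 7 -> ar s t i j k = ar s0 t i j k).
  unfold pick. apply wp_seq.
  apply (wp_for_K _ _ (fun k s => FV s /\ FA s /\ forall d, d < k -> dcc s d = 0) 2 B).
  { intros k s (F & _ & _) _ E. split; ok. rewrite F by lia. auto. }
  { lia. }
  { split; [|split]; [|intros ? ? ? ? ?; reflexivity|intros; lia].
    intros x _ _ H. ev. destruct (Nat.eqb_spec x 19); [lia | auto]. }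
  { intros k s (F & F' & HI) Hk E. apply wp_sto; [ok|ok|]. evg. split; [lia|]. split; [auto|].
    split; [|split].
    - intros x H1 H2 H3. evg. destruct (Nat.eqb_spec x 19); [lia|]. apply F; auto.
    - intros t i j' k' Ht. evg. destruct (Nat.eqb_spec t 7); [lia|]. apply F'; auto.
    - intros d Hd. evg. rewrite E. destruct (Nat.eqb_spec d k); auto. apply HI. lia. }
  intros t1 s1 Ht1 (F1 & F1' & I1). apply wp_seq.
  apply (wp_for_K _ _ (fun k s => FV s /\ FA s /\
    forall d, d < B -> dcc s d = sumn (fun k => if dig k =? d then 1 else 0) k) 5 M).
  { intros k s (F & _ & _) _ E. split; ok. rewrite F by lia. auto. }
  { lia. }
  { split; [|split]; auto.
    intros x H1 H2 H3. ev. destruct (Nat.eqb_spec x 19); [lia|]. apply F1; auto. }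
  { intros k s (F & F' & HI) Hk E.
    assert (Hu : adj s0 (j - 1) v k < n) by (apply Hw; auto; lia).
    specialize (Hcol _ Hu).
    assert (Ha : adj s (j - 1) v k = adj s0 (j - 1) v k) by (apply F'; lia).
    assert (Hx : col s0 (adj s0 (j - 1) v k) / Qq s0 j <= col s0 (adj s0 (j - 1) v k))
      by apply div_le_self.
    apply wp_seq, wp_asg.
    { ok; rewrite ?(F 10), ?(F 12) by lia; lia. }
    evg. rewrite (F 10), (F 12), Ej, Ev, E, Ha by lia.
    apply wp_seq, wp_asg.
    { ok; rewrite ?(F 10) by lia; lia. }
    evg. rewrite (F 10), Ej, !F' by lia.
    assert (Hd : dig k < B) by (apply Nat.mod_upper_bound; lia).
    assert (Emod : forall x, x - x / B * B = x mod B).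
    { intros x. rewrite Nat.Div0.mod_eq. lia. }
    assert (Hdm : forall x, x / B * B <= x).
    { intros x. rewrite Nat.mul_comm. apply Nat.Div0.mul_div_le. }
    specialize (Hdm (col s0 (adj s0 (j - 1) v k) / Qq s0 j)).
    apply wp_seq, wp_asg.
    { ok; rewrite ?(F 20), ?EB by lia; lia. }
    evg. rewrite (F 20), EB, Emod by lia. fold (dig k).
    assert (Hle : forall d, sumn (fun k => if dig k =? d then 1 else 0) k <= k).
    { intros d. transitivity (sumn (fun _ => 1) k); [|rewrite sumn_const; lia].
      apply sumn_mono. intros k' _. destruct (dig k' =? d); lia. }
    specialize (Hle (dig k)).
    apply wp_sto.
    { ok. }
    { ok. rewrite HI by auto. lia. }
    evg. split; [lia|]. split; [auto|]. split; [|split].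
    - intros x H1 H2 H3. evg. destruct (Nat.eqb_spec x 19); [lia|].
      destruct (Nat.eqb_spec x 17); [lia|]. destruct (Nat.eqb_spec x 11); [lia|]. apply F; auto.
    - intros t i j' k' Ht. evg. destruct (Nat.eqb_spec t 7); [lia|]. apply F'; auto.
    - intros d Hd'. evg. cbn [sumn]. rewrite (Nat.eqb_sym (dig k) d).
      destruct (Nat.eqb_spec d (dig k)) as [-> | Hne]; rewrite HI; auto. }
  intros t2 s2 Ht2 (F2 & F2' & I2). apply wp_seq, wp_asg; [ok|]. evg.
  apply (wp_for_K _ _ (fun k s => FV s /\ FA s /\
    (forall d, d < B -> dcc s d = sumn (fun k => if dig k =? d then 1 else 0) M) /\
    vr s 17 < B /\ (forall d, d < k -> dcc s (vr s 17) <= dcc s d)) 4 B).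
  { intros k s (F & _ & _) _ E. split; ok. rewrite F by lia. auto. }
  { lia. }
  { split; [|split; [|split; [|split]]]; auto; evg; try lia.
    intros x H1 H2 H3. evg. destruct (Nat.eqb_spec x 19); [lia|].
    destruct (Nat.eqb_spec x 17); [lia|]. apply F2; auto. }
  { intros k s (F & F' & HI & HX & Hmin) Hk E.
    apply wp_if; [ok|ok| |]; evg; rewrite E; intros Hc.
    - apply wp_asg; [ok|]. evg. rewrite E. split; [lia|]. split; [auto|].
      split; [|split; [|split; [|split]]]; evg; auto.
      + intros x H1 H2 H3. evg. destruct (Nat.eqb_spec x 19); [lia|].
        destruct (Nat.eqb_spec x 17); [lia|]. apply F; auto.
      + intros d Hd. destruct (Nat.eq_dec d k) as [-> |]; [lia|].
        specialize (Hmin d ltac:(lia)). lia.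
    - apply wp_skip. split; [lia|]. split; [auto|].
      split; [|split; [|split; [|split]]]; evg; auto.
      + intros x H1 H2 H3. evg. destruct (Nat.eqb_spec x 19); [lia|]. apply F; auto.
      + intros d Hd. destruct (Nat.eq_dec d k) as [-> |]; [lia|].
        specialize (Hmin d ltac:(lia)). lia. }
  intros t3 s3 Ht3 (F3 & F3' & I3 & HX & Hmin).
  split; [nia|]. split; [exact F3|]. split; [exact F3'|]. split; [exact HX|].
  fold dig. change (B * sumn (fun k => if dig k =? vr s3 17 then 1 else 0) M <= M).
  rewrite <- I3 by auto.
  transitivity (sumn (fun d => dcc s3 d) B).
  - rewrite <- sumn_const. apply sumn_mono. auto.
  - rewrite (sumn_ext _ (fun d => sumn (fun k => if dig k =? d then 1 else 0) M)) by auto.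
    rewrite sumn_swap.
    rewrite (sumn_ext _ (fun _ => 1)).
    + rewrite sumn_const. lia.
    + intros k _. apply sumn_indicator. apply Nat.mod_upper_bound. lia.
Qed.

(** Every vertex whose degree grows ends up flagged, except [v], whose new degree is controlled by
    the choice of its digit instead. *)
Lemma wp_add_loop s0 j v M : vr s0 10 = j -> vr s0 12 = v -> vr s0 21 = M ->
  1 <= j <= NL -> v < n -> M = cnt s0 (j - 1) v -> WF s0 -> StkOK s0 ->
  (forall u, ~ mem s0 j v u) -> (forall u, u < n -> ~ mem s0 j u v) -> ~ mem s0 (j - 1) v v ->
  cnt s0 j v = 0 ->
  let p u := col s0 u / Qq s0 j =? col s0 v / Qq s0 j in
  wp N W add_loop s0 (fun t s => t <= 22 * (M + 1) /\
    (forall x, x < 30 -> x <> 7 -> x <> 11 -> x <> 19 -> vr s x = vr s0 x) /\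
    (forall t i j k, t = 0 \/ t = 4 \/ 7 <= t -> ar s t i j k = ar s0 t i j k) /\
    WF s /\ StkOK s /\
    cnt s j v = sumn (fun k => if p (adj s0 (j - 1) v k) then 1 else 0) M /\
    (forall x a b, mem s x a b <-> mem s0 x a b \/ (x = j /\
      (a = v /\ mem s0 (j - 1) v b /\ p b = true \/
       b = v /\ mem s0 (j - 1) v a /\ p a = true))) /\
    (forall x a, x <> j -> cnt s x a = cnt s0 x a) /\
    (forall x, flg s0 x <> 0 -> flg s x <> 0) /\
    flg s v = flg s0 v /\
    (forall a, a <> v -> cnt s j a = cnt s0 j a \/ flg s a <> 0) /\
    Phi s = Phi s0 + 2 * cnt s j v /\
    vr s 7 <= vr s0 7 + cnt s j v).
Proof.
  intros Ej Ev EM Hj Hv HM Hw HS Hm1 Hm2 Hirr Hc0 p. pose proof pow_facts as HP.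
  assert (HMn : M <= n) by (rewrite HM; apply cnt_le; auto; lia).
  set (A := fun k => adj s0 (j - 1) v k).
  assert (HA : forall k, k < M -> A k < n /\ A k <> v /\ pos s0 (j - 1) v (A k) = k).
  { intros k Hk. destruct (Hw (j - 1) v k) as [H1 H2]; auto; try lia.
    split; [exact H1|]. split; [|exact H2]. intros E. apply Hirr. exists k. split; [lia | exact E]. }
  unfold add_loop.
  apply (wp_for_K _ _ (fun k s =>
    (forall x, x < 30 -> x <> 7 -> x <> 11 -> x <> 19 -> vr s x = vr s0 x) /\
    (forall t i j k, t = 0 \/ t = 4 \/ 7 <= t -> ar s t i j k = ar s0 t i j k) /\
    WF s /\ StkOK s /\
    cnt s j v = sumn (fun k => if p (A k) then 1 else 0) k /\
    (forall x a b, mem s x a b <-> mem s0 x a b \/ (x = j /\ exists k', k' < k /\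
      p (A k') = true /\ (a = v /\ b = A k' \/ a = A k' /\ b = v))) /\
    (forall x a, x <> j -> cnt s x a = cnt s0 x a) /\
    (forall x a k, x <> j -> adj s x a k = adj s0 x a k) /\
    (forall x, flg s0 x <> 0 -> flg s x <> 0) /\
    flg s v = flg s0 v /\
    (forall a, a <> v -> cnt s j a = cnt s0 j a \/ flg s a <> 0) /\
    Phi s = Phi s0 + 2 * cnt s j v /\
    vr s 7 <= vr s0 7 + cnt s j v) 20 M).
  { intros k s (F & _) _ E. split; ok. rewrite F by lia. auto. }
  { lia. }
  { split. { intros x H1 H2 H3 H4. evg. destruct (Nat.eqb_spec x 19); [lia | auto]. }
    split; [auto|]. split; [exact Hw|]. split; [exact HS|]. split; [auto|].
    split. { intros x a b. unfold mem. evg. split; [auto|].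
      intros [H | (_ & k' & Hk' & _)]; [auto | lia]. }
    split; [auto|]. split; [auto|]. split; [auto|]. split; [auto|]. split; [auto|].
    unfold Phi. evg. split; lia. }
  { intros k s (F & F' & Hw1 & HS1 & C1 & M1 & C2 & A1 & G1 & G2 & G3 & P1 & T1) Hk E.
    destruct (HA k Hk) as (Hu & Hne & Hpk).
    apply wp_seq, wp_asg.
    { ok; rewrite ?(F 10), ?(F 12) by lia; lia. }
    evg. rewrite (F 10), (F 12), Ej, Ev, E, A1 by lia. fold (A k).
    apply wp_if.
    { ok; rewrite ?(F 10), ?(F 12) by lia; lia. }
    { ok. }
    - evg. rewrite (F 10), (F 12), Ej, Ev, !F' by lia. intros Hx.
      assert (Hp : p (A k) = true).
      { apply Nat.eqb_eq. apply Nat.lxor_eq. lia. }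
      (* By [pos] the entries [A k'] are pairwise distinct, so no earlier iteration has inserted
         this edge. *)
      assert (Hn1 : ~ mem s j v (A k)).
      { intros Hm. apply M1 in Hm as [Hm | (_ & k' & Hk' & _ & [[_ H] | [H _]])].
        - exact (Hm1 _ Hm).
        - destruct (HA k') as (_ & _ & H'); [lia|]. rewrite <- H in H'. lia.
        - destruct (HA k') as (_ & H' & _); [lia|]. congruence. }
      assert (Hn2 : ~ mem s j (A k) v).
      { intros Hm. apply M1 in Hm as [Hm | (_ & k' & Hk' & _ & [[H _] | [H _]])].
        - exact (Hm2 _ Hu Hm).
        - congruence.
        - destruct (HA k') as (_ & _ & H'); [lia|]. rewrite <- H in H'. lia. }
      apply wp_seq.
      match goal with |- wp _ _ _ ?s1 _ => pose proof (wp_addboth s1 j (A k) v) as H1 end.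
      eapply wp_conseq; [apply H1; evg; auto; try lia; rewrite F by lia; auto|]. clear H1.
      intros t2 s2 (-> & [Fv2 Fa2] & Hw2 & M2 & C3 & C4 & C5 & P2 & A2). ev.
      assert (HS2 : StkOK s2).
      { apply (StkOK_ext s); auto. rewrite Fv2 by lia. reflexivity.
        intros. rewrite Fa2 by lia. reflexivity. }
      eapply wp_conseq; [apply (wp_push s2 (A k)); auto|].
      { rewrite Fv2 by lia. reflexivity. }
      intros t3 s3 (Ht3 & Fv3 & Fa3 & HS3 & T3 & G4 & G5).
      assert (C6 : forall x a, cnt s3 x a = cnt s2 x a) by (intros; apply Fa3; lia).
      assert (M3 : forall x a b, mem s3 x a b <-> mem s2 x a b).
      { intros. unfold mem. rewrite C6. split; intros (k' & Hk' & H); exists k'.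
        - rewrite Fa3 in H by lia. auto.
        - rewrite Fa3 by lia. auto. }
      split; [lia|]. split; [rewrite Fv3, Fv2 by lia; auto|].
      split. { intros x H1 H2 H3 H4. evg. destruct (Nat.eqb_spec x 19); [lia|].
        rewrite Fv3, Fv2 by lia. destruct (Nat.eqb_spec x 11); [lia|]. auto. }
      split. { intros. evg. rewrite Fa3, Fa2 by lia. apply F'. auto. }
      split. { intros x a k' Hx' Ha'. evg. rewrite !Fa3 by lia. apply Hw2; auto. }
      split. { apply (StkOK_ext s3); auto. }
      evg. split. { rewrite C6, C3. cbn [sumn]. rewrite Hp, C1. lia. }
      split.
      { intros x a b. change (mem s3 x a b <-> mem s0 x a b \/ (x = j /\ exists k', k' < S k /\
          p (A k') = true /\ (a = v /\ b = A k' \/ a = A k' /\ b = v))).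
        rewrite M3, M2. unfold mem at 1. evg. fold (mem s x a b). rewrite M1. split.
        - intros [[H | (Hxj & k' & Hk' & H)] | (Hxj & H)]; auto.
          + right. split; auto. exists k'. split; auto.
          + right. split; auto. exists k. split; auto.
        - intros [H | (Hxj & k' & Hk' & Hp' & H)]; auto.
          destruct (Nat.eq_dec k' k) as [-> | Hkn]; auto.
          left. right. split; auto. exists k'. split; [lia | auto]. }
      split. { intros x a Hx'. rewrite C6, C5 by auto. auto. }
      split. { intros x a k' Hx'. rewrite Fa3, A2 by lia. auto. }
      split. { intros x Hx'. destruct (Nat.eq_dec x (A k)) as [-> | Hxn]; auto.
        rewrite G5, Fa2 by lia. auto. }
      split. { rewrite G5, Fa2 by lia. auto. }
      split. { intros a Ha. destruct (Nat.eq_dec a (A k)) as [-> | Han]; auto.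
        rewrite C6, C5, G5, Fa2 by lia. auto. }
      split. { rewrite C6. replace (Phi (setv s3 19 (S k))) with (Phi s2);
          [unfold Phi in *; ev; lia|].
        apply sumn_ext. intros. apply sumn_ext. intros. symmetry. apply C6. }
      rewrite C6, C3. rewrite Fv2 in T3 by lia. ev. lia.
    - evg. rewrite (F 10), (F 12), Ej, Ev, !F' by lia. intros Hx.
      assert (Hp : p (A k) = false).
      { apply Nat.eqb_neq. intros Heq. unfold p in *. rewrite Heq, Nat.lxor_nilpotent in Hx. lia. }
      apply wp_skip. split; [lia|]. split; [auto|].
      split. { intros x H1 H2 H3 H4. evg. destruct (Nat.eqb_spec x 19); [lia|].
        destruct (Nat.eqb_spec x 11); [lia|]. auto. }
      split; [auto|]. split; [exact Hw1|]. split; [exact HS1|].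
      evg. split. { cbn [sumn]. rewrite Hp, C1. lia. }
      split.
      { intros x a b. change (mem s x a b <-> mem s0 x a b \/ (x = j /\ exists k', k' < S k /\
          p (A k') = true /\ (a = v /\ b = A k' \/ a = A k' /\ b = v))).
        rewrite M1. split.
        - intros [H | (Hxj & k' & Hk' & H)]; auto. right. split; auto. exists k'. split; auto.
        - intros [H | (Hxj & k' & Hk' & Hp' & H)]; auto.
          destruct (Nat.eq_dec k' k) as [-> | Hkn]; [congruence|].
          right. split; auto. exists k'. split; [lia | auto]. }
      repeat (split; [auto; fail|]). unfold Phi in *. evg. repeat split; lia. }
  intros t s Ht (F & F' & Hw1 & HS1 & C1 & M1 & C2 & A1 & G1 & G2 & G3 & P1 & T1).
  split; [lia|]. split; [auto|]. split; [auto|]. split; [auto|]. split; [auto|].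
  split; [exact C1|].
  split.
  { intros x a b. rewrite M1. split.
    - intros [H | (Hxj & k' & Hk' & Hp & [[Ha Hb] | [Ha Hb]])]; auto; right; split; auto; subst.
      + left. split; auto. split; auto. exists k'. split; [lia | auto].
      + right. split; auto. split; auto. exists k'. split; [lia | auto].
    - intros [H | (Hxj & [(Ha & (k' & Hk' & E) & Hp) | (Hb & (k' & Hk' & E) & Hp)])]; auto;
        right; split; auto; exists k'; fold (A k') in E; rewrite E; split; auto; lia. }
  repeat (split; [auto; fail|]). auto.
Qed.

End Graphs.

(** * Recolouring a vertex *)

(* The prefix of length [j] of a colour [c] is [c / q j].  While the digits of [v] are being
   chosen, [col v] is kept divisible by [q (j - 1)], i.e. the undecided digits are zero, so
   that the prefixes already fixed can be read off [col v] as for any other vertex. *)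
Definition assign_level : com :=
  Asg 20 (EOp ODiv (EL 9 eO eO (minus1 eJ)) (EL 9 eO eO eJ));;
  Asg 21 (EL 3 eO (minus1 eJ) eV);;
  pick;;
  Sto 4 eO eO eV (EOp OAdd (EL 4 eO eO eV) (EOp OMul eX (EL 9 eO eO eJ)));;
  add_loop.

Definition assign : com :=
  Asg 10 eI;; While eJ (plus1 eNL) (assign_level;; Asg 10 (plus1 eJ)).

Definition recolor : com :=
  clear;;
  Asg 17 (EL 9 eO eO (minus1 eI));;
  Sto 4 eO eO eV (EOp OMul (EOp ODiv (EL 4 eO eO eV) eX) eX);;
  assign;;
  Asg 17 (EOp OAdd eV (EC 8));;
  If eX (EC RR) Skip (Sto 0 eO eO eX (EL 4 eO eO eV)).

Section Recolor.
Variables (n NL N W : nat).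
Hypothesis HRN : RR + 8 < N.
Hypothesis HnN : n + 8 < N.
Hypothesis HLN : NL < N.
Hypothesis HNW : N * N * N * N * N * N <= W.
Variables (q b D : nat -> nat) (E : nat -> nat -> Prop).
Hypothesis Hqs : forall j, j < NL -> q j = q (S j) * b (S j).
Hypothesis Hq1 : q NL = 1.
Hypothesis Hb : forall j, 1 <= j <= NL -> 1 <= b j < N.
Hypothesis Hq0 : q 0 < N * N.
Hypothesis HD : forall j, 1 <= j <= NL -> D (j - 1) / b j <= D j.
Hypothesis Esym : forall a c, E a c -> E c a.
Hypothesis Eirr : forall a, ~ E a a.

Let HnN' : n < N. Proof. lia. Qed.

Ltac ok1 := repeat match goal with
  | |- _ /\ _ => split
  | |- True => exact I
  | |- idxok _ _ _ _ _ _ => apply (idxok_tag n NL N W HRN HnN' HLN HNW)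
  end.
Ltac ok := unfold prefix, eO, eJ, eU, eV, eI, eNL, eST, eK, eB, eM, eX, eF, aA, aB, aC, aP, aX, plus1, minus1;
  cbn [okx bok]; evg; ok1; try lia.

(** The radix products divide one another, which makes the prefixes of a colour nested. *)
Lemma q_mul x y : x <= y <= NL -> exists c, 1 <= c /\ q x = q y * c.
Proof.
  intros [H1 H2]. induction H1 as [|y H1 IH]; [exists 1; lia|].
  destruct IH as (c & Hc & Ec); [lia|]. exists (b (S y) * c).
  assert (B := Hb (S y)). rewrite Ec, Hqs by lia. split; nia.
Qed.

Lemma q_pos j : j <= NL -> 1 <= q j.
Proof.
  intros Hj. destruct (q_mul j NL) as (c & Hc & Ec); [lia|]. rewrite Ec, Hq1. lia.
Qed.

Lemma q_le j : j <= NL -> q j <= q 0.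
Proof. intros Hj. destruct (q_mul 0 j) as (c & Hc & Ec); [lia|]. nia. Qed.

Lemma prefix_mono x y a c : x <= y <= NL -> a / q y = c / q y -> a / q x = c / q x.
Proof.
  intros H Ea. destruct (q_mul x y H) as (d & Hd & Ed).
  rewrite Ed, <- !Nat.Div0.div_div, Ea. reflexivity.
Qed.

(** The summand [r] affects only digits from [j] on, which prefixes of length below [j] do not
    see. *)
Lemma prefix_extend c r x j : x < j <= NL -> r < q (j - 1) ->
  (c * q (j - 1) + r) / q x = c * q (j - 1) / q x.
Proof.
  intros Hx Hr. destruct (q_mul x (j - 1)) as (d & Hd & Ed); [lia|].
  assert (Hp := q_pos (j - 1)).
  rewrite Ed, <- !Nat.Div0.div_div. f_equal.
  rewrite Nat.div_add_l by lia. rewrite Nat.div_small by auto.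
  rewrite Nat.div_mul by lia. lia.
Qed.

(** The middle of a recolouring: the lists are exact below level [j], and from [j] on all edges at
    [v] are absent. *)
Definition MI (s : st) (j v : nat) : Prop := forall x a c, x <= NL -> a < n -> c < n ->
  (mem s x a c <-> E a c /\ col s a / q x = col s c / q x /\ (x < j \/ (a <> v /\ c <> v))).

(** The new neighbours of [v] at level [j] are neighbours at level [j - 1] whose digit [j] is the
    one picked; hence the factor [b j] between the two degrees. *)
Lemma wp_assign_level s0 j v : vr s0 10 = j -> vr s0 12 = v -> 1 <= j <= NL -> v < n ->
  (forall x, x <= NL -> Qq s0 x = q x) -> WF n NL s0 -> StkOK n s0 -> flg s0 v = 0 ->
  (forall a, a < n -> col s0 a < q 0) -> (exists c, col s0 v = c * q (j - 1)) ->
  MI s0 j v ->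
  wp N W assign_level s0 (fun t s => t <= 50 * (b j + cnt s0 (j - 1) v + 1) /\
    (forall x, x < 30 -> x <> 7 -> x <> 11 -> x <> 17 -> x <> 19 -> x <> 20 -> x <> 21 ->
       vr s x = vr s0 x) /\
    (forall t i j k, t = 0 \/ 8 <= t -> ar s t i j k = ar s0 t i j k) /\
    (forall a, a <> v -> col s a = col s0 a) /\ col s v < q 0 /\
    (exists c, col s v = c * q j) /\
    WF n NL s /\ StkOK n s /\ MI s (S j) v /\
    cnt s j v * b j <= cnt s0 (j - 1) v /\
    (forall x a, x <> j -> cnt s x a = cnt s0 x a) /\
    (forall x, flg s0 x <> 0 -> flg s x <> 0) /\ flg s v = 0 /\
    (forall a, a <> v -> cnt s j a = cnt s0 j a \/ flg s a <> 0) /\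
    Phi n NL s = Phi n NL s0 + 2 * cnt s j v /\
    vr s 7 <= vr s0 7 + cnt s j v).
Proof.
  intros Ej Ev Hj Hv HQ Hw HS Hf Hcol (c & Ec) HM.
  pose proof (pow_facts n NL N W HRN HnN' HLN HNW) as HP.
  assert (Hbj := Hb j Hj). assert (Hqj := q_pos j ltac:(lia)).
  assert (Hqj0 := q_le (j - 1) ltac:(lia)).
  assert (Eq : q (j - 1) = q j * b j).
  { rewrite Hqs by lia. replace (S (j - 1)) with j by lia. auto. }
  unfold assign_level.
  apply wp_seq, wp_asg; [ok|]. evg. rewrite Ej, !HQ, Eq, (Nat.mul_comm (q j)), Nat.div_mul by lia.
  apply wp_seq, wp_asg; [ok|]. evg. rewrite Ej, Ev.
  apply wp_seq.
  match goal with |- wp _ _ _ ?s1 _ => pose proof (wp_pick n NL N W HRN HnN' HLN HNW s1 j v (b j) (cnt s0 (j - 1) v)) as H1 end.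
  eapply wp_conseq; [apply H1; evg; auto|]; clear H1.
  { intros a Ha. specialize (Hcol a Ha). lia. }
  intros t1 s1 (Ht1 & F1 & A1 & HX & Hsum). ev.
  set (X := vr s1 17) in *.
  assert (HXq : X * q j < q (j - 1)) by (rewrite Eq; nia).
  assert (Hcv := Hcol v Hv).
  assert (HM0 : cnt s0 (j - 1) v <= n) by (apply (cnt_le n NL); auto; lia).
  apply wp_seq, wp_sto.
  { ok. rewrite F1 by lia. ev. lia. }
  { ok. all: rewrite ?(F1 12), ?(F1 10), ?A1 by lia; ev; rewrite ?Ev, ?Ej, ?HQ by lia; fold X; try lia. nia. }
  evg. rewrite (F1 12), (F1 10), !A1 by lia. ev. rewrite Ev, Ej, HQ by lia. fold X.
  match goal with |- wp _ _ _ ?s2 _ => set (s' := s2) end.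
  (* Here [c] is the prefix fixed so far, and the digit [X] is appended to it. *)
  assert (Hvq : (col s0 v + X * q j) / q j = c * b j + X).
  { rewrite Ec, Eq. replace (c * (q j * b j) + X * q j) with ((c * b j + X) * q j) by lia.
    apply Nat.div_mul. lia. }
  assert (Em : forall x a d, mem s' x a d <-> mem s0 x a d).
  { intros. subst s'. unfold mem. evg. split; intros (k & Hk & H); exists k;
      rewrite ?A1 in * by lia; auto. }
  assert (Ecn : forall x a, cnt s' x a = cnt s0 x a) by (intros; subst s'; evg; apply A1; lia).
  assert (Ead : forall x a k, adj s' x a k = adj s0 x a k) by (intros; subst s'; evg; apply A1; lia).
  assert (Ecv : col s' v = col s0 v + X * q j).
  { subst s'. evg. rewrite Nat.eqb_refl. auto. }
  assert (Eca : forall a, a <> v -> col s' a = col s0 a).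
  { intros a Ha. subst s'. evg. destruct (Nat.eqb_spec a v); [lia|]. apply A1. lia. }
  assert (Hnm1 : forall u, ~ mem s0 j v u).
  { intros u Hm. assert (Hu : u < n) by (apply (mem_pos n NL s0 j v u); auto; lia).
    apply HM in Hm; auto; lia. }
  assert (Hnm2 : forall u, u < n -> ~ mem s0 j u v).
  { intros u Hu Hm. apply HM in Hm; auto; lia. }
  assert (HirrM : ~ mem s0 (j - 1) v v).
  { intros Hm. apply HM in Hm as [Hm _]; auto; [|lia]. exact (Eirr _ Hm). }
  assert (Hc0 : cnt s0 j v = 0).
  { destruct (cnt s0 j v) eqn:Ecn0; auto. exfalso. apply (Hnm1 (adj s0 j v 0)).
    exists 0. split; [lia | auto]. }
  assert (Hwf' : WF n NL s').
  { intros x a k Hx Ha Hk. rewrite Ecn in Hk. rewrite Ead.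
    destruct (Hw x a k Hx Ha Hk) as [H1 H2]. split; auto.
    subst s'. evg. rewrite A1 by lia. auto. }
  assert (HS' : StkOK n s').
  { apply (StkOK_ext n s0); auto; [subst s'; evg; rewrite F1 by lia; reflexivity|].
    intros. subst s'. evg. destruct (Nat.eqb_spec t 4); [lia|]. apply A1. lia. }
  pose proof (wp_add_loop n NL N W HRN HnN' HLN HNW s' j v (cnt s0 (j - 1) v)) as H1.
  assert (Hqs' : Qq s' j = q j) by (subst s'; evg; rewrite A1 by lia; apply HQ; lia).
  eapply wp_conseq; [apply H1|]; clear H1; auto;
    try (subst s'; evg; rewrite F1 by lia; evg; auto; fail).
  { intros u Hu. apply Em in Hu. exact (Hnm1 _ Hu). }
  { intros u Hu Hm. apply Em in Hm. exact (Hnm2 _ Hu Hm). }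
  { intros Hm. apply Em in Hm. auto. }
  { rewrite Ecn. auto. }
  intros t2 s2 (Ht2 & F2 & A2 & Hw2 & HS2 & C2 & M2 & C3 & G1 & G2 & G3 & P2 & T2).
  rewrite Hqs' in *.
  assert (Ec2 : forall a, col s2 a = col s' a) by (intros; apply A2; lia).
  assert (Hpm : forall u, mem s0 (j - 1) v u -> u < n /\ u <> v /\ col s0 u / q (j - 1) = c).
  { intros u Hm. assert (Hu : u < n) by (apply (mem_pos n NL s0 (j - 1) v u); auto; lia).
    apply HM in Hm as (HE & H & _); auto; [|lia]. split; auto. split.
    - intros ->. exact (Eirr _ HE).
    - rewrite <- H, Ec, Nat.div_mul; auto. assert (Hp := q_pos (j - 1)). lia. }
  assert (Hold : forall x, x < j -> col s' v / q x = col s0 v / q x).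
  { intros x Hx. rewrite Ecv, Ec. apply prefix_extend; lia. }
  assert (Hcnt : cnt s2 j v * b j <= cnt s0 (j - 1) v).
  { rewrite C2, Nat.mul_comm. etransitivity; [|exact Hsum].
    apply Nat.mul_le_mono_l. apply sumn_mono. intros k Hk.
    rewrite Ead.
    assert (Hu := Hpm (adj s0 (j - 1) v k)). destruct Hu as (Hu & Hne & Hcu).
    { exists k. auto. }
    rewrite Eca by auto. rewrite HQ by lia. rewrite Ecv, Hvq.
    destruct (Nat.eqb_spec (col s0 (adj s0 (j - 1) v k) / q j) (c * b j + X)) as [Ed | Ed]; [|lia].
    rewrite Ed, (Nat.add_comm (c * b j)), Nat.Div0.mod_add, Nat.mod_small by auto.
    fold X. rewrite Nat.eqb_refl. auto. }
  split; [lia|].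
  split. { intros x ? ? ? ? ? ? ?. rewrite F2 by auto. subst s'. evg. rewrite F1 by auto. evg.
    destruct (Nat.eqb_spec x 21); [lia|]. destruct (Nat.eqb_spec x 20); [lia|]. auto. }
  split. { intros t i j' k Ht. rewrite A2 by lia. subst s'. evg.
    destruct (Nat.eqb_spec t 4); [lia|]. apply A1. lia. }
  split. { intros a Ha. rewrite Ec2, Eca; auto. }
  split.
  (* [q 0] is a multiple of [q (j - 1)], so [c * q (j - 1) < q 0] leaves room for a whole further
     block of size [q (j - 1)], and [X * q j] fits into it. *)
  { rewrite Ec2, Ecv, Ec. rewrite Ec in Hcv.
    destruct (q_mul 0 (j - 1)) as (d & Hd & Ed); [lia|]. rewrite Ed in Hcv |- *.
    rewrite Nat.mul_comm in Hcv. apply Nat.mul_lt_mono_pos_l in Hcv; [|lia].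
    assert (Hle : (c + 1) * q (j - 1) <= d * q (j - 1)) by (apply Nat.mul_le_mono_r; lia).
    lia. }
  split. { exists (c * b j + X). rewrite Ec2, Ecv, Ec, Eq. lia. }
  split; [exact Hw2|]. split; [exact HS2|].
  split.
  { intros x a d Hx Ha Hd. rewrite M2, Em, !Ec2.
    assert (Hxa : forall x a, x < j -> col s' a / q x = col s0 a / q x).
    { intros x' a' Hx'. destruct (Nat.eq_dec a' v) as [-> |]; [apply Hold; auto|].
      rewrite Eca by auto. auto. }
    (* Equal prefixes of length [j] are equal up to length [j - 1], so scanning the neighbours at
       level [j - 1] finds every edge of level [j] at [v]. *)
    assert (Hkey : forall u, u < n -> (mem s' (j - 1) v u /\ (col s' u / q j =? col s' v / q j) = true
      <-> E v u /\ col s' v / q j = col s' u / q j)).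
    { intros u Hu. assert (Hj1 : j - 1 <= NL) by lia.
      rewrite Em, (HM (j - 1) v u Hj1 Hv Hu), Nat.eqb_eq. split.
      - intros [(H1 & _) H2]; auto.
      - intros [H1 H2]. split; [|auto]. split; auto. split; [|left; lia].
        rewrite <- !Hxa by lia. apply (prefix_mono (j - 1) j); auto; lia. }
    rewrite (HM x a d) by auto.
    destruct (lt_eq_lt_dec x j) as [[Hxj | ->] | Hxj].
    - rewrite (Hxa x a), (Hxa x d) by auto. split.
      + intros [(H1 & H2 & H3) | [H _]]; [|lia]. split; [auto|]. split; [auto | left; lia].
      + intros (H1 & H2 & H3). left. split; [auto|]. split; [auto | left; lia].
    - split.
      + intros [(H1 & H2 & [H3 | H3]) | (_ & [(-> & H) | (-> & H)])]; [lia| | |].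
        * rewrite !Eca by tauto. auto.
        * apply Hkey in H as [H1 H2]; auto.
        * apply Hkey in H as [H1 H2]; auto.
      + intros (H1 & H2 & _).
        destruct (Nat.eq_dec a v) as [-> | Hav].
        * right. split; auto. left. split; auto. apply Hkey; auto.
        * destruct (Nat.eq_dec d v) as [-> | Hdv].
          -- right. split; auto. right. split; auto. apply Hkey; auto.
          -- left. rewrite !Eca in H2 by auto. auto.
    - split.
      + intros [(H1 & H2 & [H3 | H3]) | [H _]]; [lia| |lia].
        rewrite !Eca by tauto. auto.
      + intros (H1 & H2 & [H3 | H3]); [lia|]. rewrite !Eca in H2 by tauto. auto. }
  split; [auto|].
  split. { intros. rewrite C3, Ecn; auto. }
  assert (Hfl : forall x, flg s' x = flg s0 x) by (intros; subst s'; evg; apply A1; lia).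
  split. { intros x Hx. apply G1. rewrite Hfl. auto. }
  split. { rewrite G2, Hfl. auto. }
  split. { intros a Ha. rewrite <- Ecn. auto. }
  split. { rewrite P2. f_equal. apply sumn_ext. intros. apply sumn_ext. intros. apply Ecn. }
  replace (vr s0 7) with (vr s' 7); auto. subst s'. evg. rewrite F1 by lia. auto.
Qed.

(* Sums over the levels below [i] of the new neighbours of a recoloured vertex ([gsum]) and
   of the time spent on it ([hsum]). *)
Definition gsum (i : nat) : nat := sumn (fun x => D (x - 1) / b x) i.
Definition hsum (i : nat) : nat := sumn (fun x => b x + D (x - 1) + 1) i.

(** [Nw] is the number of created edges. Putting [gsum i] on the left expresses a sum over the
    levels [i] to [NL] without truncated subtraction, and cancels the meaningless term at index
    0. *)
Lemma wp_assign s0 i v : vr s0 13 = i -> vr s0 12 = v -> vr s0 6 = NL ->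
  1 <= i <= NL -> v < n ->
  (forall x, x <= NL -> Qq s0 x = q x) -> WF n NL s0 -> StkOK n s0 -> flg s0 v = 0 ->
  (forall a, a < n -> col s0 a < q 0) -> (exists c, col s0 v = c * q (i - 1)) ->
  MI s0 i v -> cnt s0 (i - 1) v <= D (i - 1) ->
  wp N W assign s0 (fun t s => exists Nw, t + 52 * hsum i <= 52 * hsum (S NL) + 2 /\
    Nw + gsum i <= gsum (S NL) /\
    (forall x, x < 30 -> x <> 7 -> x <> 10 -> x <> 11 -> x <> 17 -> x <> 19 -> x <> 20 ->
       x <> 21 -> vr s x = vr s0 x) /\
    (forall t i j k, t = 0 \/ 8 <= t -> ar s t i j k = ar s0 t i j k) /\
    (forall a, a <> v -> col s a = col s0 a) /\ col s v < q 0 /\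
    WF n NL s /\ StkOK n s /\ MI s (S NL) v /\
    (forall x, i <= x <= NL -> cnt s x v <= D (x - 1) / b x) /\
    (forall x a, x < i -> cnt s x a = cnt s0 x a) /\
    (forall x, flg s0 x <> 0 -> flg s x <> 0) /\ flg s v = 0 /\
    (forall x a, a <> v -> cnt s x a <= cnt s0 x a \/ flg s a <> 0) /\
    Phi n NL s = Phi n NL s0 + 2 * Nw /\
    vr s 7 <= vr s0 7 + Nw).
Proof.
  intros Ei Ev ENL Hi Hv HQ Hw HS Hf Hcol Hdiv HM HDi.
  pose proof (pow_facts n NL N W HRN HnN' HLN HNW) as HP.
  apply wp_seq, wp_asg; [ok|]. evg. rewrite Ei.
  apply wp_while with (mu := fun s => S NL - vr s 10) (Inv := fun s t => exists Nw j,
    vr s 10 = j /\ i <= j <= S NL /\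
    t + 52 * hsum i <= 52 * hsum j /\
    Nw + gsum i <= gsum j /\
    (forall x, x < 30 -> x <> 7 -> x <> 10 -> x <> 11 -> x <> 17 -> x <> 19 -> x <> 20 ->
       x <> 21 -> vr s x = vr s0 x) /\
    (forall t i j k, t = 0 \/ 8 <= t -> ar s t i j k = ar s0 t i j k) /\
    (forall a, a <> v -> col s a = col s0 a) /\ col s v < q 0 /\
    (exists c, col s v = c * q (j - 1)) /\
    WF n NL s /\ StkOK n s /\ MI s j v /\
    (forall x, i <= x < j -> cnt s x v <= D (x - 1) / b x) /\
    (forall x a, x < i -> cnt s x a = cnt s0 x a) /\
    (forall x, flg s0 x <> 0 -> flg s x <> 0) /\ flg s v = 0 /\
    (forall x a, a <> v -> cnt s x a <= cnt s0 x a \/ flg s a <> 0) /\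
    Phi n NL s = Phi n NL s0 + 2 * Nw /\
    vr s 7 <= vr s0 7 + Nw).
  - exists 0, i. evg. split; [auto|]. split; [lia|]. split; [lia|]. split; [lia|].
    split. { intros. evg. destruct (Nat.eqb_spec x 10); [lia | auto]. }
    split; [auto|]. split; [auto|]. split; [auto|]. split; [auto|]. split; [exact Hw|].
    split; [exact HS|]. split; [exact HM|]. split; [intros; lia|]. split; [auto|].
    split; [auto|]. split; [auto|]. split; [auto|]. unfold Phi. evg. split; lia.
  - intros s t (Nw & j & Ej & Hj & _ & _ & F & _). split; ok. rewrite F by lia. lia.
  - intros s t (Nw & j & Ej & Hj & Ht & HN & F & A1 & Co & Cv & Cd & Hw1 & HS1 & HM1 & B1 & B2
      & G1 & G2 & B3 & P1 & T1) Hlt.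
    ev. rewrite Ej, F, ENL in Hlt by lia.
    (* This bounds the scan: for the first level by assumption, later because the digit just chosen
       keeps [v] within the threshold. *)
    assert (HB : cnt s (j - 1) v <= D (j - 1)).
    { destruct (Nat.eq_dec j i) as [-> | Hn]; [rewrite B2 by lia; auto|].
      etransitivity; [apply B1; lia|]. apply HD. lia. }
    assert (Hbj := Hb j ltac:(lia)).
    apply wp_seq. eapply wp_conseq; [apply (wp_assign_level s j v); auto; try lia|].
    { rewrite F by lia. auto. }
    { intros x Hx. rewrite A1 by lia. auto. }
    { intros a Ha. destruct (Nat.eq_dec a v) as [-> |]; auto. rewrite Co; auto. }
    intros t2 s2 (Ht2 & F2 & A2 & Co2 & Cv2 & Cd2 & Hw2 & HS2 & HM2 & B4 & B5 & G3 & G4 & B6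
      & P2 & T2).
    assert (HB2 : cnt s2 j v <= D (j - 1) / b j).
    { apply Nat.div_le_lower_bound; [lia|]. lia. }
    apply wp_asg; [ok; rewrite F2, Ej by lia; lia|]. evg.
    rewrite F2, Ej by lia. split; [|lia].
    exists (Nw + cnt s2 j v), (S j). split; [lia|]. split; [lia|].
    unfold hsum, gsum in *. cbn [sumn].
    split; [lia|]. split; [lia|].
    split. { intros. destruct (Nat.eqb_spec x 10); [lia|]. rewrite F2 by lia. auto. }
    split. { intros. rewrite A2 by lia. auto. }
    split. { intros a Ha. rewrite Co2; auto. }
    split; [auto|]. split. { replace (S j - 1) with j by lia. auto. }
    split; [exact Hw2|]. split; [exact HS2|]. split; [exact HM2|].
    split. { intros x Hx. destruct (Nat.eq_dec x j) as [-> | Hn]; auto.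
      rewrite B5 by auto. apply B1. lia. }
    split. { intros x a Hx. rewrite B5 by lia. auto. }
    split; [auto|]. split; [auto|].
    split. { intros x a Ha. destruct (B3 x a Ha) as [H | H]; [|right; auto].
      destruct (Nat.eq_dec x j) as [-> | Hn]; [|left; rewrite B5; auto].
      destruct (B6 a Ha) as [H' | H']; [left; lia | right; auto]. }
    unfold Phi in *. evg. split; lia.
  - intros s t (Nw & j & Ej & Hj & Ht & HN & F & A1 & Co & Cv & Cd & Hw1 & HS1 & HM1 & B1 & B2
      & G1 & G2 & B3 & P1 & T1) Hge.
    ev. rewrite Ej, F, ENL in Hge by lia. assert (j = S NL) as -> by lia.
    exists Nw. split; [lia|]. split; [auto|]. split; [auto|]. split; [auto|].
    split; [auto|]. split; [auto|]. split; [auto|]. split; [auto|]. split; [auto|].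
    split; [intros; apply B1; lia|]. repeat (split; [auto; fail|]). auto.
Qed.

Definition MemOK (s : st) : Prop := forall x a c, x <= NL -> a < n -> c < n ->
  (mem s x a c <-> E a c /\ col s a / q x = col s c / q x).

(** Colour cells below [RR] double as registers and are left to the epilogue. *)
Definition OutOK (s : st) : Prop := forall x, x < n -> RR <= 8 + x -> outc s (8 + x) = col s x.

(** A degree of another vertex can only have grown if that vertex is now flagged. For [v] itself the
    thresholds hold at all levels from [i] on. *)
Lemma wp_recolor s0 i v : vr s0 13 = i -> vr s0 12 = v -> vr s0 6 = NL ->
  1 <= i <= NL -> v < n ->
  (forall x, x <= NL -> Qq s0 x = q x) -> WF n NL s0 -> StkOK n s0 -> flg s0 v = 0 ->
  (forall a, a < n -> col s0 a < q 0) ->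
  MemOK s0 -> OutOK s0 -> cnt s0 (i - 1) v <= D (i - 1) ->
  wp N W recolor s0 (fun t s => exists O Nw,
    t <= 18 * O + 60 * (hsum (S NL) - hsum i) + 5 * (NL + 1) + 20 /\
    cnt s0 i v <= O /\ Nw + gsum i <= gsum (S NL) /\
    (forall x, x < 7 -> vr s x = vr s0 x) /\
    (forall t i j k, 8 <= t -> ar s t i j k = ar s0 t i j k) /\
    (forall a, a < n -> col s a < q 0) /\
    WF n NL s /\ StkOK n s /\ MemOK s /\ OutOK s /\
    (forall x, i <= x <= NL -> cnt s x v <= D x) /\
    (forall x a, x < i -> cnt s x a <= cnt s0 x a) /\
    (forall x, flg s0 x <> 0 -> flg s x <> 0) /\
    (forall x a, a <> v -> cnt s x a <= cnt s0 x a \/ flg s a <> 0) /\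
    Phi n NL s + 2 * O = Phi n NL s0 + 2 * Nw /\
    vr s 7 <= vr s0 7 + Nw).
Proof.
  intros Ei Ev ENL Hi Hv HQ Hw HS Hf Hcol HM HO HDi.
  pose proof (pow_facts n NL N W HRN HnN' HLN HNW) as HP.
  assert (Hmh : hsum i <= hsum (S NL)).
  { assert (Hgen : forall m, i <= m -> hsum i <= hsum m); [|apply Hgen; lia].
    induction 1; [auto|]. unfold hsum in *. cbn [sumn]. lia. }
  unfold recolor. apply wp_seq.
  eapply wp_conseq; [apply (wp_clear n NL N W HRN HnN' HLN HNW s0 i v); auto; try lia|].
  { intros j a c Hj Ha Hm. assert (Hc : c < n) by (apply (mem_pos n NL s0 j a c); auto).
    apply HM in Hm as [H1 H2]; auto. split.
    - apply HM; auto.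
    - intros ->. exact (Eirr _ H1). }
  intros t1 s1 (O & Ht1 & F1 & A1 & Hw1 & M1 & C1 & C2 & C3 & HOv & P1).
  apply wp_seq, wp_asg.
  { ok; rewrite ?F1 by lia; lia. }
  evg. rewrite F1, Ei, A1, HQ by lia.
  assert (Hq := q_pos (i - 1) ltac:(lia)). assert (Hql := q_le (i - 1) ltac:(lia)).
  set (Qi := q (i - 1)) in *.
  assert (Hcv := Hcol v Hv).
  assert (Hdl : col s0 v / Qi * Qi <= col s0 v).
  { rewrite Nat.mul_comm. apply Nat.Div0.mul_div_le. }
  apply wp_seq, wp_sto.
  { ok. rewrite F1 by lia. lia. }
  { ok; rewrite ?F1, ?A1, ?Ev by lia; lia. }
  evg. rewrite F1, Ev, A1 by lia.
  match goal with |- wp _ _ _ ?s9 _ => set (s2 := s9) end.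
  assert (Hc2v : col s2 v = col s0 v / Qi * Qi).
  { subst s2. evg. rewrite Nat.eqb_refl. auto. }
  assert (Hc2 : forall a, a <> v -> col s2 a = col s0 a).
  { intros a Ha. subst s2. evg. destruct (Nat.eqb_spec a v); [lia|]. apply A1. lia. }
  assert (Hpre : forall x a, x < i -> col s2 a / q x = col s0 a / q x).
  { intros x a Hx. destruct (Nat.eq_dec a v) as [-> |]; [|rewrite Hc2; auto].
    rewrite Hc2v.
    replace (col s0 v) with (col s0 v / Qi * Qi + col s0 v mod Qi) at 2.
    - symmetry. unfold Qi. apply prefix_extend; [lia|]. apply Nat.mod_upper_bound. lia.
    - rewrite Nat.mul_comm. symmetry. apply Nat.Div0.div_mod. }
  assert (Hv2 : forall x, x < 30 -> x <> 10 -> x <> 11 -> x <> 17 -> vr s2 x = vr s0 x).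
  { intros x ? ? ? ?. subst s2. evg. destruct (Nat.eqb_spec x 17); [lia|]. auto. }
  assert (Ha2 : forall t i j k, t = 0 \/ 5 <= t -> ar s2 t i j k = ar s0 t i j k).
  { intros t i' j k Ht. subst s2. evg. destruct (Nat.eqb_spec t 4); [lia|]. apply A1. lia. }
  apply wp_seq. eapply wp_conseq; [apply (wp_assign s2 i v); auto; try (rewrite Hv2 by lia; auto)|].
  { intros x Hx. rewrite Ha2 by lia. auto. }
  { apply (StkOK_ext n s0); auto; [rewrite Hv2 by lia; auto|]. intros. apply Ha2. lia. }
  { rewrite Ha2 by lia. auto. }
  { intros a Ha. destruct (Nat.eq_dec a v) as [-> |]; [lia|]. rewrite Hc2; auto. }
  { exists (col s0 v / Qi). exact Hc2v. }
  { intros x a c Hx Ha Hc. change (mem s1 x a c <->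
      E a c /\ col s2 a / q x = col s2 c / q x /\ (x < i \/ a <> v /\ c <> v)).
    rewrite M1, (HM x a c) by auto. split.
    - intros [[H1 H2] [H3 | H3]]; (split; [auto|]; split; [|auto]).
      + rewrite !Hpre by auto. auto.
      + rewrite !Hc2 by tauto. auto.
    - intros (H1 & H2 & [H3 | H3]); (split; [split; [auto|]|auto]).
      + rewrite !Hpre in H2 by auto. auto.
      + rewrite !Hc2 in H2 by tauto. auto. }
  { change (cnt s1 (i - 1) v <= D (i - 1)). rewrite C2 by lia. auto. }
  intros t3 s3 (Nw & Ht3 & HN & F3 & A3 & Co3 & Cv3 & Hw3 & HS3 & HM3 & B1 & B2 & G1 & G2 & B3
    & P3 & T3).
  assert (Ev3 : vr s3 12 = v) by (rewrite F3, Hv2 by lia; auto).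
  apply wp_seq, wp_asg; [ok|]. evg. rewrite Ev3.
  set (s4 := setv s3 17 (v + 8)).
  (* Both branches of the final test change only scratch variables and the output array, so the
     remaining claims are proved once for all such states. *)
  assert (Hres : forall s5, (forall x, x < 7 -> vr s5 x = vr s3 x) -> vr s5 7 = vr s3 7 ->
    (forall t i j k, t <> 0 -> ar s5 t i j k = ar s3 t i j k) -> OutOK s5 ->
    cnt s0 i v <= O /\ Nw + gsum i <= gsum (S NL) /\
    (forall x, x < 7 -> vr s5 x = vr s0 x) /\
    (forall t i j k, 8 <= t -> ar s5 t i j k = ar s0 t i j k) /\
    (forall a, a < n -> col s5 a < q 0) /\
    WF n NL s5 /\ StkOK n s5 /\ MemOK s5 /\ OutOK s5 /\
    (forall x, i <= x <= NL -> cnt s5 x v <= D x) /\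
    (forall x a, x < i -> cnt s5 x a <= cnt s0 x a) /\
    (forall x, flg s0 x <> 0 -> flg s5 x <> 0) /\
    (forall x a, a <> v -> cnt s5 x a <= cnt s0 x a \/ flg s5 a <> 0) /\
    Phi n NL s5 + 2 * O = Phi n NL s0 + 2 * Nw /\
    vr s5 7 <= vr s0 7 + Nw).
  { intros s5 F5 F57 A5 HO5. split; [auto|]. split; [auto|].
    split. { intros x Hx. rewrite F5, F3, Hv2 by lia. auto. }
    split. { intros. rewrite A5, A3, Ha2 by lia. auto. }
    split. { intros a Ha. rewrite A5 by lia. destruct (Nat.eq_dec a v) as [-> | Hn]; auto.
      rewrite Co3, Hc2; auto. }
    split. { intros j a k. rewrite !A5 by lia. apply Hw3. }
    split. { apply (StkOK_ext n s3); auto. intros. apply A5. lia. }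
    split. { intros x a c Hx Ha Hc. rewrite !A5 by lia.
      assert (Em : mem s5 x a c <-> mem s3 x a c).
      { unfold mem. split; intros (k & Hk & H); exists k; rewrite !A5 in * by lia; auto. }
      rewrite Em, (HM3 x a c) by auto. split; [tauto|].
      intros [H1 H2]. split; [auto|]. split; [auto|]. left. lia. }
    split; [auto|].
    split. { intros x Hx. rewrite A5 by lia. etransitivity; [apply B1; auto|]. apply HD. lia. }
    split. { intros x a Hx. rewrite A5 by lia. rewrite B2 by auto. apply C1. }
    split. { intros x Hx. rewrite A5 by lia. apply G1. rewrite Ha2 by lia. auto. }
    split. { intros x a Ha. rewrite !A5 by lia. destruct (B3 x a Ha) as [H | H]; auto.
      left. etransitivity; [exact H|]. apply C1. }
    assert (Phi n NL s5 = Phi n NL s3).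
    { apply sumn_ext. intros. apply sumn_ext. intros. apply A5. lia. }
    assert (Phi n NL s2 = Phi n NL s1) by reflexivity.
    rewrite Hv2 in T3 by lia. split; lia. }
  assert (HO3 : forall x, x < n -> RR <= 8 + x -> x <> v -> outc s3 (8 + x) = col s3 x).
  { intros x Hx Hx8 Hn. rewrite A3, Ha2, Co3, Hc2 by lia. apply HO; auto. }
  apply wp_if; [ok|ok| |]; evg; intros Hc.
  - change (v + 8 < RR) in Hc. apply wp_skip. exists O, Nw. split; [lia|].
    apply Hres; auto.
    + intros x Hx. subst s4. evg. destruct (Nat.eqb_spec x 17); [lia | auto].
    + intros x Hx Hx8. subst s4. evg. apply HO3; auto. lia.
  - change (RR <= v + 8) in Hc. apply wp_sto.
    (* Tag 0 is not covered by [idxok_tag]; the test has just ensured that the address is at least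
       [RR]. *)
    { unfold eO, eX, eV. cbn [okx]. evg. change (vr s4 17) with (v + 8).
      unfold idxok, addr. repeat split; try lia. }
    { ok. subst s4. evg. rewrite Ev3. lia. }
    subst s4. evg. rewrite Ev3. exists O, Nw. split; [lia|].
    apply (Hres (seta (setv s3 17 (v + 8)) 0 0 0 (v + 8) (col s3 v))); auto.
    + intros x Hx. evg. destruct (Nat.eqb_spec x 17); [lia | auto].
    + intros t i' j k Ht. evg. destruct (Nat.eqb_spec t 0); [lia | auto].
    + intros x Hx Hx8. change (outc (seta s3 0 0 0 (v + 8) (col s3 v)) (8 + x) = col s3 x).
      cbn -[Nat.add Nat.eqb]. rewrite !(Nat.eqb_refl 0).
      destruct (Nat.eqb_spec (8 + x) (v + 8)) as [Hxv | Hxv].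
      * replace x with v by lia. auto.
      * apply HO3; auto. lia.
Qed.

End Recolor.

(** * Parameters and amortisation *)

(* With l = log Delta, g = log log Delta and kap = l g, a level divides the threshold by
   lam = 32 kap up to a relative slack 1 / kap; the slack is at least 1 as long as the
   threshold is at least [TT].  There are at most l + 2 levels, so the slacks accumulate to a
   factor 1 + O(1/g). *)
Definition ell (Delta : nat) : nat := Nat.log2 Delta.
Definition gg (Delta : nat) : nat := Nat.log2 (ell Delta).
Definition kap (Delta : nat) : nat := ell Delta * gg Delta.
Definition lam (Delta : nat) : nat := 32 * kap Delta.
Definition TT (Delta : nat) : nat := lam Delta * kap Delta.

Definition dstep (Delta x : nat) : nat := x / lam Delta + x / TT Delta.
Fixpoint dit (Delta j : nat) : nat :=
  match j with 0 => Delta | S j => dstep Delta (dit Delta j) end.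
Fixpoint depth (Delta fuel x : nat) : nat :=
  match fuel with
  | 0 => 0
  | S f => if x <? TT Delta then 0 else S (depth Delta f (dstep Delta x))
  end.
Definition lev (Delta : nat) : nat := depth Delta (ell Delta + 2) Delta.
Definition thr (Delta j : nat) : nat := if j <=? lev Delta then dit Delta j else 0.
Definition rad (Delta j : nat) : nat :=
  if j <=? lev Delta then lam Delta else dit Delta (lev Delta) + 1.
(** The number of colours with a given prefix of length [j]; in particular [pal Delta 0] is the size
    of the palette. *)
Definition pal (Delta j : nat) : nat :=
  if j <=? lev Delta then (dit Delta (lev Delta) + 1) * lam Delta ^ (lev Delta - j) else 1.

(** The base case is 18^4 <= 2^17; afterwards a step multiplies the left side by at most 36/25,
    which is below 2. *)
Lemma log2_lt_pow4 x : 17 <= x -> (x + 1) * (x + 1) * ((x + 1) * (x + 1)) <= 2 ^ x.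
Proof.
  induction 1 as [|x Hx IH]; [apply Nat.leb_le; vm_compute; reflexivity|].
  rewrite Nat.pow_succ_r'.
  assert (A1 : 5 * ((S x + 1) * (S x + 1)) <= 6 * ((x + 1) * (x + 1))) by nia.
  assert (A2 : 25 * ((S x + 1) * (S x + 1) * ((S x + 1) * (S x + 1)))
    <= 36 * ((x + 1) * (x + 1) * ((x + 1) * (x + 1)))) by nia.
  lia.
Qed.

Lemma cube_le_pow x : 32 <= x -> 32 * (x * x * x) <= 2 ^ x.
Proof.
  induction 1 as [|x Hx IH].
  - change (2 ^ 5 * (2 ^ 5 * 2 ^ 5 * 2 ^ 5) <= 2 ^ 32).
    rewrite <- !Nat.pow_add_r. apply Nat.pow_le_mono_r; lia.
  - rewrite Nat.pow_succ_r'.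
    assert (A : S x * S x * S x <= 2 * (x * x * x)) by nia. lia.
Qed.

Section Params.
Variable Delta : nat.
Hypothesis HD0 : 32 <= ell Delta.
Notation l := (ell Delta).
Notation g := (gg Delta).
Notation k := (kap Delta).
Notation T := (TT Delta).
Notation d := (dit Delta).
Notation L := (lev Delta).

Lemma Delta_pos : 0 < Delta.
Proof.
  destruct (Nat.eq_dec Delta 0) as [E | E]; [|lia].
  pose proof HD0 as H. rewrite E in H. change (32 <= 0) in H. lia.
Qed.

Lemma g_ge : 5 <= g.
Proof.
  unfold gg. change 5 with (Nat.log2 32). apply Nat.log2_le_mono. exact HD0.
Qed.

Lemma sq_le_pow x : 4 <= x -> x * x <= 2 ^ x.
Proof.
  induction 1 as [|x Hx IH]; [simpl; lia|]. rewrite Nat.pow_succ_r'. nia.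
Qed.

Lemma g_sq : g * g <= l.
Proof.
  etransitivity; [apply sq_le_pow; pose proof g_ge; lia|].
  unfold gg. apply Nat.log2_spec. lia.
Qed.

Lemma k_ge : 5 * l <= k.
Proof. pose proof g_ge. unfold kap. nia. Qed.

Lemma T_eq : T = 32 * (k * k).
Proof. unfold TT, lam. lia. Qed.

(** From g^2 <= l follows 32 k^2 <= 32 l^3 <= 2^l <= Delta. Hence the threshold Delta is not yet
    below [TT], and there is at least one level. *)
Lemma T_le : T <= Delta.
Proof.
  rewrite T_eq. pose proof g_sq as Hg.
  assert (Hk : k * k <= l * l * l).
  { unfold kap. replace (l * g * (l * g)) with (l * l * (g * g)) by lia.
    apply Nat.mul_le_mono_l. exact Hg. }
  pose proof (cube_le_pow l HD0) as Hc.
  assert (Hl : 2 ^ l <= Delta) by (apply Nat.log2_spec; apply Delta_pos).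
  lia.
Qed.

Lemma lam_ge : 1000 <= lam Delta.
Proof. unfold lam. pose proof k_ge. lia. Qed.

Lemma lam_T : lam Delta <= T.
Proof. unfold TT. pose proof k_ge. nia. Qed.

(** Since [lam <= TT], the slack is at most [x / lam] as well. *)
Lemma dstep_lam x : dstep Delta x * lam Delta <= 2 * x.
Proof.
  unfold dstep. pose proof lam_ge. pose proof k_ge.
  assert (H1 := Nat.Div0.mul_div_le x (lam Delta)).
  assert (H2 := Nat.Div0.mul_div_le x T).
  assert (H3 : x / T * lam Delta <= T * (x / T)) by (unfold TT; nia). nia.
Qed.

(** With denominators cleared: a step divides by [lam] up to the factor 1 + 1/k. *)
Lemma dstep_k x : dstep Delta x * T <= x * (k + 1).
Proof.
  unfold dstep.
  assert (H1 := Nat.Div0.mul_div_le x (lam Delta)).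
  assert (H2 := Nat.Div0.mul_div_le x T).
  assert (H3 : x / lam Delta * T = lam Delta * (x / lam Delta) * k) by (unfold TT; lia).
  assert (H4 : lam Delta * (x / lam Delta) * k <= x * k) by (apply Nat.mul_le_mono_r; lia).
  lia.
Qed.

Lemma dstep_half x : 2 * dstep Delta x <= x.
Proof. assert (H := dstep_lam x). pose proof lam_ge. nia. Qed.

Lemma dit_le j : d j <= Delta.
Proof. induction j; simpl; [lia|]. assert (H := dstep_half (d j)). lia. Qed.

(** The invariant [x < 2 ^ f] survives a step because [dstep] halves, so the value falls below [TT]
    before the fuel can run out. *)
Lemma depth_spec f : forall x, x < 2 ^ f ->
  (forall j, j < depth Delta f x -> T <= Nat.iter j (dstep Delta) x) /\
  Nat.iter (depth Delta f x) (dstep Delta) x < T /\ depth Delta f x <= f.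
Proof.
  pose proof lam_ge. pose proof lam_T.
  induction f as [|f IH]; intros x Hx; cbn [depth].
  - simpl in *. repeat split; lia.
  - destruct (Nat.ltb_spec x T) as [Hlt | Hge]; [simpl; repeat split; lia|].
    destruct (IH (dstep Delta x)) as (H1 & H2 & H3).
    { assert (H' := dstep_half x). rewrite Nat.pow_succ_r' in Hx. lia. }
    rewrite Nat.iter_succ_r. split; [|split; [auto | lia]].
    intros [|j] Hj; [simpl; auto|]. rewrite Nat.iter_succ_r. apply H1. lia.
Qed.

Lemma dit_iter j : d j = Nat.iter j (dstep Delta) Delta.
Proof. induction j; simpl; congruence. Qed.

Lemma lev_spec : (forall j, j < L -> T <= d j) /\ d L < T /\ L <= l + 2.
Proof.
  destruct (depth_spec (l + 2) Delta) as (H1 & H2 & H3).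
  - assert (H := Nat.log2_spec Delta Delta_pos). fold l in H.
    rewrite Nat.pow_add_r. rewrite Nat.pow_succ_r' in H. simpl. lia.
  - split; [|split].
    + intros j Hj. rewrite dit_iter. apply H1. exact Hj.
    + rewrite dit_iter. exact H2.
    + exact H3.
Qed.

Lemma lev_pos : 1 <= L.
Proof.
  destruct lev_spec as (_ & H & _). pose proof T_le.
  destruct L eqn:E; [simpl in H; lia | lia].
Qed.

(** The last threshold arises from one that is still at least [TT = lam * k]. *)
Lemma k_le_dL : k <= d L.
Proof.
  pose proof lev_pos. destruct lev_spec as (HL & _).
  replace L with (S (L - 1)) by lia. cbn [dit]. unfold dstep.
  specialize (HL (L - 1) ltac:(lia)).
  assert (Hk : k <= d (L - 1) / lam Delta).
  { apply Nat.div_le_lower_bound; [pose proof lam_ge; lia|]. exact HL. }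
  lia.
Qed.

(** The integer form of (1 + 1/k)^j <= 1 + 2j/k. The induction step needs 2j <= k, which holds as L
    is at most l + 2 and k at least 5l. *)
Lemma dit_pal j : j <= L -> d j * lam Delta ^ j * k <= Delta * (k + 2 * j).
Proof.
  induction j as [|j IH]; intros Hj; [simpl; lia|].
  specialize (IH ltac:(lia)). destruct lev_spec as (_ & _ & HL). pose proof k_ge.
  set (A := d j * lam Delta ^ j) in *.
  assert (HA : d (S j) * lam Delta ^ S j * k <= A * (k + 1)).
  { cbn [dit]. rewrite Nat.pow_succ_r'. assert (H' := dstep_k (d j)). unfold TT, A in *. nia. }
  assert (HB : (A * k) * (k + 1) <= Delta * (k + 2 * j) * (k + 1))
    by (apply Nat.mul_le_mono_r; exact IH).
  assert (HC : (k + 2 * j) * (k + 1) <= k * (k + 2 * S j)) by nia.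
  assert (HE : Delta * ((k + 2 * j) * (k + 1)) <= Delta * (k * (k + 2 * S j)))
    by (apply Nat.mul_le_mono_l; exact HC).
  assert (HF : d (S j) * lam Delta ^ S j * k * k <= A * (k + 1) * k)
    by (apply Nat.mul_le_mono_r; exact HA).
  apply (Nat.mul_le_mono_pos_r _ _ k); lia.
Qed.

(** The last base is [d L + 1] instead of [d L]; as [d L >= k], this is one further factor 1 +
    1/k. *)
Lemma pal_le : pal Delta 0 * k <= Delta * (k + 2 * (L + 1)).
Proof.
  unfold pal. rewrite Nat.sub_0_r. cbn [Nat.leb].
  assert (IH := dit_pal L (le_n _)). pose proof k_le_dL as Hd. pose proof k_ge.
  destruct lev_spec as (_ & _ & HL).
  set (A := lam Delta ^ L) in *.
  assert (HA : (d L + 1) * A * k <= d L * A * (k + 1)) by nia.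
  assert (HB : (d L * A * k) * (k + 1) <= Delta * (k + 2 * L) * (k + 1))
    by (apply Nat.mul_le_mono_r; exact IH).
  assert (HC : (k + 2 * L) * (k + 1) <= k * (k + 2 * (L + 1))) by nia.
  assert (HE : Delta * ((k + 2 * L) * (k + 1)) <= Delta * (k * (k + 2 * (L + 1))))
    by (apply Nat.mul_le_mono_l; exact HC).
  assert (HF : (d L + 1) * A * k * k <= d L * A * (k + 1) * k)
    by (apply Nat.mul_le_mono_r; exact HA).
  apply (Nat.mul_le_mono_pos_r _ _ k); lia.
Qed.

Lemma pal_le2 : pal Delta 0 <= 2 * Delta.
Proof.
  pose proof pal_le. pose proof k_ge. destruct lev_spec as (_ & _ & HL).
  apply (Nat.mul_le_mono_pos_r _ _ k); [lia|].
  assert (Delta * (k + 2 * (L + 1)) <= Delta * (2 * k)) by (apply Nat.mul_le_mono_l; lia).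
  lia.
Qed.

Lemma pal_step j : j < L + 1 -> pal Delta j = pal Delta (S j) * rad Delta (S j).
Proof.
  intros Hj. unfold pal, rad.
  destruct (Nat.leb_spec j L); [|lia]. destruct (Nat.leb_spec (S j) L).
  - replace (L - j) with (S (L - S j)) by lia. rewrite Nat.pow_succ_r'. lia.
  - replace (L - j) with 0 by lia. simpl. lia.
Qed.

Lemma pal_last : pal Delta (L + 1) = 1.
Proof. unfold pal. destruct (Nat.leb_spec (L + 1) L); lia. Qed.

Lemma rad_bound j : 1 <= rad Delta j <= T.
Proof.
  unfold rad. pose proof lam_ge. pose proof lam_T. destruct lev_spec as (_ & H1 & _).
  destruct (j <=? L); lia.
Qed.

Lemma thr_step j : 1 <= j <= L + 1 -> thr Delta (j - 1) / rad Delta j <= thr Delta j.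
Proof.
  intros Hj. unfold thr, rad. destruct (Nat.leb_spec (j - 1) L); [|lia].
  destruct (Nat.leb_spec j L).
  - replace (d j) with (dstep Delta (d (j - 1))); [unfold dstep; lia|].
    replace j with (S (j - 1)) at 2 by lia. reflexivity.
  - replace (j - 1) with L by lia. rewrite Nat.div_small; lia.
Qed.

(** A geometric sum with ratio at most 1/2; repeating the last term makes the bound inductive. *)
Lemma thr_tail j m : j + m <= L ->
  sumn (fun x => d (j + x)) (S m) + d (j + m) <= 2 * d j.
Proof.
  induction m as [|m IH]; intros Hm.
  - simpl. rewrite !Nat.add_0_r. lia.
  - specialize (IH ltac:(lia)). cbn [sumn] in *.
    rewrite !(Nat.add_succ_r j m) in *. cbn [dit].
    assert (H := dstep_half (d (j + m))). lia.
Qed.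

Lemma sumn_shift f a m : sumn f (a + m) = sumn f a + sumn (fun x => f (a + x)) m.
Proof. induction m; [rewrite Nat.add_0_r; simpl; lia|]. rewrite Nat.add_succ_r. simpl. lia. Qed.

Notation G := (gsum (rad Delta) (thr Delta)).
Notation H := (hsum (rad Delta) (thr Delta)).

(* [s] is the slack with which level [i] is left after a recolouring. *)
Lemma level_bounds i : 1 <= i <= L -> exists s, 1 <= s /\
  2 * (G (L + 2) - G i) + s <= 2 * d i /\
  H (L + 2) - H i <= 12 * T * s /\ d i <= 3 * k * s.
Proof.
  intros Hi. destruct lev_spec as (HL1 & HL2 & HL3).
  pose proof k_ge as Hk. pose proof lam_ge as Hlam.
  set (p := d (i - 1)). assert (Hp : T <= p) by (apply HL1; lia).
  exists (p / T).
  assert (Ht : 1 <= T) by (pose proof lam_T; lia).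
  assert (Hs : 1 <= p / T) by (apply Nat.div_le_lower_bound; lia).
  assert (Edi : d i = p / lam Delta + p / T).
  { replace i with (S (i - 1)) at 1 by lia. reflexivity. }
  set (s := p / T) in *.
  assert (Hps : p < T * (s + 1)).
  { rewrite Nat.add_1_r. apply Nat.mul_succ_div_gt. lia. }
  assert (Hpl : p / lam Delta <= 2 * k * s).
  { assert (Hlt : p / lam Delta < k * (s + 1)).
    { apply Nat.Div0.div_lt_upper_bound. unfold TT in Hps. lia. }
    nia. }
  assert (Hdi : d i <= 3 * k * s) by nia.
  split; [exact Hs|].
  assert (Hdec : forall x, i <= x < L -> sumn (fun y => d (S x + y)) (L - x) <= 2 * d (S x)).
  { intros x Hx. assert (Htl := thr_tail (S x) (L - S x) ltac:(lia)).
    replace (S (L - S x)) with (L - x) in Htl by lia. lia. }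
  (* The constant 32 in [lam] is spent here: [d (S i)] is at most 2 d_i / lam, hence at most 6 s /
     32, and the whole tail is at most twice that. *)
  assert (Htail : 2 * sumn (fun y => d (S i + y)) (L - i) <= s).
  { destruct (Nat.eq_dec i L) as [-> | Hn]; [rewrite Nat.sub_diag; simpl; lia|].
    specialize (Hdec i ltac:(lia)).
    assert (Hst : d (S i) * lam Delta <= 2 * d i) by apply dstep_lam.
    assert (Hst2 : d (S i) * (32 * k) <= 6 * s * k) by (unfold lam in Hst; lia).
    assert (Hst3 : d (S i) * 32 <= 6 * s).
    { apply (Nat.mul_le_mono_pos_r _ _ k); lia. }
    lia. }
  assert (Ebr : forall x, x <= L -> thr Delta x = d x).
  { intros x Hx. unfold thr. destruct (Nat.leb_spec x L); lia. }
  assert (Erl : forall x, x <= L -> rad Delta x = lam Delta).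
  { intros x Hx. unfold rad. destruct (Nat.leb_spec x L); lia. }
  assert (Erm : rad Delta (L + 1) = d L + 1).
  { unfold rad. destruct (Nat.leb_spec (L + 1) L); lia. }
  split.
  { unfold gsum. replace (L + 2) with (i + (S (L - i) + 1)) by lia.
    rewrite sumn_shift.
    rewrite (sumn_shift _ (S (L - i)) 1). cbn [sumn].
    replace (i + (S (L - i) + 0)) with (L + 1) by lia.
    rewrite Erm. replace (L + 1 - 1) with L by lia. rewrite (Ebr L) by lia.
    rewrite (Nat.div_small (d L)) by lia.
    change (sumn (fun x => thr Delta (i + x - 1) / rad Delta (i + x)) (L - i)
      + thr Delta (i + (L - i) - 1) / rad Delta (i + (L - i))) with
      (sumn (fun x => thr Delta (i + x - 1) / rad Delta (i + x)) (S (L - i))).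
    change (S (L - i)) with (1 + (L - i)).
    rewrite (sumn_shift _ 1). cbn [sumn]. rewrite !Nat.add_0_r.
    rewrite Ebr, Erl by lia. fold p.
    assert (Hm : sumn (fun x => thr Delta (i + (1 + x) - 1) / rad Delta (i + (1 + x))) (L - i)
      <= sumn (fun y => d (S i + y)) (L - i)).
    { apply sumn_mono. intros x Hx.
      assert (Hst := thr_step (i + (1 + x)) ltac:(lia)).
      rewrite (Ebr (i + (1 + x))) in Hst by lia.
      replace (S i + x) with (i + (1 + x)) by lia. exact Hst. }
    lia. }
  split; [|exact Hdi].
  unfold hsum. replace (L + 2) with (i + (S (L - i) + 1)) by lia.
  rewrite sumn_shift, (sumn_shift _ (S (L - i)) 1).
  rewrite (sumn_ext (fun x => rad Delta (i + x) + thr Delta (i + x - 1) + 1)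
    (fun x => (lam Delta + 1) + d (i - 1 + x))).
  2:{ intros x Hx. rewrite Erl, Ebr by lia. replace (i + x - 1) with (i - 1 + x) by lia. lia. }
  assert (Hsplit : forall c f m, sumn (fun x => c + f x) m = m * c + sumn f m).
  { intros c f m. induction m; cbn [sumn]; lia. }
  rewrite Hsplit. cbn [sumn]. replace (i + (S (L - i) + 0)) with (L + 1) by lia.
  rewrite Erm. replace (L + 1 - 1) with L by lia. rewrite (Ebr L) by lia.
  assert (Htl := thr_tail (i - 1) (L - i) ltac:(lia)).
  cbn [sumn] in Htl. fold p in Htl.
  assert (HdL : d L <= d i).
  { assert (Hmon : forall x, d (i + x) <= d i).
    { induction x; [rewrite Nat.add_0_r; lia|]. rewrite Nat.add_succ_r. cbn [dit].
      assert (Hh := dstep_half (d (i + x))). lia. }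
    replace L with (i + (L - i)) by lia. apply Hmon. }
  assert (Hdp : d i <= p).
  { replace i with (S (i - 1)) by lia. cbn [dit]. assert (Hh := dstep_half (d (i - 1))).
    fold p in Hh |- *. lia. }
  assert (HpT : p <= 2 * T * s) by nia.
  assert (HLl : S (L - i) * (lam Delta + 1) <= 2 * T).
  { assert (S (L - i) <= k) by lia. unfold TT. nia. }
  assert (HTs : T <= T * s) by nia.
  lia.
Qed.

(** Covers what a popped vertex costs apart from the work charged to edges: the check of its levels,
    the loop overhead per level and constants. *)
Definition pushcost : nat := 40 * (L + 4).
(** A recolouring with slack [s] lowers [Phi] by more than [s], and its dominant cost is
    [60 * 12 * T * s]; 1600 leaves room for the smaller terms. *)
Definition ratio : nat := 1600 * T.

(** At the last level no edge is created and the scan costs O(T), which a single removed edge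
    covers; at the other levels the slack pays. *)
Lemma recolor_pays i O Nw : 1 <= i <= L + 1 -> thr Delta i + 1 <= O ->
  Nw + G i <= G (L + 2) ->
  18 * O + 60 * (H (L + 2) - H i) + pushcost * Nw + ratio * (2 * Nw) <= ratio * (2 * O).
Proof.
  intros Hi HO HN. destruct lev_spec as (HL1 & HL2 & HL3).
  pose proof k_ge as Hk. pose proof lam_ge as Hlam. pose proof lam_T as HlT.
  destruct (Nat.eq_dec i (L + 1)) as [-> | Hne].
  - assert (EG : G (L + 2) = G (L + 1)).
    { unfold gsum. replace (L + 2) with (S (L + 1)) by lia. cbn [sumn].
      assert (Hst := thr_step (L + 1) ltac:(lia)).
      assert (E0 : thr Delta (L + 1) = 0).
      { unfold thr. destruct (Nat.leb_spec (L + 1) L); lia. }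
      lia. }
    assert (Nw = 0) as -> by lia.
    assert (EH : H (L + 2) - H (L + 1) <= 2 * T).
    { unfold hsum. replace (L + 2) with (S (L + 1)) by lia. cbn [sumn].
      replace (L + 1 - 1) with L by lia. unfold rad, thr.
      destruct (Nat.leb_spec (L + 1) L); [lia|]. destruct (Nat.leb_spec L L); lia. }
    unfold ratio. assert (T <= T * O) by nia. nia.
  - destruct (level_bounds i ltac:(lia)) as (s & Hs & H1 & H2 & H3).
    assert (Et : thr Delta i = d i).
    { unfold thr. destruct (Nat.leb_spec i L); lia. }
    rewrite Et in HO.
    assert (Hsl : 2 * Nw + s <= 2 * d i) by lia.
    assert (Hdk : d i * k * 32 <= 3 * T * s).
    { rewrite T_eq. nia. }
    assert (Hpc : pushcost * Nw <= 40 * (d i * k)).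
    { unfold pushcost. assert (L + 4 <= k) by lia. nia. }
    assert (HdT : 18 * (d i + 1) <= T * s).
    { assert (18 * (d i + 1) <= d i * k * 6) by nia. lia. }
    assert (Hr1 : ratio * (2 * Nw) + ratio * s <= ratio * (2 * d i)) by (rewrite <- Nat.mul_add_distr_l; apply Nat.mul_le_mono_l; lia).
    assert (Hr2 : ratio * (2 * (d i + 1)) + 18 * (O - (d i + 1)) <= ratio * (2 * O)).
    { unfold ratio. nia. }
    unfold ratio in *. lia.
Qed.

End Params.

(** * The update procedure *)

Definition logp (e : expr) (dst : nat) : com :=
  Asg 17 e;; Asg dst eO;;
  While (EC 1) eX (Asg 17 (EOp ODiv eX (EC 2));; Asg dst (plus1 (EV dst))).

(** The tables are recomputed at every update. This costs O(log Delta) and spares a separate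
    treatment of the first update. *)
Definition params : com :=
  logp (EV 1) 8;; logp (EV 8) 9;;
  Asg 16 (EOp OMul (EV 8) (EV 9));;
  Asg 15 (EOp OMul (EC 32) (EV 16));;
  Asg 16 (EOp OMul (EV 15) (EV 16));;
  Asg 10 eO;; Asg 17 (EV 1);; Sto 8 eO eO eJ eX;;
  While (EV 16) (plus1 eX)
    (Asg 17 (EOp OAdd (EOp ODiv eX (EV 15)) (EOp ODiv eX (EV 16)));;
     Asg 10 (plus1 eJ);; Sto 8 eO eO eJ eX);;
  Asg 6 (plus1 eJ);; Sto 8 eO eO eNL eO;; Sto 9 eO eO eNL (EC 1);;
  Asg 18 (plus1 eX);; Sto 9 eO eO eJ (EV 18);;
  While eO eJ
    (Asg 18 (EOp OMul (EV 18) (EV 15));; Asg 10 (minus1 eJ);;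
     Sto 9 eO eO eJ (EV 18)).

(** A deletion raises no degree, so only an insertion pushes its endpoints. *)
Definition edit : com :=
  Asg 7 eO;; Asg 11 (EV 3);; Asg 12 (EV 4);; Asg 10 eO;;
  While eJ (plus1 eNL)
    (If (EOp OXor (prefix eU) (prefix eV)) (EC 1)
       (If eO (EV 2) (both halfadd) (both halfrem)) Skip;;
     Asg 10 (plus1 eJ));;
  If eO (EV 2) (push;; Asg 11 eV;; push) Skip.

(** [eF] acts as a break: it is lowered to [eI] at the first exceeded level, so [eI] ends there, or
    at [NL + 1] if there is none. *)
Definition check : com :=
  Asg 13 (EC 1);; Asg 14 (plus1 eNL);;
  While eI eF
    (If (EL 8 eO eO eI) (EL 3 eO eI eV) (Asg 14 eI) (Asg 13 (plus1 eI))).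

Definition work : com :=
  While eO eST
    (Asg 7 (minus1 eST);; Asg 12 (EL 6 eO eO eST);; Sto 5 eO eO eV eO;;
     check;; If eI (plus1 eNL) recolor Skip).

Definition main : com := params;; edit;; work.

Lemma log2_half x : 2 <= x -> Nat.log2 (x / 2) + 1 = Nat.log2 x.
Proof.
  intros Hx. assert (E := Nat.div_mod_eq x 2). assert (Hm := Nat.mod_upper_bound x 2).
  assert (H1 : 1 <= x / 2) by (apply Nat.div_le_lower_bound; lia).
  rewrite E at 2. destruct (x mod 2) as [|[|r]]; [| |lia].
  - rewrite Nat.add_0_r, Nat.log2_double by lia. lia.
  - rewrite Nat.add_1_r, <- Nat.add_1_r, Nat.log2_succ_double by lia. lia.
Qed.

Section Main.
Variables (n Delta W : nat).
Hypothesis HD0 : 32 <= ell Delta.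
Let N := n + Delta + 2.
Hypothesis HNW : N * N * N * N * N * N <= W.
Let NL := lev Delta + 1.
Let q := pal Delta.
Let b := rad Delta.
Let D := thr Delta.

Let big : 1000 <= Delta.
Proof. pose proof (T_le Delta HD0). pose proof (lam_T Delta HD0). pose proof (lam_ge Delta HD0). lia. Qed.
Let HRN : RR + 8 < N. Proof. unfold RR, N. pose proof big. lia. Qed.
Let HnN : n + 8 < N. Proof. unfold N. pose proof big. lia. Qed.
Let HnN' : n < N. Proof. lia. Qed.
Let Hell : 40 * (lev Delta + 4) <= Delta.
Proof.
  destruct (lev_spec Delta HD0) as (_ & _ & HL). pose proof (k_ge Delta HD0).
  pose proof (T_le Delta HD0). pose proof (lam_T Delta HD0). unfold lam in *. lia.
Qed.
Let HLN : NL < N. Proof. unfold N, NL. pose proof Hell. lia. Qed.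

Ltac ok1 := repeat match goal with
  | |- _ /\ _ => split
  | |- True => exact I
  | |- idxok _ _ _ _ _ _ => apply (idxok_tag n NL N W HRN HnN' HLN HNW)
  end.
Ltac ok := unfold prefix, eO, eJ, eU, eV, eI, eNL, eST, eK, eB, eM, eX, eF, aA, aB, aC, aP, aX, plus1, minus1;
  cbn [okx bok]; evg; ok1; try lia.

Lemma wp_logp e dst s0 x : eval e s0 = x -> okx N W e s0 -> x <= Delta -> dst = 8 \/ dst = 9 ->
  wp N W (logp e dst) s0 (fun t s => t <= 3 * Nat.log2 x + 3 /\ vr s dst = Nat.log2 x /\
    (forall y, y <> 17 -> y <> dst -> vr s y = vr s0 y) /\
    (forall t i j k, ar s t i j k = ar s0 t i j k)).
Proof.
  intros Ex Hok Hx Hd. pose proof (pow_facts n NL N W HRN HnN' HLN HNW) as HP.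
  assert (HxN : x < N) by (unfold N; lia).
  assert (Hlog : forall y, Nat.log2 y <= y).
  { intros y. apply Nat.log2_le_lin. lia. }
  assert (Hd' : forall y, y <> dst -> (y =? dst) = false) by (intros; now apply Nat.eqb_neq).
  apply wp_seq, wp_asg; [auto|]. rewrite Ex.
  destruct Hd as [-> | ->].
  all: apply wp_seq, wp_asg; [ok|].
  all: match goal with |- wp _ _ _ (setv _ ?dst _) _ =>
    apply wp_while with (mu := fun s => vr s 17) (Inv := fun s t => exists c,
      vr s dst = c /\ Nat.log2 (vr s 17) + c = Nat.log2 x /\ t <= 3 * c /\ vr s 17 <= x /\
      (forall y, y <> 17 -> y <> dst -> vr s y = vr s0 y) /\
      (forall t i j k, ar s t i j k = ar s0 t i j k)) end.
  1, 5: exists 0; evg; split; [auto|]; split; [lia|]; split; [lia|]; split; [lia|];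
    split; [|auto]; intros y H1 H2; rewrite Hd' by lia;
    destruct (Nat.eqb_spec y 17); [lia | auto].
  1, 4: intros s t _; split; ok.
  1, 3: intros s t (c & Ec & Hc & Ht & Hle & Fv & Fa) Hlt; ev;
    apply wp_seq, wp_asg; [ok|]; evg;
    assert (Hh := log2_half (vr s 17) ltac:(lia));
    assert (Hdl : vr s 17 / 2 < vr s 17) by (apply Nat.div_lt; lia);
    (apply wp_asg; [ok; specialize (Hlog x); lia|]); evg;
    (split; [|lia]); exists (S c);
    (split; [lia|]); (split; [lia|]); (split; [lia|]); (split; [lia|]); (split; [|auto]);
    intros y H1 H2; rewrite Hd' by lia;
    destruct (Nat.eqb_spec y 17); [lia | auto].
  all: intros s t (c & Ec & Hc & Ht & Hle & Fv & Fa) Hge; ev;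
    assert (Hz : Nat.log2 (vr s 17) = 0) by (apply Nat.log2_null; exact Hge);
    (split; [lia|]); (split; [lia|]); auto.
Qed.

Lemma wp_params s0 : vr s0 1 = Delta ->
  wp N W params s0 (fun t s => t <= 40 * (ell Delta + 1) /\
    (forall x, x <= NL -> Dd s x = D x /\ Qq s x = q x) /\ vr s 6 = NL /\
    (forall y, y < 6 -> vr s y = vr s0 y) /\
    (forall t i j k, t < 8 -> ar s t i j k = ar s0 t i j k)).
Proof.
  intros E1. pose proof (pow_facts n NL N W HRN HnN' HLN HNW) as HP.
  pose proof (T_le Delta HD0) as HT. pose proof (lam_T Delta HD0) as HlT.
  pose proof (lam_ge Delta HD0) as Hlam. pose proof (k_ge Delta HD0) as Hk.
  destruct (lev_spec Delta HD0) as (HL1 & HL2 & HL3).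
  assert (HlogD : Nat.log2 Delta = ell Delta) by reflexivity.
  assert (HlD : ell Delta <= Delta) by (pose proof Hell; unfold lam in *; lia).
  assert (HDN : Delta < N) by (unfold N; lia).
  assert (Hg : Nat.log2 (ell Delta) = gg Delta) by reflexivity.
  assert (Hgl : gg Delta <= ell Delta).
  { unfold gg. apply Nat.lt_le_incl, Nat.log2_lt_lin. lia. }
  assert (Hkl : ell Delta * gg Delta = kap Delta) by reflexivity.
  assert (Hl32 : 32 * kap Delta = lam Delta) by reflexivity.
  assert (HTe : lam Delta * kap Delta = TT Delta) by reflexivity.
  unfold params.
  apply wp_seq. eapply wp_conseq; [apply (wp_logp _ _ _ Delta); auto; ok|].
  intros t1 s1 (Ht1 & V1 & F1 & A1).
  apply wp_seq. eapply wp_conseq; [apply (wp_logp _ _ _ (ell Delta)); auto; ok|].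
  intros t2 s2 (Ht2 & V2 & F2 & A2). rewrite HlogD in *. rewrite Hg in *.
  assert (V28 : vr s2 8 = ell Delta) by (rewrite F2 by lia; auto).
  apply wp_seq, wp_asg; [ok|]. evg. rewrite V28, V2, Hkl.
  apply wp_seq, wp_asg; [ok|]. evg. rewrite Hl32.
  apply wp_seq, wp_asg; [ok|]. evg. rewrite HTe.
  apply wp_seq, wp_asg; [ok|]. evg.
  apply wp_seq, wp_asg; [ok|]. evg. rewrite F2, F1, E1 by lia.
  apply wp_seq, wp_sto; [ok|ok|]. evg.
  assert (Hd : forall j, dit Delta j <= Delta) by (apply dit_le; auto).
  assert (A12 : forall t i j k, ar s2 t i j k = ar s0 t i j k) by (intros; rewrite A2; auto).
  assert (F12 : forall y, y < 6 -> vr s2 y = vr s0 y) by (intros; rewrite F2, F1 by lia; auto).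
  clear A1 A2 F1 F2 V1 V2.
  apply wp_seq.
  apply wp_while with (mu := fun s => S (lev Delta) - vr s 10) (Inv := fun s t => exists j,
    vr s 10 = j /\ j <= lev Delta /\ vr s 17 = dit Delta j /\ t = 4 * j /\
    vr s 15 = lam Delta /\ vr s 16 = TT Delta /\
    (forall x, x <= j -> Dd s x = dit Delta x) /\
    (forall y, y < 6 -> vr s y = vr s0 y) /\
    (forall t i j k, t < 8 -> ar s t i j k = ar s0 t i j k)).
  { exists 0. evg. split; [auto|]. split; [lia|]. split; [reflexivity|]. split; [auto|].
    split; [auto|]. split; [auto|]. split.
    { intros x Hx. destruct (Nat.eqb_spec x 0); [subst; reflexivity | lia]. }
    split.
    { intros y Hy. repeat match goal with |- context [y =? ?c] => destruct (Nat.eqb_spec y c); [lia|] end.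
      auto. }
    intros t i j k Ht. destruct (Nat.eqb_spec t 8); [lia|]. auto. }
  { intros s t (j & E10 & Hj & E17 & _). specialize (Hd j). split; ok. }
  { intros s t (j & E10 & Hj & E17 & Ht & E15 & E16 & HDd & Fv & Fa) Hlt. ev.
    rewrite E16, E17 in Hlt.
    assert (Hjl : j < lev Delta).
    { destruct (Nat.eq_dec j (lev Delta)) as [-> |]; lia. }
    assert (Hdj := Hd (S j)). cbn [dit] in Hdj. unfold dstep in Hdj.
    apply wp_seq, wp_asg.
    { ok. rewrite E15, E16, E17. lia. }
    evg. rewrite E15, E16, E17.
    change (dit Delta j / lam Delta + dit Delta j / TT Delta) with (dit Delta (S j)) in *.
    apply wp_seq, wp_asg; [ok|]. evg. rewrite E10.
    assert (HjN : j + 1 < N) by (unfold NL in *; lia).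
    apply wp_sto; [ok|ok|]. evg. split; [|lia].
    exists (j + 1). split; [auto|]. split; [lia|]. split; [rewrite Nat.add_1_r; auto|].
    split; [lia|]. split; [auto|]. split; [auto|]. split.
    { intros x Hx. destruct (Nat.eqb_spec x (j + 1)) as [-> |]; [rewrite Nat.add_1_r; auto|].
      apply HDd. lia. }
    split.
    { intros y Hy. repeat match goal with |- context [y =? ?c] => destruct (Nat.eqb_spec y c); [lia|] end.
      auto. }
    intros t' i j' k Ht'. destruct (Nat.eqb_spec t' 8); [lia|]. auto. }
  intros s t (j & E10 & Hj & E17 & Ht & E15 & E16 & HDd & Fv & Fa) Hge. ev.
  rewrite E16, E17 in Hge.
  assert (j = lev Delta) as ->.
  { destruct (Nat.eq_dec j (lev Delta)); auto. specialize (HL1 j ltac:(lia)). lia. }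
  assert (HLNL : lev Delta + 1 = NL) by reflexivity.
  apply wp_seq, wp_asg; [ok; rewrite ?E10; lia|]. evg. rewrite E10, HLNL.
  apply wp_seq, wp_sto; [ok|ok|]. evg.
  apply wp_seq, wp_sto; [ok|ok|]. evg.
  apply wp_seq, wp_asg; [ok; rewrite ?E17; lia|]. evg. rewrite E17.
  apply wp_seq, wp_sto; [ok; rewrite ?E10; lia|ok|]. evg. rewrite E10.
  assert (Hq0 : q 0 <= 2 * Delta) by (apply pal_le2; auto).
  assert (HqL : forall x, x <= lev Delta -> q x <= 2 * Delta).
  { intros x Hx. etransitivity; [|exact Hq0]. unfold q, pal.
    destruct (Nat.leb_spec x (lev Delta)); [|lia]. rewrite Nat.sub_0_r. cbn [Nat.leb].
    apply Nat.mul_le_mono_l. apply Nat.pow_le_mono_r; lia. }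
  apply wp_while with (mu := fun s => vr s 10) (Inv := fun s t => exists j,
    vr s 10 = j /\ j <= lev Delta /\ vr s 18 = q j /\ t + 4 * j = 4 * lev Delta /\
    vr s 15 = lam Delta /\ vr s 6 = NL /\
    (forall x, x <= NL -> Dd s x = D x) /\
    (forall x, j <= x <= NL -> Qq s x = q x) /\
    (forall y, y < 6 -> vr s y = vr s0 y) /\
    (forall t i j k, t < 8 -> ar s t i j k = ar s0 t i j k)).
  { exists (lev Delta). evg. split; [auto|]. split; [lia|].
    assert (EqL : q (lev Delta) = dit Delta (lev Delta) + 1).
    { unfold q, pal. rewrite Nat.leb_refl, Nat.sub_diag. simpl. lia. }
    split; [lia|]. split; [lia|]. split; [auto|]. split; [auto|].
    split.
    { intros x Hx. unfold D, thr. destruct (Nat.eqb_spec x NL) as [-> | Hn].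
      - destruct (Nat.leb_spec NL (lev Delta)); lia.
      - destruct (Nat.leb_spec x (lev Delta)); [apply HDd; lia | lia]. }
    split.
    { intros x Hx. destruct (Nat.eqb_spec x (lev Delta)) as [-> |]; [lia|].
      destruct (Nat.eqb_spec x NL) as [-> |]; [|lia].
      unfold q. rewrite <- HLNL. symmetry. apply pal_last; auto. }
    split.
    { intros y Hy. repeat match goal with |- context [y =? ?c] => destruct (Nat.eqb_spec y c); [lia|] end.
      auto. }
    intros t' i j' k Ht'. destruct (Nat.eqb_spec t' 9); [lia|].
    destruct (Nat.eqb_spec t' 8); [lia|]. auto. }
  { intros s' t' _. split; ok. }
  { intros s' t' (j & E10' & Hj' & E18 & Ht' & E15' & E6 & HDd' & HQ & Fv' & Fa') Hlt. ev.
    assert (Eq : q (j - 1) = q j * lam Delta).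
    { unfold q. rewrite (pal_step Delta HD0 (j - 1)) by lia.
      replace (S (j - 1)) with j by lia. f_equal. unfold rad.
      destruct (Nat.leb_spec j (lev Delta)); lia. }
    assert (Hqj := HqL (j - 1) ltac:(lia)). rewrite Eq in Hqj.
    assert (H2D : 2 * Delta < W) by lia.
    apply wp_seq, wp_asg.
    { ok. }
    evg. rewrite E18, E15', <- Eq.
    apply wp_seq, wp_asg; [ok|]. evg. rewrite E10'.
    apply wp_sto; [ok|ok|]. evg. split; [|lia].
    exists (j - 1). split; [auto|]. split; [lia|]. split; [auto|]. split; [lia|].
    split; [auto|]. split; [auto|]. split; [auto|]. split.
    { intros x Hx. destruct (Nat.eqb_spec x (j - 1)) as [-> |]; [auto|]. apply HQ. lia. }
    split.
    { intros y Hy. repeat match goal with |- context [y =? ?c] => destruct (Nat.eqb_spec y c); [lia|] end.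
      auto. }
    intros t'' i j' k Ht''. destruct (Nat.eqb_spec t'' 9); [lia|]. auto. }
  intros s' t' (j & E10' & Hj' & E18 & Ht' & E15' & E6 & HDd' & HQ & Fv' & Fa') Hge'. ev.
  split; [lia|]. split; [|auto].
  intros x Hx. split; [auto|]. apply HQ. lia.
Qed.

Definition touches (u v a c : nat) : Prop := a = v /\ c = u \/ a = u /\ c = v.

(** During the loop the levels below [j] already describe the new graph [E'] and the others still
    [E]. Every level gains at most one edge, whence [2 * (NL + 1)]. *)
Lemma wp_edit s0 kd u v (E E' : nat -> nat -> Prop) :
  vr s0 2 = kd -> vr s0 3 = u -> vr s0 4 = v -> vr s0 6 = NL ->
  u < n -> v < n -> u <> v ->
  (forall a c, E a c -> E c a) ->
  (0 < kd -> ~ E u v /\ forall a c, E' a c <-> E a c \/ touches u v a c) ->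
  (kd = 0 -> E u v /\ forall a c, E' a c <-> E a c /\ ~ touches u v a c) ->
  (forall x, x <= NL -> Qq s0 x = q x) -> WF n NL s0 -> MemOK n NL q E s0 ->
  (forall a, a < n -> flg s0 a = 0) ->
  wp N W edit s0 (fun t s => t <= 25 * (NL + 2) /\
    Phi n NL s <= Phi n NL s0 + 2 * (NL + 1) /\ vr s 7 <= 2 /\
    (forall y, y < 7 -> vr s y = vr s0 y) /\
    (forall t i j k, t = 0 \/ t = 4 \/ 7 <= t -> ar s t i j k = ar s0 t i j k) /\
    WF n NL s /\ StkOK n s /\ MemOK n NL q E' s /\
    (forall x a, cnt s x a <= cnt s0 x a \/ flg s a <> 0)).
Proof.
  intros E2 E3 E4 E6 Hu Hv Huv Esym Hins Hdel HQ Hw HM Hfl.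
  pose proof (pow_facts n NL N W HRN HnN' HLN HNW) as HP.
  unfold edit.
  apply wp_seq, wp_asg; [ok|]. apply wp_seq, wp_asg; [exact I|]. evg. rewrite E3.
  apply wp_seq, wp_asg; [exact I|]. evg. rewrite E4.
  apply wp_seq, wp_asg; [ok|]. evg.
  apply wp_seq.
  apply wp_while with (mu := fun s => S NL - vr s 10) (Inv := fun s t => exists j,
    vr s 10 = j /\ j <= S NL /\ t <= 20 * j /\
    vr s 7 = 0 /\ vr s 11 = u /\ vr s 12 = v /\
    (forall y, y < 7 -> vr s y = vr s0 y) /\
    (forall t i j k, t = 0 \/ 4 <= t -> ar s t i j k = ar s0 t i j k) /\
    WF n NL s /\
    (forall x a c, x <= NL -> a < n -> c < n ->
      (mem s x a c <-> (if x <? j then E' a c else E a c) /\ col s0 a / q x = col s0 c / q x)) /\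
    (forall x a, kd = 0 \/ (a <> u /\ a <> v) -> cnt s x a <= cnt s0 x a) /\
    Phi n NL s <= Phi n NL s0 + 2 * j).
  { exists 0. evg. split; [auto|]. split; [lia|]. split; [lia|]. split; [auto|].
    split; [auto|]. split; [auto|]. split.
    { intros y Hy. repeat match goal with |- context [y =? ?c] => destruct (Nat.eqb_spec y c); [lia|] end.
      auto. }
    split; [auto|]. split; [exact Hw|]. split; [exact HM|]. split; [auto|]. unfold Phi. evg. lia. }
  { intros s t (j & E10 & Hj & _ & _ & _ & _ & Fv & _). split; ok. rewrite Fv by lia. lia. }
  { intros s t (j & E10 & Hj & Ht & E7 & E11 & E12 & Fv & Fa & Hw1 & HM1 & C1 & P1) Hlt.
    ev. rewrite E10, (Fv 6), E6 in Hlt by lia.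
    (* The common end of the three branches, insertion, deletion and differing prefixes: passing to
       the next level restores the invariant. *)
    assert (Hpost : forall tt t s2, tt + t + 2 <= 20 * S j -> frame s s2 -> WF n NL s2 ->
      (forall x a c, x <= NL -> a < n -> c < n ->
        (mem s2 x a c <-> (if x <? S j then E' a c else E a c) /\ col s0 a / q x = col s0 c / q x)) ->
      (forall x a, kd = 0 \/ (a <> u /\ a <> v) -> cnt s2 x a <= cnt s x a) ->
      Phi n NL s2 <= Phi n NL s + 2 ->
      wp N W (Asg 10 (plus1 eJ)) s2 (fun t2 s3 => (exists j', vr s3 10 = j' /\ j' <= S NL /\
        S (tt + (t + t2)) <= 20 * j' /\
        vr s3 7 = 0 /\ vr s3 11 = u /\ vr s3 12 = v /\
        (forall y, y < 7 -> vr s3 y = vr s0 y) /\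
        (forall t i j k, t = 0 \/ 4 <= t -> ar s3 t i j k = ar s0 t i j k) /\
        WF n NL s3 /\
        (forall x a c, x <= NL -> a < n -> c < n ->
          (mem s3 x a c <-> (if x <? j' then E' a c else E a c) /\ col s0 a / q x = col s0 c / q x)) /\
        (forall x a, kd = 0 \/ (a <> u /\ a <> v) -> cnt s3 x a <= cnt s0 x a) /\
        Phi n NL s3 <= Phi n NL s0 + 2 * j') /\ S NL - vr s3 10 < S NL - j)).
    { intros tt t2 s2 Ht2 [F2 A2] Hw2 HM2 C2 P2.
      apply wp_asg; [ok; rewrite F2, E10 by lia; lia|]. evg.
      rewrite F2, E10 by lia. split; [|lia]. exists (j + 1).
      split; [auto|]. split; [lia|]. split; [lia|].
      split; [rewrite F2 by lia; auto|]. split; [rewrite F2 by lia; auto|].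
      split; [rewrite F2 by lia; auto|]. split.
      { intros y Hy. destruct (Nat.eqb_spec y 10); [lia|]. rewrite F2 by lia. auto. }
      split; [intros; rewrite A2 by auto; auto|]. split; [exact Hw2|].
      split; [rewrite Nat.add_1_r; exact HM2|].
      split; [intros x a Ha; etransitivity; [apply C2; auto | auto]|].
      unfold Phi in *. evg. lia. }
    assert (Hpre : forall x, x <= NL -> Qq s x = q x) by (intros; rewrite Fa by lia; auto).
    assert (Hcol : forall a, col s a = col s0 a) by (intros; apply Fa; lia).
    apply wp_seq, wp_if.
    { ok; lia. }
    { ok. }
    - evg. rewrite E10, E11, E12, !Hcol, Hpre by lia. intros Hx.
      assert (Heq : col s0 u / q j = col s0 v / q j) by (apply Nat.lxor_eq; lia).
      assert (Hmuv : mem s j u v <-> E u v).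
      { rewrite (HM1 j u v) by (auto; lia). destruct (Nat.ltb_spec j j); [lia|]. tauto. }
      assert (Hmvu : mem s j v u <-> E u v).
      { rewrite (HM1 j v u) by (auto; lia). destruct (Nat.ltb_spec j j); [lia|].
        split; [intros [Hvu _]; auto | intros Hvu; split; auto]. }
      apply wp_if; [ok|ok| |]; evg; rewrite (Fv 2), E2 by lia; intros Hkd.
      + destruct (Hins Hkd) as [HnE HE'].
        eapply wp_conseq; [apply (wp_addboth n NL N W HRN HnN' HLN HNW s j u v); auto; try lia; tauto|].
        intros t2 s2 (-> & Hf2 & Hw2 & M2 & C2 & C3 & C4 & P2 & _).
        eapply wp_conseq; [apply (Hpost t 14 s2); auto; try lia|intros t3 s3 Hres; exact Hres].
        * intros x a c Hx' Ha Hc. rewrite M2, (HM1 x a c) by auto.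
          destruct (Nat.ltb_spec x j); destruct (Nat.ltb_spec x (S j)); try lia.
          -- split; [intros [H' | [H' _]]; [auto | lia] | auto].
          -- assert (x = j) as -> by lia. rewrite HE'. unfold touches. split.
             ++ intros [[H1 H2] | [_ H1]]; [auto|].
                split; [auto|]. destruct H1 as [[-> ->] | [-> ->]]; auto.
             ++ intros [[H1 | H1] H2]; auto.
          -- split; [intros [H' | [H' _]]; [auto | lia] | auto].
        * intros x a [Ha | Ha]; [lia|]. rewrite C4 by tauto. auto.
      + assert (kd = 0) as Hk0 by lia. destruct (Hdel Hk0) as [HE HE'].
        eapply wp_conseq; [apply (wp_remboth n NL N W HRN HnN' HLN HNW s j u v); auto; try lia; tauto|].
        intros t2 s2 (-> & Hf2 & Hw2 & M2 & C2 & C3 & C4 & P2).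
        eapply wp_conseq; [apply (Hpost t 18 s2); auto; try lia|intros t3 s3 Hres; exact Hres].
        intros x a c Hx' Ha Hc. rewrite M2, (HM1 x a c) by auto.
        destruct (Nat.ltb_spec x j); destruct (Nat.ltb_spec x (S j)); try lia.
        * split; [tauto|]. intros H'. split; auto. intros [H'' _]; lia.
        * assert (x = j) as -> by lia. rewrite HE'. unfold touches. tauto.
        * split; [tauto|]. intros H'. split; auto. intros [H'' _]; lia.
    - evg. rewrite E10, E11, E12, !Hcol, Hpre by lia. intros Hx.
      assert (Hne : col s0 u / q j <> col s0 v / q j).
      { intros Heq. rewrite Heq, Nat.lxor_nilpotent in Hx. lia. }
      apply wp_skip.
      eapply wp_conseq; [apply (Hpost t 1 s); auto; try lia|intros t3 s3 Hres; exact Hres].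
      + split; auto.
      + intros x a c Hx' Ha Hc. rewrite (HM1 x a c) by auto.
        destruct (Nat.ltb_spec x j); destruct (Nat.ltb_spec x (S j)); try lia; try tauto.
        assert (x = j) as -> by lia.
        assert (Hnt : col s0 a / q j = col s0 c / q j -> ~ touches u v a c).
        { intros H1 [[-> ->] | [-> ->]]; auto. }
        destruct (Nat.eq_dec kd 0) as [Hk | Hk].
        * destruct (Hdel Hk) as [_ HE']. rewrite HE'. tauto.
        * destruct (Hins ltac:(lia)) as [_ HE']. rewrite HE'. tauto. }
  intros s t (j & E10 & Hj & Ht & E7 & E11 & E12 & Fv & Fa & Hw1 & HM1 & C1 & P1) Hge.
  ev. rewrite E10, (Fv 6), E6 in Hge by lia. assert (j = S NL) as -> by lia.
  assert (HM2 : MemOK n NL q E' s).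
  { intros x a c Hx Ha Hc. rewrite (HM1 x a c) by auto. rewrite !Fa by lia.
    destruct (Nat.ltb_spec x (S NL)); [tauto | lia]. }
  assert (Hfl1 : forall a, a < n -> flg s a = 0) by (intros; rewrite Fa by lia; auto).
  assert (HS : StkOK n s).
  { split; [|split].
    - rewrite E7. intros; lia.
    - rewrite E7. intros; lia.
    - intros x Hx Hf. rewrite Hfl1 in Hf by auto. lia. }
  apply wp_if; [ok|ok| |]; evg; rewrite (Fv 2), E2 by lia; intros Hkd.
  - apply wp_seq. eapply wp_conseq; [apply (wp_push n NL N W HRN HnN' HLN HNW s u); auto|].
    intros t1 s1 (Ht1 & F1 & A1 & HS1 & T1 & G1 & G1').
    apply wp_seq, wp_asg; [exact I|]. evg. rewrite F1, E12 by lia.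
    eapply wp_conseq; [apply (wp_push n NL N W HRN HnN' HLN HNW _ v); auto|].
    intros t2 s2 (Ht2 & F2 & A2 & HS2 & T2 & G2 & G2'). evg. ev.
    assert (Fa12 : forall t i j k, t <> 5 -> t <> 6 -> ar s2 t i j k = ar s t i j k).
    { intros. rewrite A2, A1 by auto. auto. }
    split; [lia|]. split.
    { replace (Phi n NL s2) with (Phi n NL s); [lia|].
      apply sumn_ext. intros. apply sumn_ext. intros. symmetry. apply Fa12; lia. }
    split; [lia|]. split.
    { intros y Hy. rewrite F2 by lia. destruct (Nat.eqb_spec y 11); [lia|].
      rewrite F1 by lia. auto. }
    split. { intros. rewrite Fa12 by lia. apply Fa. lia. }
    split. { intros x a k Hx Ha. rewrite !Fa12 by lia. apply Hw1; auto. }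
    split; [exact HS2|].
    split. { intros x a c Hx Ha Hc. rewrite !Fa12 by lia. rewrite <- (HM2 x a c) by auto.
      unfold mem. split; intros (k & Hk & H); exists k; rewrite !Fa12 in * by lia; auto. }
    intros x a. rewrite Fa12 by lia.
    destruct (Nat.eq_dec a v) as [-> | Hav]; [auto|].
    destruct (Nat.eq_dec a u) as [-> | Hau]; [right; rewrite G2'; auto|].
    left. apply C1. auto.
  - apply wp_skip. split; [lia|]. split; [lia|]. split; [lia|]. split; [auto|].
    split; [intros; apply Fa; lia|]. split; [auto|]. split; [auto|]. split; [auto|].
    intros x a. left. apply C1. left. lia.
Qed.

Lemma wp_check s0 v : vr s0 6 = NL -> vr s0 12 = v -> v < n ->
  (forall x, x <= NL -> Dd s0 x = D x) ->
  wp N W check s0 (fun t s => t <= 3 * (NL + 2) /\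
    (forall y, y <> 13 -> y <> 14 -> vr s y = vr s0 y) /\ ar s = ar s0 /\
    1 <= vr s 13 <= NL + 1 /\
    (forall x, 1 <= x < vr s 13 -> cnt s0 x v <= D x) /\
    (vr s 13 <= NL -> D (vr s 13) < cnt s0 (vr s 13) v)).
Proof.
  intros E6 E12 Hv HDd. pose proof (pow_facts n NL N W HRN HnN' HLN HNW) as HP.
  unfold check. apply wp_seq, wp_asg; [ok|]. apply wp_seq, wp_asg; [ok; rewrite ?E6; lia|].
  evg. rewrite E6.
  apply wp_while with (mu := fun s => vr s 14 - vr s 13) (Inv := fun s t => exists i f,
    vr s 13 = i /\ vr s 14 = f /\ 1 <= i <= f /\ f <= NL + 1 /\ t + 3 * (f - i) <= 3 * NL /\
    (f = NL + 1 \/ f = i /\ i <= NL /\ D i < cnt s0 i v) /\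
    (forall y, y <> 13 -> y <> 14 -> vr s y = vr s0 y) /\ ar s = ar s0 /\
    (forall x, 1 <= x < i -> cnt s0 x v <= D x)).
  - exists 1, (NL + 1). evg. split; [auto|]. split; [auto|]. split; [unfold NL; lia|].
    split; [lia|]. split; [lia|]. split; [auto|]. split.
    { intros y H1 H2. repeat match goal with |- context [y =? ?c] => destruct (Nat.eqb_spec y c); [lia|] end.
      auto. }
    split; [auto|]. lia.
  - intros s t _. split; exact I.
  - intros s t (i & f & E13 & E14 & Hi & Hf & Ht & Hd & Fv & Fa & Hc) Hlt. ev.
    rewrite E13, E14 in Hlt.
    assert (Efa : forall t i j k, ar s t i j k = ar s0 t i j k) by (rewrite Fa; auto).
    apply wp_if.
    { ok. }
    { ok. rewrite Fv by lia. lia. }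
    + evg. rewrite !Efa, E13, Fv, E12, HDd by lia. intros Hcmp.
      apply wp_asg; [exact I|]. evg. rewrite E13. split; [|lia].
      exists i, i. split; [auto|]. split; [auto|]. split; [lia|]. split; [lia|].
      split; [lia|]. split; [right; split; [auto|]; split; [lia | auto]|]. split.
      { intros y H1 H2. destruct (Nat.eqb_spec y 14); [lia|]. auto. }
      auto.
    + evg. rewrite !Efa, E13, Fv, E12, HDd by lia. intros Hcmp.
      apply wp_asg; [ok; lia|]. evg. rewrite E13. split; [|lia].
      exists (i + 1), f. split; [auto|]. split; [auto|]. split; [lia|]. split; [lia|].
      split; [lia|]. split; [left; lia|]. split.
      { intros y H1 H2. destruct (Nat.eqb_spec y 13); [lia|]. auto. }
      split; [auto|]. intros x Hx. destruct (Nat.eq_dec x i) as [-> |]; [lia|]. apply Hc. lia.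
  - intros s t (i & f & E13 & E14 & Hi & Hf & Ht & Hd & Fv & Fa & Hc) Hge. ev.
    rewrite E13, E14 in Hge. assert (f = i) as -> by lia.
    split; [lia|]. split; [auto|]. split; [auto|]. rewrite E13.
    split; [lia|]. split; [auto|]. intros Hle. destruct Hd as [-> | (_ & _ & Hd)]; [lia | auto].
Qed.

(** Level 0 is left out, since there the bound is the promise on the degrees. *)
Definition Clean (s : st) : Prop := forall a, a < n -> flg s a = 0 ->
  forall x, 1 <= x <= NL -> cnt s x a <= D x.

Definition Stable (E : nat -> nat -> Prop) (s : st) : Prop :=
  WF n NL s /\ StkOK n s /\ MemOK n NL q E s /\ OutOK n s /\
  (forall a, a < n -> col s a < q 0) /\ Clean s.

(** The potential is both the time budget and the termination measure: each round costs at least one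
    tick and is paid by a drop of the potential. *)
Lemma wp_work s0 (E : nat -> nat -> Prop) :
  (forall a c, E a c -> E c a) -> (forall a, ~ E a a) ->
  (forall s, WF n NL s -> MemOK n NL q E s -> forall a, a < n -> cnt s 0 a <= Delta) ->
  vr s0 6 = NL -> (forall x, x <= NL -> Dd s0 x = D x /\ Qq s0 x = q x) -> Stable E s0 ->
  wp N W work s0 (fun t s =>
    t + ratio Delta * Phi n NL s <= ratio Delta * Phi n NL s0 + pushcost Delta * vr s0 7 + 1 /\
    vr s 7 = 0 /\ Stable E s).
Proof.
  intros Esym Eirr Hdeg E6 HDQ HSt. pose proof (pow_facts n NL N W HRN HnN' HLN HNW) as HP.
  assert (HNL : NL = lev Delta + 1) by reflexivity.
  apply wp_while with (mu := fun s => ratio Delta * Phi n NL s + pushcost Delta * vr s 7)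
    (Inv := fun s t => vr s 6 = NL /\ (forall x, x <= NL -> Dd s x = D x /\ Qq s x = q x) /\
      Stable E s /\ t + ratio Delta * Phi n NL s + pushcost Delta * vr s 7 <=
        ratio Delta * Phi n NL s0 + pushcost Delta * vr s0 7).
  - split; [auto|]. split; [auto|]. split; [auto|]. lia.
  - intros s t _. split; ok.
  - intros s t (E6' & HDQ' & (Hw & HS & HM & HO & Hcol & Hcl) & Ht) Hlt. ev.
    set (st := vr s 7) in *.
    destruct HS as (S1 & S2 & S3).
    assert (Hpos : 0 < st) by exact Hlt.
    destruct (S1 (st - 1)) as [Hv Hfv]; [fold st; lia|].
    assert (Hst : st <= n).
    { assert (Hnd : NoDup (map (fun k => stk s k) (seq 0 st))).
      { apply NoDup_map_NoDup_ForallPairs; [|apply seq_NoDup].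
        intros a c Ha Hc Hac. apply in_seq in Ha, Hc. apply S2; auto; fold st; lia. }
      apply NoDup_incl_length with (l' := seq 0 n) in Hnd;
        [rewrite length_map, !length_seq in Hnd; exact Hnd|].
      intros y Hin. apply in_map_iff in Hin as (k & <- & Hk). apply in_seq in Hk. apply in_seq.
        destruct (S1 k); fold st; lia. }
    set (v := stk s (st - 1)) in *.
    apply wp_seq, wp_asg; [ok; fold st; lia|]. evg. fold st.
    apply wp_seq, wp_asg; [ok|]. evg. fold v.
    apply wp_seq, wp_sto; [ok|ok|]. evg.
    match goal with |- wp _ _ _ ?s9 _ => set (s1 := s9) end.
    assert (A1 : forall t i j k, t <> 5 -> ar s1 t i j k = ar s t i j k).
    { intros t' i j k Ht'. subst s1. evg. destruct (Nat.eqb_spec t' 5); [lia | auto]. }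
    assert (Gv : flg s1 v = 0) by (subst s1; evg; rewrite Nat.eqb_refl; auto).
    assert (Ga : forall a, a <> v -> flg s1 a = flg s a).
    { intros a Ha. subst s1. evg. destruct (Nat.eqb_spec a v); [lia | auto]. }
    assert (E7 : vr s1 7 = st - 1) by reflexivity.
    assert (HS1 : StkOK n s1).
    { unfold StkOK. rewrite E7. split; [|split].
      - intros k Hk. rewrite A1 by lia. destruct (S1 k) as [H1 H2]; [fold st; lia|].
        split; auto. rewrite Ga; auto. intros Hkv.
        assert (k = st - 1) by (apply S2; auto; fold st; lia). lia.
      - intros k k' Hk Hk'. rewrite !A1 by lia. apply S2; fold st; lia.
      - intros x Hx Hfx. destruct (Nat.eq_dec x v) as [-> | Hxv]; [lia|].
        rewrite Ga in Hfx by auto. destruct (S3 x Hx Hfx) as (k & Hk & Ek). fold st in Hk.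
        exists k. rewrite A1 by lia. split; auto.
        destruct (Nat.eq_dec k (st - 1)) as [-> |]; [|lia]. exfalso. auto. }
    apply wp_seq. eapply wp_conseq; [apply (wp_check s1 v); auto|].
    { intros x Hx. rewrite A1 by lia. apply HDQ'. auto. }
    intros t2 s2 (Ht2 & F2 & A2 & Hi & Hci & Hvi).
    assert (A2' : forall t i j k, ar s2 t i j k = ar s1 t i j k) by (rewrite A2; auto).
    assert (A12 : forall t i j k, t <> 5 -> ar s2 t i j k = ar s t i j k).
    { intros. rewrite A2', A1; auto. }
    assert (Hw2 : WF n NL s2).
    { intros x a k Hx Ha. rewrite !A12 by lia. apply Hw; auto. }
    assert (HS2 : StkOK n s2).
    { apply (StkOK_ext n s1); [rewrite F2 by lia; auto | intros; apply A2' | auto]. }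
    assert (Hmem : forall x a c, mem s2 x a c <-> mem s x a c).
    { intros. unfold mem. split; intros (k & Hk & Hka); exists k; rewrite !A12 in * by lia; auto. }
    assert (HM2 : MemOK n NL q E s2).
    { intros x a c Hx Ha Hc. rewrite !A12 by lia. rewrite Hmem. apply HM; auto. }
    assert (HO2 : OutOK n s2) by (intros x Hx Hr; rewrite !A12 by lia; apply HO; auto).
    assert (Hcol2 : forall a, a < n -> col s2 a < q 0) by (intros; rewrite A12 by lia; auto).
    assert (HDQ2 : forall x, x <= NL -> Dd s2 x = D x /\ Qq s2 x = q x).
    { intros x Hx. rewrite !A12 by lia. auto. }
    assert (HP2 : Phi n NL s2 = Phi n NL s).
    { apply sumn_ext. intros. apply sumn_ext. intros. apply A12. lia. }
    assert (E62 : vr s2 6 = NL) by (rewrite F2 by lia; exact E6').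
    assert (E72 : vr s2 7 = st - 1) by (rewrite F2 by lia; exact E7).
    assert (E12 : vr s2 12 = v) by (rewrite F2 by lia; reflexivity).
    assert (Gv2 : flg s2 v = 0) by (rewrite A2'; auto).
    set (i := vr s2 13) in *.
    assert (Hpc : pushcost Delta = 40 * (NL + 3)) by (unfold pushcost; lia).
    assert (Hpst : pushcost Delta * st = pushcost Delta * (st - 1) + pushcost Delta).
    { replace st with (st - 1 + 1) at 1 by lia. lia. }
    apply wp_if; [ok|ok; lia| |]; evg; fold i; rewrite E62; intros Hcmp.
    + assert (HD' : cnt s2 (i - 1) v <= D (i - 1)).
      (* For [i = 1] this is the promise on the degrees; otherwise level [i - 1] is within its
         threshold because [i] is the least exceeded level. *)
      { destruct (Nat.eq_dec i 1) as [-> | Hn].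
        - change (D (1 - 1)) with (D 0). unfold D, thr. cbn [Nat.leb dit].
          apply Hdeg; auto.
        - rewrite A2'. apply Hci. lia. }
      pose proof (wp_recolor n NL N W HRN HnN HLN HNW q b D E) as HR.
      eapply wp_conseq; [apply (HR) with (i := i) (v := v); auto; try lia|].
      * intros j Hj. apply pal_step; auto; lia.
      * apply pal_last; auto.
      * intros j Hj. pose proof (rad_bound Delta HD0 j). pose proof (T_le Delta HD0).
        unfold b. split; [lia|]. unfold N. lia.
      * pose proof (pal_le2 Delta HD0). unfold q, N. nia.
      * intros j Hj. apply thr_step; auto.
      * intros x Hx. apply HDQ2. auto.
      * intros t3 s3 (O & Nw & Ht3 & HOv & HN & F3 & A3 & Hcol3 & Hw3 & HS3 & HM3 & HO3 & B1 & B2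
          & G1 & B3 & P3 & T3).
        assert (Hpay := recolor_pays Delta HD0 i O Nw).
        replace (lev Delta + 2) with (S NL) in Hpay by lia.
        assert (Hthr : thr Delta i + 1 <= O).
        { assert (Hx := Hvi ltac:(lia)). rewrite <- A2' in Hx. fold D. lia. }
        specialize (Hpay ltac:(lia) Hthr HN). fold b D in Hpay.
        assert (Hpn : pushcost Delta * vr s3 7 <= pushcost Delta * (st - 1 + Nw))
          by (apply Nat.mul_le_mono_l; lia).
        rewrite Nat.mul_add_distr_l in Hpn.
        assert (Hphi : ratio Delta * Phi n NL s3 + ratio Delta * (2 * O)
          = ratio Delta * Phi n NL s + ratio Delta * (2 * Nw)).
        { rewrite <- !Nat.mul_add_distr_l. f_equal. lia. }
        assert (Hcost : S (t + (1 + (1 + (1 + (t2 + S t3))))) + ratio Delta * Phi n NL s3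
          + pushcost Delta * vr s3 7 <=
          t + ratio Delta * Phi n NL s + pushcost Delta * st) by lia.
        split; [|lia]. split; [rewrite F3 by lia; auto|].
        split; [intros x Hx; rewrite !A3 by lia; auto|]. split; [|lia].
        split; [auto|]. split; [auto|]. split; [auto|]. split; [auto|]. split; [auto|].
        intros a Ha Hfa x Hx. destruct (Nat.eq_dec a v) as [-> | Hav].
        -- destruct (le_lt_dec i x); [apply B1; lia|].
           etransitivity; [apply B2; auto|]. rewrite A2'. apply Hci. lia.
        -- destruct (B3 x a Hav) as [Hle | Hf]; [|lia].
           etransitivity; [exact Hle|]. rewrite A12 by lia. apply Hcl; auto.
           destruct (Nat.eq_dec (flg s a) 0) as [Hz | Hz]; auto.
           exfalso. apply (G1 a); auto. rewrite A2', Ga; auto.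
    + apply wp_skip. split; [|lia]. split; [auto|]. split; [auto|]. split; [|lia].
      split; [auto|]. split; [auto|]. split; [auto|]. split; [auto|]. split; [auto|].
      intros a Ha Hfa x Hx. rewrite A12 by lia. destruct (Nat.eq_dec a v) as [-> | Hav].
      * rewrite <- A1 by lia. apply Hci. lia.
      * apply Hcl; auto. rewrite <- Ga by auto. rewrite <- A2'. auto.
  - intros s t (E6' & HDQ' & HSt' & Ht) Hge. ev.
    split; [lia|]. split; [lia | auto].
Qed.

(* The invariant between two updates. *)
Definition Rest (E : nat -> nat -> Prop) (s : st) : Prop :=
  WF n NL s /\ MemOK n NL q E s /\ OutOK n s /\ (forall a, a < n -> col s a < q 0) /\
  (forall a, a < n -> flg s a = 0) /\ (forall a x, a < n -> 1 <= x <= NL -> cnt s x a <= D x).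

(* Amortised time of an update, for the potential [ratio * Phi] plus [pushcost] per entry of
   the stack. *)
Definition upcost : nat :=
  40 * (ell Delta + 1) + 25 * (NL + 2) + ratio Delta * (2 * (NL + 1)) + 2 * pushcost Delta + 1.

Lemma wp_main s0 kd u v (E E' : nat -> nat -> Prop) :
  vr s0 1 = Delta -> vr s0 2 = kd -> vr s0 3 = u -> vr s0 4 = v ->
  u < n -> v < n -> u <> v ->
  (forall a c, E a c -> E c a) -> (forall a c, E' a c -> E' c a) -> (forall a, ~ E' a a) ->
  (0 < kd -> ~ E u v /\ forall a c, E' a c <-> E a c \/ touches u v a c) ->
  (kd = 0 -> E u v /\ forall a c, E' a c <-> E a c /\ ~ touches u v a c) ->
  (forall s, WF n NL s -> MemOK n NL q E' s -> forall a, a < n -> cnt s 0 a <= Delta) ->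
  Rest E s0 ->
  wp N W main s0 (fun t s => Rest E' s /\
    t + ratio Delta * Phi n NL s <= ratio Delta * Phi n NL s0 + upcost).
Proof.
  intros E1 E2 E3 E4 Hu Hv Huv Esym Esym' Eirr' Hins Hdel Hdeg (Hw & HM & HO & Hcol & Hfl & Hcl).
  unfold main. apply wp_seq. eapply wp_conseq; [apply wp_params; auto|].
  intros t1 s1 (Ht1 & HDQ & E6 & F1 & A1).
  assert (Hm1 : forall x a c, mem s1 x a c <-> mem s0 x a c).
  { intros. unfold mem. split; intros (k & Hk & Hka); exists k; rewrite !A1 in * by lia; auto. }
  apply wp_seq. eapply wp_conseq.
  { apply (wp_edit s1 kd u v E E'); auto; try (rewrite F1 by lia; auto).
    - intros x Hx. apply HDQ. auto.
    - intros x a k Hx Ha. rewrite !A1 by lia. apply Hw; auto.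
    - intros x a c Hx Ha Hc. rewrite Hm1, !A1 by lia. apply HM; auto.
    - intros a Ha. rewrite A1 by lia. auto. }
  intros t2 s2 (Ht2 & P2 & T2 & F2 & A2 & Hw2 & HS2 & HM2 & C2).
  eapply wp_conseq.
  { apply (wp_work s2 E'); auto.
    - rewrite F2 by lia. auto.
    - intros x Hx. rewrite !A2 by lia. auto.
    - split; [auto|]. split; [auto|]. split; [auto|]. split; [|split].
      + intros x Hx Hr. rewrite !A2, !A1 by lia. auto.
      + intros a Ha. rewrite A2, A1 by lia. auto.
      + intros a Ha Hf x Hx. destruct (C2 x a) as [Hle | Hne]; [|lia].
        etransitivity; [exact Hle|]. rewrite A1 by lia. auto. }
  intros t3 s3 (Ht3 & E7 & Hw3 & HS3 & HM3 & HO3 & Hcol3 & Hcl3).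
  assert (Hfl3 : forall a, a < n -> flg s3 a = 0).
  { intros a Ha. destruct (Nat.eq_dec (flg s3 a) 0) as [Hz | Hz]; auto.
    destruct HS3 as (_ & _ & HS3). destruct (HS3 a Ha Hz) as (k & Hk & _). lia. }
  split.
  { split; [auto|]. split; [auto|]. split; [auto|]. split; [auto|]. split; [auto|].
    intros a x Ha Hx. apply Hcl3; auto. }
  assert (HP1 : Phi n NL s1 = Phi n NL s0).
  { apply sumn_ext. intros. apply sumn_ext. intros. apply A1. lia. }
  rewrite HP1 in P2.
  assert (HR : ratio Delta * Phi n NL s2 <= ratio Delta * (Phi n NL s0 + 2 * (NL + 1)))
    by (apply Nat.mul_le_mono_l; auto).
  assert (HPc : pushcost Delta * vr s2 7 <= pushcost Delta * 2) by (apply Nat.mul_le_mono_l; auto).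
  unfold upcost. lia.
Qed.

(** A monochromatic edge would lie in the last level graph, whose threshold is 0. *)
Lemma Rest_proper E s a c : Rest E s -> a < n -> c < n -> E a c -> col s a <> col s c.
Proof.
  intros (Hw & HM & _ & _ & _ & Hcl) Ha Hc HE Heq.
  assert (Hm : mem s NL a c) by (apply HM; auto; rewrite Heq; auto).
  destruct Hm as (k & Hk & _).
  assert (H1 := Hcl a NL Ha ltac:(unfold NL; lia)).
  assert (H2 : D NL = 0).
  { unfold D, thr, NL. destruct (Nat.leb_spec (lev Delta + 1) (lev Delta)); lia. }
  lia.
Qed.

(** The zeroed memory is a legal start: empty lists, no flags, and every vertex of colour 0. *)
Lemma Rest_init (E : nat -> nat -> Prop) s :
  (forall a c, ~ E a c) -> (forall t i j k, ar s t i j k = 0) -> Rest E s.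
Proof.
  intros HE H0. split; [|split; [|split; [|split; [|split]]]].
  - intros x a k _ _. rewrite H0. lia.
  - intros x a c _ _ _. split; [|intros [H _]; exfalso; exact (HE _ _ H)].
    intros (k & Hk & _). rewrite H0 in Hk. lia.
  - intros x _ _. rewrite !H0. auto.
  - intros a Ha. rewrite H0. unfold q, pal. cbn [Nat.leb].
    pose proof (lam_ge Delta HD0).
    assert (lam Delta ^ (lev Delta - 0) <> 0) by (apply Nat.pow_nonzero; lia). nia.
  - intros. apply H0.
  - intros. rewrite H0. lia.
Qed.

End Main.

(** * Running the machine *)

Definition prologue : program := [IConst 5 2; IAdd 5 5 0; IAdd 5 5 1].

Definition copy (x0 len : nat) : program :=
  flat_map (fun x => [ILoad (8 + x) 6; IAdd 6 6 7]) (seq x0 len).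

(** Cell 6 is set to the address [4 * N^3] of the colour array and then runs along it. Cells 6 and 7
    lie below the colour cells and are not overwritten by the copied colours. *)
Definition epilogue : program :=
  [IConst 6 4; IMul 6 6 5; IMul 6 6 5; IMul 6 6 5; IConst 7 1] ++ copy 0 (RR - 8).

Definition machine : program := prologue ++ cc main 3 ++ epilogue.

Lemma main_wf : cwf main = true.
Proof. vm_compute. reflexivity. Qed.

Lemma copy_correct P w A len : forall x0 base m,
  RR <= A -> x0 + len <= RR - 8 -> A + x0 + len < 2 ^ w ->
  code_at P base (copy x0 len) -> m 6 = A + x0 -> m 7 = 1 ->
  exists m', run P w base m (2 * len) (base + 2 * len) m' /\
    (forall x, x0 <= x < x0 + len -> m' (8 + x) = m (A + x)) /\
    (forall a, RR <= a -> m' a = m a) /\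
    (forall a, a < 8 + x0 -> a <> 6 -> m' a = m a).
Proof.
  induction len as [|len IH]; intros x0 base m HA Hx HW HP H6 H7.
  - exists m. simpl. rewrite Nat.add_0_r. split; [constructor|].
    split; [intros; lia | auto].
  - change (copy x0 (S len)) with (ILoad (8 + x0) 6 :: IAdd 6 6 7 :: copy (S x0) len) in HP.
    apply code_at_cons in HP as [HP1 HP]. apply code_at_cons in HP as [HP2 HP].
    set (m1 := upd m (8 + x0) (m (A + x0))).
    set (m2 := upd m1 6 (A + S x0)).
    assert (Hm2 : forall a, a <> 6 -> a <> 8 + x0 -> m2 a = m a).
    { intros a H1 H2. unfold m2, m1, upd. destruct (Nat.eqb_spec a 6); [lia|].
      destruct (Nat.eqb_spec a (8 + x0)); [lia | auto]. }
    destruct (IH (S x0) (S (S base)) m2) as (m' & Hr & H1 & H2 & H3);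
      [auto | lia | lia | exact HP | reflexivity | exact H7 |].
    exists m'. split; [|split; [|split]].
    + replace (2 * S len) with (1 + (1 + 2 * len)) by lia.
      replace (base + (1 + (1 + 2 * len))) with (S (S base) + 2 * len) by lia.
      eapply run_trans; [apply run_1; unfold step; rewrite HP1, H6; reflexivity|].
      eapply run_trans; [apply run_1|exact Hr].
      unfold step. rewrite HP2. fold m1.
      assert (E6 : m1 6 = A + x0) by exact H6. assert (E7 : m1 7 = 1) by exact H7.
      rewrite E6, E7, Nat.mod_small by lia. unfold m2.
      replace (A + x0 + 1) with (A + S x0) by lia. reflexivity.
    + intros x Hxr. destruct (Nat.eq_dec x x0) as [-> | Hn].
      * rewrite H3 by lia. unfold m2, upd. destruct (Nat.eqb_spec (8 + x0) 6); [lia|].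
        unfold m1, upd. now rewrite Nat.eqb_refl.
      * rewrite H1 by lia. apply Hm2; unfold RR in *; lia.
    + intros a Ha. rewrite H2 by auto. apply Hm2; unfold RR in *; lia.
    + intros a Ha Hn. rewrite H3 by lia. apply Hm2; lia.
Qed.

Lemma code_at_machine :
  code_at machine 0 prologue /\ code_at machine 3 (cc main 3) /\
  code_at machine (3 + length (cc main 3)) epilogue.
Proof.
  assert (H : code_at machine 0 machine) by (intros i _; reflexivity).
  unfold machine at 2 in H. apply code_at_app in H as [H1 H].
  apply code_at_app in H as [H2 H3]. auto.
Qed.

Lemma machine_halts w m :
  step machine w (3 + length (cc main 3) + length epilogue) m = None.
Proof.
  unfold step. rewrite nth_overflow; [reflexivity|].
  unfold machine. rewrite !length_app. change (length prologue) with 3. lia.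
Qed.

(** All that survives from one update to the next: the registers are overwritten with colours. *)
Definition Arr (N : nat) (A : nat -> nat -> nat -> nat -> nat) (m : memory) : Prop :=
  forall t i j k, i < N -> j < N -> k < N -> RR <= addr N t i j k ->
    m (addr N t i j k) = A t i j k.

Lemma prologue_correct P w n Delta m :
  let N := n + Delta + 2 in N < 2 ^ w -> 2 < 2 ^ w ->
  m 0 = n -> m 1 = Delta -> code_at P 0 prologue ->
  exists m1, run P w 0 m 3 3 m1 /\ m1 5 = N /\ forall x, x <> 5 -> m1 x = m x.
Proof.
  intros N HN H2 H0 H1 P1.
  apply code_at_cons in P1 as [I1 P1]. apply code_at_cons in P1 as [I2 P1].
  apply code_at_cons in P1 as [I3 _].
  exists (upd (upd (upd m 5 2) 5 (2 + n)) 5 N). split; [|split].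
  - eapply run_S; [unfold step; rewrite I1, Nat.mod_small by lia; reflexivity|].
    eapply run_S; [unfold step; rewrite I2|].
    { replace (upd m 5 2 5 + upd m 5 2 0) with (2 + n) by (rewrite <- H0; reflexivity).
      rewrite Nat.mod_small by lia. reflexivity. }
    eapply run_S; [unfold step; rewrite I3|apply run_0].
    replace (upd (upd m 5 2) 5 (2 + n) 5 + upd (upd m 5 2) 5 (2 + n) 1) with N.
    + rewrite Nat.mod_small by lia. reflexivity.
    + change (upd (upd m 5 2) 5 (2 + n) 1) with (m 1). rewrite H1.
      change (upd (upd m 5 2) 5 (2 + n) 5) with (2 + n). lia.
  - apply upd_same.
  - intros x Hx. unfold upd. destruct (Nat.eqb_spec x 5); [lia | auto].
Qed.

Lemma epilogue_correct P w N b m : RR + 8 < N -> 16 * (N * N * N) < 2 ^ w -> m 5 = N ->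
  code_at P b epilogue ->
  exists m', run P w b m (length epilogue) (b + length epilogue) m' /\
    (forall x, x < RR - 8 -> m' (8 + x) = m (addr N 4 0 0 x)) /\
    (forall a, RR <= a -> m' a = m a).
Proof.
  intros HN HW M5 HP. unfold epilogue in HP. apply code_at_app in HP as [P3 P4].
  apply code_at_cons in P3 as [J1 P3]. apply code_at_cons in P3 as [J2 P3].
  apply code_at_cons in P3 as [J3 P3]. apply code_at_cons in P3 as [J4 P3].
  apply code_at_cons in P3 as [J5 _].
  assert (L1 : 4 * N < 2 ^ w) by nia. assert (L2 : 4 * N * N < 2 ^ w) by nia.
  assert (Hmul : forall m0 v, m0 6 = v -> m0 5 = N -> v * N < 2 ^ w ->
    upd m0 6 ((m0 6 * m0 5) mod 2 ^ w) = upd m0 6 (v * N)).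
  { intros m0 v -> -> Hv. now rewrite Nat.mod_small. }
  set (m1 := upd m 6 4). set (m2 := upd m1 6 (4 * N)). set (m3 := upd m2 6 (4 * N * N)).
  set (m4 := upd m3 6 (4 * N * N * N)). set (m5 := upd m4 7 1).
  assert (R3 : run P w b m 5 (b + 5) m5).
  { replace (b + 5) with (S (S (S (S (S b))))) by lia.
    eapply run_S; [unfold step; rewrite J1, Nat.mod_small by lia; reflexivity|]. fold m1.
    eapply run_S; [unfold step; rewrite J2, (Hmul m1 4); [reflexivity | reflexivity | exact M5 | lia]|].
    fold m2.
    eapply run_S; [unfold step; rewrite J3, (Hmul m2 (4 * N)); [reflexivity | reflexivity | exact M5 | lia]|].
    fold m3.
    eapply run_S; [unfold step; rewrite J4, (Hmul m3 (4 * N * N)); [reflexivity | reflexivity | exact M5 | lia]|].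
    fold m4.
    eapply run_S; [unfold step; rewrite J5, Nat.mod_small by lia; reflexivity|].
    apply run_0. }
  assert (M : forall x, x <> 6 -> x <> 7 -> m5 x = m x).
  { intros x H6 H7. unfold m5, m4, m3, m2, m1, upd. destruct (Nat.eqb_spec x 7); [lia|].
    destruct (Nat.eqb_spec x 6); [lia | auto]. }
  set (A4 := addr N 4 0 0 0).
  assert (HA4 : A4 = 4 * N * N * N) by (unfold A4, addr; lia).
  assert (HA4b : RR <= A4 /\ A4 <= 4 * (N * N * N)).
  { rewrite HA4. split; [|lia]. unfold RR in *. nia. }
  assert (H38 : A4 + 0 + (RR - 8) < 2 ^ w).
  { assert (N <= N * N * N) by nia. unfold RR in *. lia. }
  destruct (copy_correct P w A4 (RR - 8) 0 (b + 5) m5) as (m' & R4 & C1 & C2 & _);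
    [lia | lia | exact H38 | exact P4 | rewrite HA4, Nat.add_0_r; reflexivity | reflexivity |].
  exists m'. split; [|split].
  - change (length epilogue) with (5 + 2 * (RR - 8)). rewrite Nat.add_assoc.
    eapply run_trans; [exact R3 | exact R4].
  - intros x Hx. rewrite C1 by lia.
    replace (A4 + x) with (addr N 4 0 0 x) by (unfold A4, addr; lia).
    assert (Hle : A4 <= addr N 4 0 0 x) by (unfold A4, addr; lia).
    apply M; unfold RR in *; lia.
  - intros a Ha. rewrite C2 by auto. apply M; unfold RR in *; lia.
Qed.

(** [main] must be correct from every state with the given inputs and arrays, because the remaining
    variables start with stale colours. *)
Lemma machine_run n Delta w A m (Q : nat -> st -> Prop) :
  let N := n + Delta + 2 in
  RR + 8 < N -> 16 * (N * N * N) < 2 ^ w ->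
  m 0 = n -> m 1 = Delta -> Arr N A m ->
  (forall s, (forall x, x < 5 -> vr s x = m x) -> ar s = A -> wp N (2 ^ w) main s Q) ->
  exists m' k t s', Exec machine w 0 m k m' /\ k <= kmax main * t + 130 /\ Q t s' /\
    Arr N (ar s') m' /\
    (forall x, x < RR - 8 -> m' (8 + x) = ar s' 4 0 0 x) /\
    (forall x, RR <= x -> x < N -> m' x = ar s' 0 0 0 x).
Proof.
  intros N HN HW H0 H1 HA Hwp.
  assert (HNW : N < 2 ^ w) by nia.
  destruct code_at_machine as (P1 & P2 & P3).
  destruct (prologue_correct machine w n Delta m) as (m1 & R1 & M15 & M1); auto.
  { unfold RR in HN. lia. }
  fold N in M15. set (s := mkSt m1 A).
  destruct (Hwp s) as (t & s' & Hex & HQ); [intros; apply M1; lia | reflexivity|].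
  assert (HR : Rel N s m1).
  { split; [auto|]. split; [exact M15|]. intros t' i j k Hi Hj Hk Ha.
    rewrite M1; [apply HA; auto | unfold RR in *; lia]. }
  destruct (cc_correct machine w N main s t s' Hex 3 m1 P2 main_wf HR)
    as (m2 & k2 & Hk2 & R2 & (V2 & N2 & A2)).
  assert (M25 : m2 5 = N) by (rewrite V2; [exact N2 | unfold TMP; lia]).
  destruct (epilogue_correct machine w N _ m2 HN HW M25 P3) as (m3 & R3 & C1 & C2).
  exists m3, (3 + (k2 + (length epilogue + 0))), t, s'.
  split; [|split; [|split; [exact HQ|split; [|split]]]].
  - eapply run_Exec; [exact R1|].
    eapply run_Exec; [exact R2|]. eapply run_Exec; [exact R3|].
    apply Exec_halt, machine_halts.
  (* The 3 instructions of the prologue and the 117 of the epilogue stay below 130. *)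
  - change (length epilogue) with 117. lia.
  - intros t' i j k Hi Hj Hk Ha. rewrite C2 by auto. apply A2; auto.
  - intros x Hx. rewrite C1 by auto. unfold RR in *. apply A2; try lia.
    unfold addr. nia.
  - intros x Hx HxN. rewrite C2 by auto.
    assert (E : addr N 0 0 0 x = x) by (unfold addr; lia).
    rewrite <- E at 1. apply A2; try lia.
Qed.

(** * Edge sequences and the amortised bound for a session *)

Lemma edge_snoc s e x y :
  edge (s ++ [e]) x y = if same_pair x y e then ins e else edge s x y.
Proof. unfold edge. rewrite fold_left_app. reflexivity. Qed.

Lemma same_pair_sym x y e : same_pair x y e = same_pair y x e.
Proof. unfold same_pair. apply Bool.orb_comm. Qed.

Lemma edge_sym s x y : edge s x y = edge s y x.
Proof.
  induction s as [|e s IH] using rev_ind; [reflexivity|].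
  rewrite !edge_snoc, same_pair_sym, IH. reflexivity.
Qed.

Lemma same_pair_touches x y e : same_pair x y e = true <-> touches (eu e) (ev e) x y.
Proof.
  unfold same_pair, touches. rewrite Bool.orb_true_iff, !Bool.andb_true_iff, !Nat.eqb_eq.
  split; intros [[-> ->] | [-> ->]]; auto.
Qed.

Lemma valid_snoc n Delta s e : valid_seq n Delta (s ++ [e]) ->
  valid_seq n Delta s /\ eu e < n /\ ev e < n /\ eu e <> ev e /\
  edge s (eu e) (ev e) = negb (ins e) /\
  (forall x, x < n -> degree n (s ++ [e]) x <= Delta).
Proof.
  intros H. split.
  - intros t Ht. specialize (H t). cbv zeta in H |- *. rewrite length_app in H. specialize (H ltac:(simpl; lia)).
    rewrite !firstn_app, app_nth1 in H by auto.
    replace (t - length s) with 0 in H by lia. replace (S t - length s) with 0 in H by lia.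
    simpl firstn in H. rewrite !app_nil_r in H. exact H.
  - specialize (H (length s)). cbv zeta in H. rewrite length_app in H. specialize (H ltac:(simpl; lia)).
    rewrite app_nth2, Nat.sub_diag in H by lia. cbn [nth] in H.
    replace (S (length s)) with (length (s ++ [e])) in H by (rewrite length_app; simpl; lia).
    rewrite (firstn_all (s ++ [e])) in H.
    rewrite firstn_app, Nat.sub_diag, firstn_all in H. cbn [firstn] in H.
    rewrite app_nil_r in H. exact H.
Qed.

Lemma edge_irrefl n Delta s x : valid_seq n Delta s -> edge s x x = false.
Proof.
  induction s as [|e s IH] using rev_ind; intros Hv; [reflexivity|].
  apply valid_snoc in Hv as (Hv & _ & _ & Hne & _). rewrite edge_snoc.
  destruct (same_pair x x e) eqn:Es; auto.
  apply same_pair_touches in Es. unfold touches in Es. lia.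
Qed.

(** The entries of a list at level 0 are distinct neighbours in the graph; so the promise on the
    degrees bounds the degree at level 0, as [wp_work] requires. *)
Lemma cnt_degree n NL q s us a :
  WF n NL s -> MemOK n NL q (fun x y => edge us x y = true) s -> a < n ->
  cnt s 0 a <= degree n us a.
Proof.
  intros Hw HM Ha.
  assert (Hnd : NoDup (map (fun k => adj s 0 a k) (seq 0 (cnt s 0 a)))).
  { apply NoDup_map_NoDup_ForallPairs; [|apply seq_NoDup].
    intros k k' Hk Hk' E. apply in_seq in Hk, Hk'.
    destruct (Hw 0 a k) as [_ E1]; auto; try lia.
    destruct (Hw 0 a k') as [_ E2]; auto; try lia. congruence. }
  apply NoDup_incl_length with (l' := filter (fun y => edge us a y) (seq 0 n)) in Hnd.
  - rewrite length_map, length_seq in Hnd. exact Hnd.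
  - intros u Hu. apply in_map_iff in Hu as (k & <- & Hk). apply in_seq in Hk.
    destruct (Hw 0 a k) as [H1 _]; auto; try lia.
    apply filter_In. split; [apply in_seq; lia|].
    apply (HM 0 a (adj s 0 a k)); auto; try lia. exists k. split; auto. lia.
Qed.

Lemma word_size_pow c n Delta : (n + Delta + 2) ^ (c + 1) <= 2 ^ word_size c n Delta.
Proof.
  unfold word_size. rewrite Nat.mul_comm, Nat.pow_mul_r. apply Nat.pow_le_mono_l.
  rewrite Nat.add_1_r. apply Nat.lt_le_incl, Nat.log2_spec. lia.
Qed.

Lemma session n Delta s : 32 <= ell Delta -> valid_seq n Delta s ->
  exists m cost A, Session machine (word_size 5 n Delta) n Delta s m cost /\
    Arr (n + Delta + 2) A m /\ (forall x, x < n -> m (8 + x) = A 4 0 0 x) /\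
    Rest n Delta (fun x y => edge s x y = true) (mkSt m A) /\
    cost + kmax main * (ratio Delta * Phi n (lev Delta + 1) (mkSt m A)) <=
      length s * (kmax main * upcost Delta + 130).
Proof.
  intros HD0 Hv. set (N := n + Delta + 2). set (w := word_size 5 n Delta).
  assert (HW : N * N * N * N * N * N <= 2 ^ w).
  { pose proof (word_size_pow 5 n Delta) as H. fold N w in H. simpl Nat.pow in H. lia. }
  assert (HDb : 1000 <= Delta).
  { pose proof (T_le Delta HD0). pose proof (lam_T Delta HD0). pose proof (lam_ge Delta HD0). lia. }
  assert (HN : RR + 8 < N) by (unfold RR, N; lia).
  assert (HNp : 16 * (N * N * N) < 2 ^ w).
  { unfold RR in HN. assert (16 * (N * N * N) < N * N * N * N) by nia.
    assert (N * N * N * N <= N * N * N * N * N) by nia.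
    assert (N * N * N * N * N <= N * N * N * N * N * N) by nia. lia. }
  pose proof (machine_run n Delta w) as Hrun. cbv zeta in Hrun.
  remember (kmax main) as kM eqn:EkM. clear EkM.
  induction s as [|e s IH] using rev_ind.
  - exists init_mem, 0, (fun _ _ _ _ => 0). split; [constructor|].
    split; [intros ? ? ? ? _ _ _ _; reflexivity|]. split; [reflexivity|].
    split; [apply (Rest_init n Delta (2 ^ w)); auto; discriminate|].
    replace (Phi n (lev Delta + 1) (mkSt init_mem (fun _ _ _ _ => 0))) with 0; [simpl; lia|].
    unfold Phi. cbn [ar]. rewrite (sumn_ext _ (fun _ => 0)).
    + rewrite sumn_const. lia.
    + intros. rewrite sumn_const. lia.
  - assert (Hv' := Hv). apply valid_snoc in Hv' as (Hvs & Hu & Hw & Huv & He & Hdeg).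
    destruct (IH Hvs) as (m & cost & A & HS & HA & Hcol & HR & Hc).
    set (m1 := load_input m n Delta e).
    assert (Hm1 : forall x, 5 <= x -> m1 x = m x).
    { intros x Hx. unfold m1, load_input, upd.
      repeat match goal with |- context [x =? ?c] => destruct (Nat.eqb_spec x c); [lia|] end.
      reflexivity. }
    assert (HA1 : Arr N A m1).
    { intros t i j k Hi Hj Hk Ha. rewrite Hm1; [apply HA; auto | unfold RR in Ha; lia]. }
    set (E := fun x y => edge s x y = true).
    set (E' := fun x y => edge (s ++ [e]) x y = true).
    destruct (Hrun A m1 (fun t s' => Rest n Delta E' s' /\
      t + ratio Delta * Phi n (lev Delta + 1) s' <=
      ratio Delta * Phi n (lev Delta + 1) (mkSt m A) + upcost Delta))
      as (m2 & k & t & s' & Hex & Hk & [HR2 Ht] & HA2 & C1 & C2); auto.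
    { intros s0 Hs0 Ha0.
      eapply wp_conseq.
      - apply (wp_main n Delta (2 ^ w) HD0 HW s0 (if ins e then 1 else 0) (eu e) (ev e) E E').
        + rewrite Hs0 by lia. reflexivity.
        + rewrite Hs0 by lia. reflexivity.
        + rewrite Hs0 by lia. reflexivity.
        + rewrite Hs0 by lia. reflexivity.
        + exact Hu.
        + exact Hw.
        + exact Huv.
        + intros a c H. unfold E in *. rewrite edge_sym. exact H.
        + intros a c H. unfold E' in *. rewrite edge_sym. exact H.
        + intros a H. unfold E' in H. rewrite (edge_irrefl n Delta) in H by auto. discriminate.
        + intros Hins. destruct (ins e) eqn:Ei; [|lia]. split.
          * unfold E. rewrite He. discriminate.
          * intros a c. unfold E, E'. rewrite edge_snoc, Ei, <- same_pair_touches.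
            destruct (same_pair a c e); split; auto. intros [H | H]; [auto | discriminate].
        + intros Hins. destruct (ins e) eqn:Ei; [lia|]. split.
          * unfold E. rewrite He. reflexivity.
          * intros a c. unfold E, E'. rewrite edge_snoc, Ei, <- same_pair_touches.
            destruct (same_pair a c e); split; try discriminate; auto.
            -- intros [_ H]. exfalso. auto.
            -- intros [H _]. exact H.
        + intros s1 Hw1 HM1 a Ha. etransitivity; [|apply Hdeg; exact Ha].
          eapply cnt_degree; eauto.
        + destruct s0 as [v0 a0]. simpl in Ha0. subst a0. exact HR.
      - intros t s' [H1 H2]. split; [exact H1|].
        replace (Phi n (lev Delta + 1) s0) with (Phi n (lev Delta + 1) (mkSt m A)) in H2; [exact H2|].
        unfold Phi. rewrite Ha0. reflexivity. }
    exists m2, (cost + k), (ar s'). split; [|split; [|split; [|split]]].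
    + econstructor; [exact HS | exact Hex].
    + exact HA2.
    + intros x Hx. destruct (le_lt_dec RR (8 + x)) as [Hr | Hr].
      * rewrite C2 by lia. destruct HR2 as (_ & _ & HO & _). apply HO; auto.
      * apply C1. lia.
    + exact HR2.
    + rewrite length_app. simpl length.
      change (Phi n (lev Delta + 1) (mkSt m2 (ar s'))) with (Phi n (lev Delta + 1) s').
      set (P1 := Phi n (lev Delta + 1) (mkSt m A)) in *.
      set (P2 := Phi n (lev Delta + 1) s') in *.
      assert (Hkm : kM * (t + ratio Delta * P2) <= kM * (ratio Delta * P1 + upcost Delta))
        by (apply Nat.mul_le_mono_l; exact Ht).
      rewrite !Nat.mul_add_distr_l in Hkm. lia.
Qed.

(** * Asymptotics of the palette and of the update time *)

Lemma pow_le_imp_log2 m x : 2 ^ m <= x -> m <= Nat.log2 x.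
Proof. intros H. apply Nat.log2_le_mono in H. now rewrite Nat.log2_pow2 in H by lia. Qed.

Lemma gg_unbounded m : exists D0, forall Delta, D0 <= Delta -> m <= gg Delta.
Proof.
  exists (2 ^ (2 ^ m)). intros Delta H. unfold gg, ell.
  apply pow_le_imp_log2, pow_le_imp_log2. exact H.
Qed.

(** The relative excess of the palette is 2(L + 1)/k, and 2(L + 1) <= 2l + 6 <= 6l with k = l g
    makes it at most 6/g. *)
Lemma palette_colors Delta : 32 <= ell Delta ->
  pal Delta 0 * gg Delta <= Delta * (gg Delta + 6).
Proof.
  intros HD0. pose proof (pal_le Delta HD0) as H. pose proof (lev_spec Delta HD0) as (_ & _ & HL).
  apply (Nat.mul_le_mono_pos_l _ _ (ell Delta)); [lia|].
  assert (Hk : kap Delta = ell Delta * gg Delta) by reflexivity.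
  assert (H2 : Delta * (kap Delta + 2 * (lev Delta + 1)) <= Delta * (ell Delta * (gg Delta + 6)))
    by (apply Nat.mul_le_mono_l; lia).
  lia.
Qed.

(** The dominant term is [ratio] times the growth of [Phi], one edge for each of at most l + 4 level
    graphs. *)
Lemma upcost_le Delta : 32 <= ell Delta -> upcost Delta <= 4000 * (TT Delta * ell Delta).
Proof.
  intros HD0. pose proof (lev_spec Delta HD0) as (_ & _ & HL).
  pose proof (lam_T Delta HD0). pose proof (lam_ge Delta HD0).
  unfold upcost, ratio, pushcost. set (T := TT Delta) in *. set (l := ell Delta) in *.
  assert (H1 : T * (2 * (lev Delta + 1 + 1)) <= T * (2 * l + 8)) by (apply Nat.mul_le_mono_l; lia).
  assert (H2 : 1000 * l <= T * l) by (apply Nat.mul_le_mono_r; lia).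
  assert (H3 : T * 32 <= T * l) by (apply Nat.mul_le_mono_l; lia).
  lia.
Qed.

(** The cost is of order l^3 g^2. As g^2 (g + 1)^2 <= 2^g <= l, the factor g^2 (g + 1)^2 is traded
    for a fourth factor l, and no correction of the exponent is needed. *)
Lemma upcost_log Delta : 17 <= gg Delta -> 32 <= ell Delta ->
  upcost Delta * ((gg Delta + 1) * (gg Delta + 1)) <=
    4000 * 32 * (ell Delta * ell Delta * (ell Delta * ell Delta)).
Proof.
  intros Hg HD0. pose proof (upcost_le Delta HD0) as H.
  pose proof (log2_lt_pow4 (gg Delta) Hg) as Hp.
  assert (Hl : 2 ^ gg Delta <= ell Delta) by (apply Nat.log2_spec; lia).
  rewrite (T_eq Delta HD0) in H. unfold kap in H.
  set (g := gg Delta) in *. set (l := ell Delta) in *.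
  assert (H1 : g * g * ((g + 1) * (g + 1)) <= l).
  { assert (g * g <= (g + 1) * (g + 1)) by nia.
    assert (g * g * ((g + 1) * (g + 1)) <= (g + 1) * (g + 1) * ((g + 1) * (g + 1)))
      by (apply Nat.mul_le_mono_r; auto). lia. }
  assert (H2 : upcost Delta * ((g + 1) * (g + 1)) <=
    4000 * (32 * (l * g * (l * g)) * l) * ((g + 1) * (g + 1))) by (apply Nat.mul_le_mono_r; exact H).
  assert (H3 : l * l * l * (g * g * ((g + 1) * (g + 1))) <= l * l * l * l)
    by (apply Nat.mul_le_mono_l; exact H1).
  lia.
Qed.

Open Scope R_scope.

Lemma ln_2_bounds : / 2 < ln 2 < 1.
Proof.
  split; [exact ln_lt_2|].
  rewrite <- (ln_exp 1). apply ln_increasing; [lra|].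
  pose proof (exp_ineq1 1). lra.
Qed.

Lemma INR_pow2 m : INR (2 ^ m) = 2 ^ m.
Proof. rewrite pow_INR. reflexivity. Qed.

Lemma ln_INR_bounds x : (0 < x)%nat ->
  INR (Nat.log2 x) / 2 <= ln (INR x) <= INR (Nat.log2 x + 1).
Proof.
  intros Hx. pose proof ln_2_bounds. destruct (Nat.log2_spec x Hx) as [H1 H2].
  apply le_INR in H1. apply lt_INR in H2. rewrite INR_pow2 in *.
  assert (Hp : forall m, 0 < 2 ^ m) by (intros; apply pow_lt; lra).
  split.
  - transitivity (ln (2 ^ Nat.log2 x)).
    + rewrite ln_pow by lra. pose proof (pos_INR (Nat.log2 x)). nra.
    + destruct H1 as [H1 | H1]; [left; apply ln_increasing; auto | rewrite H1; lra].
  - transitivity (ln (2 ^ S (Nat.log2 x))).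
    + left. apply ln_increasing; auto. apply lt_0_INR. exact Hx.
    + rewrite ln_pow by lra. rewrite Nat.add_1_r. pose proof (pos_INR (S (Nat.log2 x))). nra.
Qed.

(** 128000 is 4000 * 32 from the integer bound, and 16 is 2^4 from l <= 2 ln Delta. The lower bound
    1 serves to absorb the constant overhead per update. *)
Lemma upcost_time Delta : (17 <= gg Delta)%nat -> (32 <= ell Delta)%nat ->
  1 <= time_bound (fun _ => 0) Delta /\
  INR (upcost Delta) <= 16 * 128000 * time_bound (fun _ => 0) Delta.
Proof.
  intros Hg HD0. assert (HDp := Delta_pos Delta HD0).
  pose proof (upcost_log Delta Hg HD0) as HN. apply le_INR in HN.
  pose proof (ln_INR_bounds Delta HDp) as [HL1 HL2].
  fold (ell Delta) in *. set (l := ell Delta) in *.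
  assert (Hlp : 32 <= INR l).
  { replace 32 with (INR 32) by (simpl; lra). apply le_INR. exact HD0. }
  pose proof (ln_INR_bounds l ltac:(lia)) as [HG1 HG2].
  change (Nat.log2 l) with (gg Delta) in *. set (g := gg Delta) in *.
  assert (Hgp : 17 <= INR g).
  { replace 17 with (INR 17) by (simpl; lra). apply le_INR. exact Hg. }
  set (x := ln (INR Delta)) in *.
  assert (Hx : INR l / 2 <= x <= INR l + 1) by (rewrite plus_INR in HL2; simpl in HL2; lra).
  assert (Hx16 : 16 <= x) by lra.
  assert (Hy0 : 1 < ln x).
  { rewrite <- (ln_exp 1). apply ln_increasing; [apply exp_pos|]. pose proof exp_le_3. lra. }
  (* ln Delta is at most l + 1, hence at most 2^(g + 1); so its logarithm is at most (g + 1) ln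
     2. *)
  assert (Hy : ln x <= INR g + 1).
  { destruct (Nat.log2_spec l ltac:(lia)) as [_ Hl2].
    assert (Hxl : x <= 2 ^ S g).
    { transitivity (INR (l + 1)); [rewrite plus_INR; simpl; lra|].
      rewrite <- INR_pow2. apply le_INR. change (Nat.log2 l) with g in Hl2. lia. }
    transitivity (ln (2 ^ S g)).
    - destruct Hxl as [Hxl | Hxl]; [left; apply ln_increasing; lra | rewrite Hxl; lra].
    - rewrite ln_pow by lra. rewrite S_INR. pose proof ln_2_bounds. nra. }
  assert (Htb : time_bound (fun _ => 0) Delta = x ^ 4 / (ln x) ^ 2).
  { unfold time_bound. fold x. rewrite Rplus_0_r.
    replace 4 with (INR 4) at 1 by (simpl; lra). rewrite Rpower_pow by lra. reflexivity. }
  rewrite Htb. set (y := ln x) in *.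
  assert (Hyp : 0 < y ^ 2) by (apply pow_lt; lra).
  assert (Hyx : y <= x).
  { unfold y. assert (Hex := exp_ineq1_le (ln x)). rewrite exp_ln in Hex by lra. lra. }
  assert (Hd : x ^ 4 / y ^ 2 * y ^ 2 = x ^ 4) by (field; lra).
  split.
  - apply (Rmult_le_reg_r (y ^ 2)); [exact Hyp|]. rewrite Hd, Rmult_1_l.
    assert (y ^ 2 <= x ^ 2) by (apply pow_incr; lra).
    assert (1 <= x ^ 2) by nra. replace (x ^ 4) with (x ^ 2 * x ^ 2) by ring. nra.
  - apply (Rmult_le_reg_r (y ^ 2)); [exact Hyp|].
    rewrite (Rmult_assoc _ (x ^ 4 / y ^ 2)), Hd.
    rewrite !mult_INR, plus_INR in HN.
    replace (INR 4000) with 4000 in HN by (rewrite INR_IZR_INZ; reflexivity).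
    replace (INR 32) with 32 in HN by (simpl; lra). simpl (INR 1) in HN.
    assert (Hy2 : y ^ 2 <= (INR g + 1) * (INR g + 1)) by (simpl; nra).
    assert (Hup := pos_INR (upcost Delta)).
    assert (Hl4 : INR l * INR l * (INR l * INR l) <= 16 * x ^ 4).
    { assert (Ha : INR l * INR l <= 4 * (x * x)) by nra.
      assert (Hb : 0 <= INR l * INR l) by nra.
      replace (16 * x ^ 4) with (4 * (x * x) * (4 * (x * x))) by ring. nra. }
    assert (INR (upcost Delta) * y ^ 2 <= INR (upcost Delta) * ((INR g + 1) * (INR g + 1)))
      by (apply Rmult_le_compat_l; auto).
    lra.
Qed.

Lemma eps_cv : Un_cv (fun D => 6 / INR (gg D)) 0.
Proof.
  intros e He. destruct (INR_unbounded (6 / e)) as [m Hm].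
  destruct (gg_unbounded (S m)) as [D0 HD]. exists D0. intros D HDn.
  specialize (HD D HDn). apply le_INR in HD. rewrite S_INR in HD.
  assert (H6 : 0 < 6 / e) by (apply Rdiv_lt_0_compat; lra).
  assert (Hg : 6 / e < INR (gg D)) by lra.
  unfold R_dist. rewrite Rminus_0_r, Rabs_pos_eq.
  - apply (Rmult_lt_reg_r (INR (gg D))); [lra|].
    replace (6 / INR (gg D) * INR (gg D)) with 6 by (field; lra).
    apply (Rmult_lt_compat_l e) in Hg; [|auto].
    replace (e * (6 / e)) with 6 in Hg by (field; lra). exact Hg.
  - apply Rlt_le, Rdiv_lt_0_compat; lra.
Qed.

Theorem theorem3 :
  exists (P : program) (c : nat) (eps delta : nat -> R) (C : R) (D0 : nat),
    Un_cv (fun D => eps D) 0 /\ Un_cv (fun D => delta D) 0 /\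
    forall (n Delta : nat), (D0 <= Delta)%nat ->
    forall s : list update, valid_seq n Delta s ->
      exists (m : memory) (cost : nat),
        Session P (word_size c n Delta) n Delta s m cost /\
        INR cost <= C * INR (length s) * time_bound delta Delta /\
        proper_coloring n s (fun x => m (color_cell x)) /\
        (forall x, (x < n)%nat -> INR (m (color_cell x)) < (1 + eps Delta) * INR Delta).
Proof.
  destruct (gg_unbounded 17) as [D0 HD0].
  (* The parameter 5 gives words of six times the bit length of N = n + Delta + 2, so that N^6 <=
     2^w. In the time constant, 130 covers the prologue and the epilogue. *)
  exists machine, 5%nat, (fun D => 6 / INR (gg D)), (fun _ => 0),
    (INR (kmax main) * (16 * 128000) + 130), D0.
  split; [exact eps_cv|]. split.
  { intros e He. exists 0%nat. intros k _. unfold R_dist. rewrite Rminus_0_r, Rabs_R0. exact He. }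
  intros n Delta HD s Hs. specialize (HD0 Delta HD).
  assert (Hell : (32 <= ell Delta)%nat).
  { destruct (le_lt_dec 32 (ell Delta)) as [H | H]; auto. exfalso.
    unfold gg in HD0.
    assert (Hl : (Nat.log2 (ell Delta) <= ell Delta)%nat) by (apply Nat.log2_le_lin; lia).
    assert (Hm : (Nat.log2 (ell Delta) <= Nat.log2 32)%nat) by (apply Nat.log2_le_mono; lia).
    change (Nat.log2 32) with 5%nat in Hm. lia. }
  destruct (session n Delta s Hell Hs) as (m & cost & A & HS & _ & Hcol & HR & Hcost).
  pose proof (word_size_pow 5 n Delta) as HW. cbn [Nat.pow Nat.add] in HW.
  exists m, cost. split; [exact HS|]. split; [|split].
  - destruct (upcost_time Delta HD0 Hell) as [Ht1 Ht2].
    set (tb := time_bound (fun _ => 0) Delta) in *.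
    assert (Hc : (cost <= length s * (kmax main * upcost Delta + 130))%nat) by lia.
    apply le_INR in Hc. rewrite mult_INR, plus_INR, mult_INR in Hc.
    replace (INR 130) with 130 in Hc by (rewrite INR_IZR_INZ; reflexivity).
    pose proof (pos_INR (length s)). pose proof (pos_INR (kmax main)).
    assert (Hk : INR (kmax main) * INR (upcost Delta) <= INR (kmax main) * (16 * 128000 * tb))
      by (apply Rmult_le_compat_l; auto).
    assert (Hs2 : INR (length s) * (INR (kmax main) * INR (upcost Delta) + 130) <=
      INR (length s) * ((INR (kmax main) * (16 * 128000) + 130) * tb))
      by (apply Rmult_le_compat_l; [auto | nra]).
    lra.
  - intros x y Hx Hy HE. unfold color_cell. rewrite !Hcol by auto.
    exact (Rest_proper n Delta _ Hell (le_n _) _ _ x y HR Hx Hy HE).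
  - intros x Hx. unfold color_cell. rewrite Hcol by auto.
    destruct HR as (_ & _ & _ & Hq & _). specialize (Hq x Hx). cbn [ar] in Hq.
    pose proof (palette_colors Delta Hell) as Hp.
    apply lt_INR in Hq. apply le_INR in Hp. rewrite !mult_INR, plus_INR in Hp.
    replace (INR 6) with 6 in Hp by (simpl; lra).
    assert (Hg : 17 <= INR (gg Delta)).
    { replace 17 with (INR 17) by (simpl; lra). apply le_INR. exact HD0. }
    eapply Rlt_le_trans; [exact Hq|].
    apply (Rmult_le_reg_r (INR (gg Delta))); [lra|].
    replace ((1 + 6 / INR (gg Delta)) * INR Delta * INR (gg Delta))
      with (INR Delta * (INR (gg Delta) + 6)) by (field; lra).
    exact Hp.
Qed.
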